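(* Let $\theta_0,\theta_1,\theta_t,\theta_\infty\in\mathbb C$, let $(\kappa_0,\kappa_1,\kappa_t,\kappa_\infty)=(\theta_0,\theta_1,\theta_t,\theta_\infty-1)$ and define $\rho$ by $\kappa_0+\kappa_1+\kappa_t+\kappa_\infty+2\rho=1$. Let $(E_t,\nabla_t)$ be the irreducible isomonodromic deformation of $\mathfrak{sl}(2,\mathbb C)$-Fuchsian systems on $\mathbb P^1$ with poles $0,1,t,\infty$ and exponents $\theta_i$ defined by a solution $q(t)$ of the Painlevé VI equation with parameters $(\kappa_0,\kappa_1,\kappa_t,\kappa_\infty)$, let $p(t)$ be the associated auxiliary variable, and let $t$ be such that $q(t)\neq0,1,t,\infty$. Let $(\tilde E_t'',\tilde\nabla_t'')$ be the elliptic pull-back of the deformation. Then $\tilde E_t''$ is semistable and has Tu invariant $$\lambda(\tilde E_t'')=q(t)+\frac{\rho+\kappa_\infty}{p(t)}.$$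
   Context: Painlevé VI with parameters $(\kappa_0,\kappa_1,\kappa_t,\kappa_\infty)$: $$q''=\tfrac12\left(\tfrac1q+\tfrac1{q-1}+\tfrac1{q-t}\right)q'^2-\left(\tfrac1t+\tfrac1{t-1}+\tfrac1{q-t}\right)q'+\tfrac{q(q-1)(q-t)}{t^2(t-1)^2}\left(\tfrac{\kappa_\infty^2}2-\tfrac{\kappa_0^2}2\tfrac t{q^2}+\tfrac{\kappa_1^2}2\tfrac{t-1}{(q-1)^2}+\tfrac{1-\kappa_t^2}2\tfrac{t(t-1)}{(q-t)^2}\right).$$ Deformation defined by $q(t)$: set $$p=\frac12\left(\frac{t(t-1)}{q(q-1)(q-t)}\frac{dq}{dt}+\frac{\theta_0}{q}+\frac{\theta_1}{q-1}+\frac{\theta_t-1}{q-t}\right),\qquad \boldsymbol p=q(q-1)(q-t)p.$$ $E_t$ is the trivial rank $2$ bundle on $\mathbb P^1$ and $\nabla_t$ is given by the system $\frac{dY}{dx}=\left(\frac{A_0}{x}+\frac{A_1}{x-1}+\frac{A_t}{x-t}\right)Y$, $A_i=\begin{pmatrix}a_i&b_i\\c_i&-a_i\end{pmatrix}$, $a_i^2+b_ic_i=\theta_i^2/4$, with $$a_0=\tfrac{\boldsymbol p}{t}-\tfrac{\kappa_0}2,\quad a_1=-\tfrac{\boldsymbol p}{t-1}-\tfrac{q-1}{t-1}(\rho+\kappa_\infty)-\tfrac{\kappa_1}2,\quad a_t=\tfrac{\boldsymbol p}{t(t-1)}+\tfrac{q-t}{t-1}(\rho+\kappa_\infty)-\tfrac{\kappa_t}2,$$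 $$b_0=-\tfrac qt,\quad b_1=\tfrac{q-1}{t-1},\quad b_t=-\tfrac{q-t}{t(t-1)}$$ (and the $c_i$ determined by $a_i^2+b_ic_i=\theta_i^2/4$); the residue at infinity is $A_\infty=-(A_0+A_1+A_t)=\begin{pmatrix}\theta_\infty/2&0\\ *&-\theta_\infty/2\end{pmatrix}$, and it is assumed that $A_\infty\ne0$. When $q$ solves Painlevé VI this is (up to gauge equivalence) an isomonodromic deformation. Irreducible means that there is no $\nabla_t$-invariant line subbundle. The parabolic structure is $l_i=\ker(A_i+\frac{\theta_i}2I)$, $i=0,1,t$, and $l_\infty=(0:1)$ (the eigenline of $A_\infty$ for $-\frac{\theta_\infty}2$). Elliptic pull-back: let $X_t=\{y^2=x(x-1)(x-t)\}$ (compactified), $\pi:X_t\to\mathbb P^1$, $(x,y)\mapsto x$, $\omega_\infty$ the point at infinity, $\omega_i=(i,0)$ for $i=0,1,t$. For a rank $2$ bundle $E$ on a curve and a line $l\subset E|_p$, $\mathrm{elm}^+_l(E)$ is the bundle whose sections are the meromorphic sections of $E$ with at most a simple pole at $p$ whose polar coefficient lies in $l$; connections are transported through the birational identification. Starting from $(E,\nabla)$ on $\mathbb P^1$ with lines $l_i\subset E|_i$, set $(\tilde E,\tilde\nabla)=\pi^*(E,\nabla)$, $\tilde l_i=\pi^*l_i$; let $(\tilde E',\tilde\nabla')$ be obtained by applying $\mathrm{elm}^+_{\tilde l_i}$ at $\omega_i$ for $i=0,1,t,\infty$, so that $\det\tilde E'\simeq\mathcal O_X(4[\omega_\infty])$;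 finally $(\tilde E'',\tilde\nabla'')=(\tilde E',\tilde\nabla')\otimes(L,\zeta)^{\otimes(-1)}$ where $L=\mathcal O_X(2[\omega_\infty])$ and $\zeta$ is the connection on $L$ with $(L,\zeta)^{\otimes2}\simeq(\det\tilde E',\mathrm{tr}\,\tilde\nabla')$. In particular $\tilde E''=\tilde E'\otimes\mathcal O_X(-2[\omega_\infty])$ has trivial determinant. Tu invariant: the semistable rank $2$ bundles with trivial determinant on $X_t$ are $L\oplus L^{-1}$ with $L=\mathcal O([\omega]-[\omega_\infty])$, $\omega\in X_t$, for which $\lambda=x(\omega)\in\mathbb P^1$, and, for $i=0,1,t,\infty$, the unique non-trivial extension $E_i$ of $L_i=\mathcal O([\omega_i]-[\omega_\infty])$ by itself, for which $\lambda(E_i)=i$. *)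

(* Defs.v *)
From HB Require Import structures.
From mathcomp Require Import all_boot all_order all_algebra all_field.
From mathcomp Require Import complex polyXY qfpoly.
From mathcomp Require Import all_classical all_reals all_analysis.

Set Implicit Arguments.
Unset Strict Implicit.
Unset Printing Implicit Defensive.

Import Order.TTheory GRing.Theory Num.Theory.
Import numFieldNormedType.Exports.

Local Open Scope classical_set_scope.
Local Open Scope ring_scope.

(* A smooth projective curve is presented by its function field, its closed
   points and the local ring of each point inside the function field.  The last
   field is d/dx on the function field for a fixed non-constant function x; it
   trivializes the module of rational 1-forms by dx. *)
Record curve (C : fieldType) := Curve {
  fnf : fieldType;
  cst : C -> fnf;
  pnt : choiceType;
  loc : pnt -> set fnf;
  der : fnf -> fnf }.

Section Bundles.
Variables (C : fieldType) (X : curve C).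
Local Notation K := (fnf X).

Definition maxid (P : pnt X) : set K :=
  [set f | loc P f /\ (f = 0 \/ ~ loc P f^-1)].

Definition uniformizer (P : pnt X) (z : K) : Prop :=
  maxid P z /\ forall f, maxid P f -> exists2 g, loc P g & f = g * z.

(* Vector bundles are given by their stalks: a bundle of rank r is a locally
   free subsheaf of the constant sheaf K^r (choose a rational trivialization),
   i.e. a family of lattices indexed by the points. Line bundles are the
   case of V = K^o, rank 2 bundles that of V = 'cV[K]_2. *)
Definition stalks (V : Type) := pnt X -> set V.

Definition span (V : lmodType K) (P : pnt X) (S : set V) : set V :=
  [set v | exists s : seq (K * V),
     (forall c, c \in s -> loc P c.1 /\ S c.2) /\
     v = \sum_(c <- s) c.1 *: c.2].

Definition trivial_bundle : stalks 'cV[K]_2 :=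
  fun P => [set v | forall i, loc P (v i 0)].

Definition is_bundle (E : stalks 'cV[K]_2) : Prop :=
  (forall P, exists2 g : 'M[K]_2, g \in unitmx &
     forall v, E P v <-> trivial_bundle P (invmx g *m v)) /\
  finite_set [set P | E P <> trivial_bundle P].

Definition bundle_iso (E F : stalks 'cV[K]_2) : Prop :=
  exists2 g : 'M[K]_2, g \in unitmx & forall P v, E P v <-> F P (g *m v).

(* The line bundle O(D): sections f with div f + D >= 0. *)
Definition OD (D : pnt X -> int) : stalks K^o :=
  fun P => [set f | exists2 z, uniformizer P z & loc P (f * z ^ D P)].

Definition has_degree (M : stalks K^o) (d : int) : Prop :=
  exists D : pnt X -> int,
    [/\ finite_set [set P | D P <> 0],
        forall P f, M P f <-> OD D P f
      & d = \sum_(P \in [set: pnt X]) D P].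

Definition det_bundle (E : stalks 'cV[K]_2) : stalks K^o :=
  fun P => span P [set f : K^o | exists v w, [/\ E P v, E P w
                     & f = v 0 0 * w 1 0 - v 1 0 * w 0 0]].

Definition tens (V : lmodType K) (M : stalks K^o) (E : stalks V) : stalks V :=
  fun P => span P [set u : V | exists f v, [/\ M P f, E P v
                     & u = (f : K) *: v]].

Definition dual_line (M : stalks K^o) : stalks K^o :=
  fun P => [set f | forall g : K, M P g -> loc P ((f : K) * g)].

Definition dsum (M N : stalks K^o) : stalks 'cV[K]_2 :=
  fun P => [set v | M P (v 0 0) /\ N P (v 1 0)].

(* Line subbundles of E (saturated) correspond to the lines K s of the generic
   fibre; s identifies the line subbundle E \cap K s with a line bundle. *)
Definition line_sub (E : stalks 'cV[K]_2) (s : 'cV[K]_2) : stalks K^o :=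
  fun P => [set f | E P ((f : K) *: s)].

Definition semistable (E : stalks 'cV[K]_2) : Prop :=
  forall s : 'cV[K]_2, s != 0 ->
  exists m e : int, [/\ has_degree (line_sub E s) m,
                        has_degree (det_bundle E) e & m *+ 2 <= e].

(* E is an extension 0 -> M -> E -> N -> 0, in generic coordinates adapted to
   the inclusion of M and the projection onto N. *)
Definition extension (M N : stalks K^o) (E : stalks 'cV[K]_2) : Prop :=
  is_bundle E /\ forall P,
    (forall f : K, M P f <-> E P (\col_i (if i == 0 then f else 0))) /\
    (forall g : K, N P g <-> exists2 v, E P v & v 1 0 = g).

(* a morphism N -> E that is a section of E -> N *)
Definition split_extension (N : stalks K^o) (E : stalks 'cV[K]_2) : Prop :=
  exists h : K, forall P (g : K), N P g ->
    E P (\col_i (if i == 0 then h * g else g)).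

Definition nontrivial_self_extension (M : stalks K^o) (E : stalks 'cV[K]_2) :=
  exists F, [/\ bundle_iso E F, extension M M F & ~ split_extension M F].

(* A line in the fibre E_P / m_P E_P is represented by its preimage in E_P.
   [trivial_line P l] is the line l of C^2 in the fibre of the trivial bundle. *)
Definition trivial_line (P : pnt X) (l : set 'cV[C]_2) : set 'cV[K]_2 :=
  [set v | trivial_bundle P v /\
     exists2 a, l a & forall i, maxid P (v i 0 - cst X (a i 0))].

Definition elm (p : pnt X) (l : set 'cV[K]_2) (E : stalks 'cV[K]_2) :
    stalks 'cV[K]_2 :=
  fun P => if P == p then [set v | exists2 z, uniformizer p z & l (z *: v)]
           else E P.

(* A meromorphic connection is v |-> dv + N v dx on the generic fibre, for a
   matrix N; on line bundles N is a scalar. *)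
Definition nabla (N : 'M[K]_2) (v : 'cV[K]_2) : 'cV[K]_2 :=
  map_mx (@der C X) v + N *m v.

Definition irreducible_connection (N : 'M[K]_2) : Prop :=
  forall s : 'cV[K]_2, s != 0 -> ~ exists g : K, nabla N s = g *: s.

Definition line_conn_iso (M1 : stalks K^o) (z1 : K)
    (M2 : stalks K^o) (z2 : K) : Prop :=
  exists2 g : K, g != 0 &
    (forall P (f : K), M1 P f <-> M2 P (g * f)) /\
    (forall f : K, der (g * f) + z2 * (g * f) = g * (der f + z1 * f)).

End Bundles.

Section ProjectiveLine.
Variable C : fieldType.
Local Notation K0 := {fraction {poly C}}.
Local Notation iF := (@FracField.tofrac {poly C}).

Definition ratC (c : C) : K0 := iF c%:P.
Definition ratX : K0 := iF 'X.

Definition rat_der (f : K0) : K0 :=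
  let: (a, b) := fraction.frac (generic_quotient.repr f) in
  iF (a^`() * b - a * b^`()) / iF b ^+ 2.

(* None is the point at infinity; the local coordinates are x - a and 1/x *)
Definition P1_loc (P : option C) : set K0 :=
  let: (xi, a) := if P is Some a then (ratX, a) else (ratX^-1, 0) in
  [set f | exists u v : {poly C},
     v.[a] <> 0 /\ f * (map_poly ratC v).[xi] = (map_poly ratC u).[xi]].

Definition P1 : curve C := @Curve C K0 ratC (option C) P1_loc rat_der.

End ProjectiveLine.

Section EllipticCurve.
Variables (C : fieldType) (t : C).
Local Notation K0 := {fraction {poly C}}.
Local Notation iF := (@FracField.tofrac {poly C}).

Definition cubic : {poly C} := 'X * ('X - 1%:P) * ('X - t%:P).

Definition ell_poly : {poly K0} := 'X^2 - (iF cubic)%:P.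

Lemma ell_poly_size : size ell_poly = 3.
Proof.
rewrite /ell_poly size_polyDl ?size_polyXn // size_polyN size_polyC.
by case: (_ != 0).
Qed.

Lemma ell_poly_monic : ell_poly \is monic.
Proof.
rewrite monicE /ell_poly lead_coefDl ?lead_coefXn //.
by rewrite size_polyXn size_polyN size_polyC; case: (_ != 0).
Qed.

Lemma size_cubic : size cubic = 4.
Proof.
rewrite /cubic size_Mmonic ?monicXsubC //; last first.
  by rewrite mulf_neq0 ?polyX_eq0 // polyXsubC_eq0.
by rewrite size_Mmonic ?polyX_eq0 ?monicXsubC // !size_XsubC size_polyX.
Qed.

Lemma cubic_not_square (r : K0) : r ^+ 2 <> iF cubic.
Proof.
have [n [d [d0 ->]]] : exists n d : {poly C}, d != 0 /\ r = iF n / iF d.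
  exists (fraction.frac (generic_quotient.repr r)).1.
  exists (fraction.frac (generic_quotient.repr r)).2; split; first exact: denom_ratioP.
  rewrite -[LHS](generic_quotient.reprK r); case: (generic_quotient.repr r) => -[n d] /= d0.
  have iFd : iF d != 0 by rewrite tofrac_eq0.
  apply: (mulIf iFd); rewrite mulfVK //.
  rewrite /FracField.tofrac; unlock.
  rewrite -[LHS](FracField.pi_mul).
  apply/eqmodP; rewrite /= FracField.equivfE /FracField.mulf.
  by rewrite !numden_Ratio ?mulf_neq0 ?oner_eq0 //= !mulr1 mulrC.
have iFd : iF d != 0 by rewrite tofrac_eq0.
rewrite expr_div_n => /(canRL (divfK (expf_neq0 2 iFd))).
rewrite -!tofracXn -tofracM => /eqP; rewrite tofrac_eq => /eqP E.
have cub0 : cubic != 0 by rewrite -size_poly_eq0 size_cubic.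
have n0 : n != 0.
  apply: contra_eq_neq E => ->; rewrite expr0n /= eq_sym.
  by rewrite mulf_neq0 ?expf_neq0.
have := congr1 (fun p : {poly C} => size p) E.
rewrite /= [size (cubic * _)]size_mul ?expf_neq0 // size_cubic !expr2 !size_mul //.
have : (0 < size n)%N by rewrite size_poly_gt0.
have : (0 < size d)%N by rewrite size_poly_gt0.
case: (size n) => // a; case: (size d) => // b _ _.
rewrite !addSn !addnS /= => /(congr1 odd).
by rewrite !oddS !oddD !addbb.
Qed.

Lemma ell_poly_mi : monic_irreducible_poly ell_poly.
Proof.
split; last exact: ell_poly_monic.
apply: cubic_irreducible; first by rewrite ell_poly_size.
move=> r; apply/negP; rewrite rootE /ell_poly !hornerE subr_eq0 => /eqP.
exact: cubic_not_square.
Qed.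

(* function field C(x)[y] / (y^2 - x(x-1)(x-t)) *)
Definition ell_field : fieldType := {poly %/ ell_poly with ell_poly_mi}.

Definition ell_inj (f : K0) : ell_field := qpolyC ell_poly f.
Definition ellC (c : C) : ell_field := ell_inj (ratC c).
Definition ellX : ell_field := ell_inj (ratX C).
Definition ellY : ell_field := qpolyX ell_poly.

(* d/dx (f0 + f1 y) = f0' + f1' y + f1 c'(x) / (2y), where y^2 = c(x);
   the coefficients f0, f1 are those of the reduced representative *)
Definition ell_der (f : ell_field) : ell_field :=
  let r : {poly K0} := polyn (f : {poly %/ ell_poly}) in
  ell_inj (rat_der r`_0) + ell_inj (rat_der r`_1) * ellY
  + ell_inj (r`_1 * iF cubic^`()) / (2%:R * ellY).

(* None is the point at infinity *)
Definition ell_point : choiceType :=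
  option {ab : C * C | ab.2 ^+ 2 == ab.1 * (ab.1 - 1) * (ab.1 - t)}.

(* plane charts: (x, y) near an affine point (a, b); near infinity
   (x/y, 1/y), in which the curve is smooth at (0, 0) *)
Definition ell_loc (P : ell_point) : set ell_field :=
  let: (xi, eta, (a, b)) :=
    if P is Some ab then (ellX, ellY, sval ab)
    else (ellX / ellY, ellY^-1, (0, 0)) in
  [set f | exists u v : {poly {poly C}}, v.[a, b] <> 0 /\
     f * (map_poly (map_poly ellC) v).[xi, eta]
     = (map_poly (map_poly ellC) u).[xi, eta]].

Definition Ell : curve C := @Curve C ell_field ellC ell_point ell_loc ell_der.

Definition ell_pi (P : ell_point) : option C :=
  if P is Some ab then Some (sval ab).1 else None.

Lemma w0_proof : (0 : C) ^+ 2 == 0 * (0 - 1) * (0 - t).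
Proof. by rewrite expr0n !mul0r. Qed.
Lemma w1_proof : (0 : C) ^+ 2 == 1 * (1 - 1) * (1 - t).
Proof. by rewrite subrr mulr0 mul0r expr0n. Qed.
Lemma wt_proof : (0 : C) ^+ 2 == t * (t - 1) * (t - t).
Proof. by rewrite subrr mulr0 expr0n. Qed.

Definition w0 : pnt Ell := Some (exist _ (0, 0) w0_proof).
Definition w1 : pnt Ell := Some (exist _ (1, 0) w1_proof).
Definition wt : pnt Ell := Some (exist _ (t, 0) wt_proof).
Definition woo : pnt Ell := None.

Definition pullback (E : stalks (P1 C) 'cV[K0]_2) : stalks Ell 'cV[ell_field]_2 :=
  fun P => @span C Ell 'cV[ell_field]_2 P
    [set u | exists2 v, E (ell_pi P) v & u = map_mx ell_inj v].

(* pi^* l at P, for a line l in the fibre of E at pi(P); m_P (pi^* E)_P has to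
   be added since pi may be ramified at P *)
Definition pullback_line (E : stalks (P1 C) 'cV[K0]_2) (P : pnt Ell)
    (l : set 'cV[K0]_2) : set 'cV[ell_field]_2 :=
  @span C Ell 'cV[ell_field]_2 P
    [set u | (exists2 v, l v & u = map_mx ell_inj v) \/
             (exists f v, [/\ @maxid C Ell P f, pullback E P v & u = f *: v])].

(* (E'', N'') is the elliptic pull-back of (E, N) with the lines l0, l1, lt, loo
   in the fibres of E at 0, 1, t, infinity *)
Definition elliptic_pullback
    (E : stalks (P1 C) 'cV[K0]_2) (N : 'M[K0]_2) (l0 l1 lt loo : set 'cV[K0]_2)
    (E'' : stalks Ell 'cV[ell_field]_2) (N'' : 'M[ell_field]_2) : Prop :=
  let E' := @elm C Ell woo (pullback_line E woo loo)
           (@elm C Ell wt (pullback_line E wt lt)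
           (@elm C Ell w1 (pullback_line E w1 l1)
           (@elm C Ell w0 (pullback_line E w0 l0) (pullback E)))) in
  let N' := map_mx ell_inj N in
  let L := @OD C Ell (fun P => 2 * (P == woo)%:R) in
  exists zeta : ell_field,
    [/\ @line_conn_iso C Ell (tens L L) (zeta + zeta)
                             (det_bundle E') (\tr N'),
        E'' = tens (dual_line L) E'
      & N'' = N' - zeta%:M].

(* O([w] - [w_oo]) *)
Definition pic0 (w : pnt Ell) : stalks Ell (ell_field^o) :=
  @OD C Ell (fun P => (P == w)%:R - (P == woo)%:R).

(* The Tu invariant of E is the point lambda of P^1 (None is infinity). *)
Definition Tu_invariant (E : stalks Ell 'cV[ell_field]_2) (lambda : option C) :
    Prop :=
  exists w : pnt Ell, ell_pi w = lambda /\
    (bundle_iso E (dsum (pic0 w) (dual_line (pic0 w))) \/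
     (w \in [:: w0; w1; wt; woo] /\ nontrivial_self_extension (pic0 w) E)).

End EllipticCurve.

Section PainleveVI.
Variable C : numClosedFieldType.

Definition PVI_rhs (k0 k1 kt koo t q q' : C) : C :=
  2^-1 * (q^-1 + (q - 1)^-1 + (q - t)^-1) * q' ^+ 2
  - (t^-1 + (t - 1)^-1 + (q - t)^-1) * q'
  + q * (q - 1) * (q - t) / (t ^+ 2 * (t - 1) ^+ 2) *
    (koo ^+ 2 / 2 - k0 ^+ 2 / 2 * (t / q ^+ 2)
     + k1 ^+ 2 / 2 * ((t - 1) / (q - 1) ^+ 2)
     + (1 - kt ^+ 2) / 2 * (t * (t - 1) / (q - t) ^+ 2)).

(* q is a holomorphic solution on the open set D, which avoids the fixed
   singularities 0, 1 and the poles of q *)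
Definition PVI_solution (k0 k1 kt koo : C) (D : set C) (q : C -> C) : Prop :=
  open D /\ forall s, D s ->
    [/\ s <> 0, s <> 1, derivable q s 1, derivable (derive1 q) s 1
      & q s <> 0 -> q s <> 1 -> q s <> s ->
        derive1 (derive1 q) s = PVI_rhs k0 k1 kt koo s (q s) (derive1 q s)].

Definition PVI_p (th0 th1 tht : C) (q : C -> C) (t : C) : C :=
  2^-1 * (t * (t - 1) / (q t * (q t - 1) * (q t - t)) * derive1 q t
          + th0 / q t + th1 / (q t - 1) + (tht - 1) / (q t - t)).

(* the matrix (a, b; c, -a) with a^2 + b c = th^2 / 4, for b != 0 *)
Definition residue (th a b : C) : 'M[C]_2 :=
  \matrix_(i, j) (if i == 0 then if j == 0 then a else b
                  else if j == 0 then (th ^+ 2 / 4 - a ^+ 2) / b else - a).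

Section Residues.
Variables (th0 th1 tht k0 k1 kt koo rho t q p : C).
Let bp : C := q * (q - 1) * (q - t) * p.

Definition res0 : 'M[C]_2 := residue th0 (bp / t - k0 / 2) (- (q / t)).

Definition res1 : 'M[C]_2 :=
  residue th1
    (- (bp / (t - 1)) - (q - 1) / (t - 1) * (rho + koo) - k1 / 2)
    ((q - 1) / (t - 1)).

Definition rest : 'M[C]_2 :=
  residue tht
    (bp / (t * (t - 1)) + (q - t) / (t - 1) * (rho + koo) - kt / 2)
    (- ((q - t) / (t * (t - 1)))).

End Residues.

(* the connection d - (A0/x + A1/(x-1) + At/(x-t)) dx of dY/dx = A Y *)
Definition fuchs_connection (t : C) (A0 A1 At : 'M[C]_2) : 'M[fnf (P1 C)]_2 :=
  let x := ratX C in
  - (x^-1 *: map_mx (@ratC C) A0 + (x - 1)^-1 *: map_mx (@ratC C) A1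
     + (x - ratC t)^-1 *: map_mx (@ratC C) At).

Definition eigenline (A : 'M[C]_2) (th : C) : set 'cV[C]_2 :=
  [set v | (A + (th / 2)%:M) *m v = 0].

Definition line_0_1 : set 'cV[C]_2 := [set v | v 0 0 = 0].

End PainleveVI.

(* Main.v *)
From HB Require Import structures.
Require Import Defs.
From mathcomp Require Import all_boot all_order all_algebra all_field.
From mathcomp Require Import complex polyXY qfpoly.
From mathcomp Require Import all_classical all_reals all_analysis.
From mathcomp Require Import zify ring.
Set Implicit Arguments.
Unset Strict Implicit.
Unset Printing Implicit Defensive.
Import Order.TTheory GRing.Theory Num.Theory.
Import numFieldNormedType.Exports.
Local Open Scope classical_set_scope.
Local Open Scope ring_scope.

(** Let [r = rho + kappa_oo].  The line [l_i] has slope [m_i], where [m_0], [m_1],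
    [m_t] are the values at [0, 1, t] of the polynomial
    [M = p x^2 + (p (q - t - 1) + r) x + p (q - 1) (q - t)].  In the coordinates
    [u_0 = y v_0], [u_1 = v_1 - M v_0] the bundle is therefore trivial over the affine
    curve, and only its lattice at infinity depends on [q] and [p].

    If [p <> 0], put [lambda = q + r / p] and let [w = (lambda, mu)] be a point of the
    curve.  Since [M (x - lambda) - p x (x - 1) (x - t)] has degree at most 1, the
    vector [(x - lambda, - p (y - mu))] generates a line subbundle [O(w - w_oo)].  When
    [mu <> 0] the one attached to [(lambda, - mu)] is a complement.  When [mu = 0] the
    quotient is again isomorphic to [O(w - w_oo)], so that the bundle is either the
    non-trivial self-extension or split.  If [p = 0] then [r <> 0], because otherwise
    [(1, 0)] would be a common eigenvector of the residues, and the bundle is an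
    extension of [O] by [O].

    In all cases it is an extension of line bundles of degree 0, hence semistable,
    because principal divisors have degree 0: a function and its conjugate have the
    same degree, and their product is a rational function of [x]. *)

(** Put [c(x) = x (x - 1) (x - t)]. Because [kappa_i = theta_i], the slope
    [- (a_i + theta_i / 2) / b_i] of [l_i] simplifies to [p c(q) / (q - i) + i r] for [i = 0, 1, t].
    The divided difference [(c(q) - c(x)) / (q - x)] takes the value [c(q) / (q - i)] at each root
    [i] of [c], whence [M = p (c(q) - c(x)) / (q - x) + r x].

    The value of [lambda] is forced at infinity. The coefficient of [x^2] in [M (x - lambda) - p c]
    is [r + p (q - lambda)], which vanishes only for [lambda = q + r / p]. The lattice at infinity
    asks [u_0] to have at most a simple pole and [u_1 + (M / y) u_0] to vanish. On
    [(x - lambda, - p (y - mu))] the second expression is [p mu + L / y] with [L] of degree at most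
    1; it is regular, since [y] has a triple pole and [L] at most a double one. Hence a multiple [f]
    of this vector lies in the lattice at infinity exactly when [f] vanishes there. At affine points
    the two entries have only [w] as a common zero, which leaves [O(w - w_oo)]. *)

Section Columns.
Variable K : fieldType.

Definition cv2 (a b : K) : 'cV[K]_2 := \col_i (if i == 0 then a else b).

Definition mx2 (a b c d : K) : 'M[K]_2 :=
  \matrix_(i, j) (if i == 0 then if j == 0 then a else b
                  else if j == 0 then c else d).

Lemma cv20 a b : cv2 a b 0 0 = a. Proof. by rewrite mxE. Qed.
Lemma cv21 a b : cv2 a b 1 0 = b. Proof. by rewrite mxE. Qed.

Lemma ord2P (P : 'I_2 -> Prop) : (forall i, P i) <-> P 0 /\ P 1.
Proof.
split=> [h|[h0 h1] [[|[|//]] hi]]; first by split; apply: h.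
  by rewrite (_ : Ordinal hi = 0) //; apply: val_inj.
by rewrite (_ : Ordinal hi = 1) //; apply: val_inj.
Qed.

Lemma col2P (v w : 'cV[K]_2) : v 0 0 = w 0 0 -> v 1 0 = w 1 0 -> v = w.
Proof.
move=> h0 h1; apply/matrixP => i j; rewrite (ord1 j).
by move: i; apply/ord2P.
Qed.

Lemma cv2_eta (v : 'cV[K]_2) : v = cv2 (v 0 0) (v 1 0).
Proof. by apply: col2P; rewrite mxE. Qed.

Lemma mulmx_col2 (g : 'M[K]_2) (v : 'cV[K]_2) (i : 'I_2) :
  (g *m v) i 0 = g i 0 * v 0 0 + g i 1 * v 1 0.
Proof. by rewrite mxE big_ord_recl big_ord1; congr (_ + g i _ * v _ _); apply: val_inj. Qed.

Lemma mx2_cv2 a b c d x y :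
  mx2 a b c d *m cv2 x y = cv2 (a * x + b * y) (c * x + d * y).
Proof. by apply: col2P; rewrite mulmx_col2 !mxE. Qed.

Lemma mx2P (g h : 'M[K]_2) :
  (forall x y, g *m cv2 x y = h *m cv2 x y) -> g = h.
Proof.
move=> gh; have e (v : 'cV[K]_2) : g *m v = h *m v by rewrite (cv2_eta v) gh.
apply/matrixP => i; apply/ord2P; split.
  by have /matrixP/(_ i 0) := e (cv2 1 0); rewrite !mulmx_col2 !mxE /= !mulr1 !mulr0 !addr0.
by have /matrixP/(_ i 0) := e (cv2 0 1); rewrite !mulmx_col2 !mxE /= !mulr1 !mulr0 !add0r.
Qed.

Lemma det_mx2 (g : 'M[K]_2) : \det g = g 0 0 * g 1 1 - g 0 1 * g 1 0.
Proof.
rewrite (expand_det_row _ 0) big_ord_recl big_ord1 /cofactor !det_mx11 !mxE /=.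
rewrite expr0 mul1r expr1 mulN1r mulrN.
by congr (g _ _ * g _ _ - g _ _ * g _ _); apply: val_inj.
Qed.

Lemma unitmx_mx2 a b c d : a * d - b * c != 0 -> mx2 a b c d \in unitmx.
Proof. by move=> h; rewrite unitmxE det_mx2 !mxE /= unitfE. Qed.

Lemma inv_mx2 (A B : 'M[K]_2) : (forall x y, A *m (B *m cv2 x y) = cv2 x y) ->
  [/\ A \in unitmx, B \in unitmx & invmx A = B].
Proof.
move=> h; have AB : A *m B = 1%:M.
  by apply: mx2P => x y; rewrite -mulmxA h mul1mx.
have [uA uB] := mulmx1_unit AB; split=> //.
by rewrite -[RHS]mul1mx -(mulVmx uA) -mulmxA AB mulmx1.
Qed.

Definition det2 (v w : 'cV[K]_2) : K := v 0 0 * w 1 0 - v 1 0 * w 0 0.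

Lemma det2_mulmx (g : 'M[K]_2) (v w : 'cV[K]_2) : det2 (g *m v) (g *m w) = \det g * det2 v w.
Proof. by rewrite /det2 !mulmx_col2 det_mx2; ring. Qed.

End Columns.

(** * Finitely supported divisors and their degrees *)

Section FiniteSupport.
Variable T : choiceType.
Implicit Types D : T -> int.

Definition finsupp D := finite_set [set P | D P <> 0].

Lemma finsupp_sub D (A : set T) : finite_set A ->
  (forall P, ~ A P -> D P = 0) -> finsupp D.
Proof.
move=> fA h; apply: sub_finite_set fA => P /= DP.
by apply: contra_notP DP => /h.
Qed.

Lemma fsum_supp D (A : set T) : finite_set A -> (forall P, ~ A P -> D P = 0) ->
  \sum_(P \in [set: T]) D P = \sum_(P \in A) D P.
Proof.
move=> fA h; apply/esym/fsbig_widen => //.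
by move=> P [_ nA]; apply: h.
Qed.

Lemma finsuppD D D' : finsupp D -> finsupp D' -> finsupp (fun P => D P + D' P).
Proof.
move=> h h'; apply: (@finsupp_sub _ ([set P | D P <> 0] `|` [set P | D' P <> 0])).
  by rewrite finite_setU.
by move=> P /not_orP[/contrapT + /contrapT +] /= => -> ->; rewrite addr0.
Qed.

Lemma finsuppN D : finsupp D -> finsupp (fun P => - D P).
Proof.
move=> h; by apply: (finsupp_sub h) => P /contrapT /= ->; rewrite oppr0.
Qed.

Lemma fsumD D D' : finsupp D -> finsupp D' ->
  \sum_(P \in [set: T]) (D P + D' P) =
  \sum_(P \in [set: T]) D P + \sum_(P \in [set: T]) D' P.
Proof.
move=> h h'; pose A := [set P | D P <> 0] `|` [set P | D' P <> 0].
have fA : finite_set A by rewrite finite_setU.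
have hA P : ~ A P -> D P = 0 /\ D' P = 0.
  by move=> /not_orP[/contrapT -> /contrapT ->].
rewrite !(fsum_supp fA) ?fsbig_split //; by move=> P /hA[h1 h2]; rewrite /= ?h1 ?h2.
Qed.

Lemma fsumN D : finsupp D ->
  \sum_(P \in [set: T]) (- D P) = - \sum_(P \in [set: T]) D P.
Proof.
move=> h; apply/eqP; rewrite -subr_eq0 opprK -fsumD //; last exact: finsuppN.
by rewrite fsbig1 // => P _; rewrite addNr.
Qed.

Lemma fsum_le D D' : finsupp D -> finsupp D' -> (forall P, D P <= D' P) ->
  \sum_(P \in [set: T]) D P <= \sum_(P \in [set: T]) D' P.
Proof.
move=> h h' le; rewrite -subr_ge0 -fsumN // -fsumD //; last exact: finsuppN.
by apply: fsumr_ge0 => P _; rewrite subr_ge0.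
Qed.

Lemma finsupp_pt (Q : T) : finsupp (fun P => (P == Q)%:R).
Proof.
apply: (@finsupp_sub _ [set Q]) => // P /= h.
by case: eqP => // e; case: h.
Qed.

Lemma fsum_pt (Q : T) : \sum_(P \in [set: T]) ((P == Q)%:R : int) = 1.
Proof.
rewrite (@fsum_supp _ [set Q]) ?fsbig_set1 ?eqxx // => P /= h.
by case: eqP => // e; case: h.
Qed.

End FiniteSupport.

(** * Orders of vanishing and divisors *)

(* [ord P 0] is unconstrained; [vge] below treats 0 as vanishing to every order. *)
Record curve_order (C : fieldType) (X : curve C)
    (ord : pnt X -> fnf X -> int) : Prop := CurveOrder {
  ord_loc0 : forall P, loc P (0 : fnf X);
  ord_locD : forall P (f g : fnf X), loc P f -> loc P g -> loc P (f + g);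
  ord_locP : forall P (f : fnf X), f != 0 -> loc P f <-> 0 <= ord P f;
  ordM : forall P (f g : fnf X), f != 0 -> g != 0 ->
    ord P (f * g) = ord P f + ord P g;
  ord_unif : forall P, exists2 z : fnf X, z != 0 & ord P z = 1;
  ord_finsupp : forall f : fnf X, f != 0 -> finsupp (ord^~ f);
  ord_degree0 : forall f : fnf X, f != 0 ->
    \sum_(P \in [set: pnt X]) ord P f = 0 }.

Section CurveOrder.
Variables (C : fieldType) (X : curve C) (ord : pnt X -> fnf X -> int).
Hypothesis ordX : curve_order ord.
Local Notation K := (fnf X).
Implicit Types (P : pnt X) (f g z : K) (n m : int).

Definition vge P n f := (f == 0) || (n <= ord P f).

Lemma ord1 P : ord P 1 = 0.
Proof.
have /esym/eqP := ordM ordX P (oner_neq0 K) (oner_neq0 K).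
by rewrite mulr1 -[X in _ == X]addr0 (inj_eq (addrI _)) => /eqP.
Qed.

Lemma ordV P f : f != 0 -> ord P f^-1 = - ord P f.
Proof.
move=> f0; have := ordM ordX P f0 (invr_neq0 f0); rewrite divff // ord1 => /esym/eqP.
by rewrite addrC addr_eq0 => /eqP.
Qed.

Lemma ordXn P f (n : nat) : f != 0 -> ord P (f ^+ n) = ord P f *+ n.
Proof.
move=> f0; elim: n => [|n IH]; first by rewrite ord1.
by rewrite exprS (ordM ordX) // ?expf_neq0 // IH mulrS.
Qed.

Lemma ordXz P f n : f != 0 -> ord P (f ^ n) = n * ord P f.
Proof.
move=> f0; case: n => n; first by rewrite -exprnP ordXn // -mulr_natl natz.
rewrite NegzE -exprz_inv -exprnP ordXn ?invr_eq0 // ordV // -mulr_natl natz; ring.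
Qed.

Lemma vge0 P n : vge P n 0.
Proof. by rewrite /vge eqxx. Qed.

Lemma vgeE P n f : f != 0 -> vge P n f = (n <= ord P f).
Proof. by rewrite /vge => /negPf ->. Qed.

Lemma vge_loc P f : loc P f <-> vge P 0 f.
Proof.
have [->|f0] := eqVneq f 0; last by rewrite vgeE //; exact: (ord_locP ordX).
by rewrite vge0; split=> // _; exact: (ord_loc0 ordX).
Qed.

Lemma vgeW P m n f : m <= n -> vge P n f -> vge P m f.
Proof. by rewrite /vge => mn /orP[->//|h]; rewrite (le_trans mn h) orbT. Qed.

Lemma vgeM P m n f g : vge P m f -> vge P n g -> vge P (m + n) (f * g).
Proof.
have [->|f0] := eqVneq f 0; first by rewrite mul0r !vge0.
have [->|g0] := eqVneq g 0; first by rewrite mulr0 !vge0.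
by rewrite !vgeE ?mulf_neq0 // (ordM ordX) //; apply: lerD.
Qed.

Lemma vgeMl P m n k f g : k <= m + n -> vge P m f -> vge P n g -> vge P k (f * g).
Proof. by move=> h hf hg; apply: (vgeW h); exact: vgeM. Qed.

Lemma vge_mulr P n f g : g != 0 -> vge P n (f * g) = vge P (n - ord P g) f.
Proof.
move=> g0; have [->|f0] := eqVneq f 0; first by rewrite mul0r !vge0.
by rewrite !vgeE ?mulf_neq0 // (ordM ordX) // lerBlDr.
Qed.

Lemma vge_mull P n f g : g != 0 -> vge P n (g * f) = vge P (n - ord P g) f.
Proof. by rewrite mulrC; apply: vge_mulr. Qed.

(** Multiplying by a power of an element of order 1 reduces to [n = 0], where the claim is that the
    local ring is closed under addition. *)
Lemma vgeD P n f g : vge P n f -> vge P n g -> vge P n (f + g).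
Proof.
have [z z0 oz] := ord_unif ordX P.
have e h : vge P n h = vge P 0 (h * z ^ (- n)).
  by rewrite vge_mulr ?expfz_neq0 // ordXz // oz mulr1 sub0r opprK.
by rewrite !e mulrDl => /vge_loc hf /vge_loc hg; apply/vge_loc/(ord_locD ordX).
Qed.

(** As [(-1)^2 = 1], twice the order of [-1] is 0. *)
Lemma ordN P f : ord P (- f) = ord P f.
Proof.
have [->|f0] := eqVneq f 0; first by rewrite oppr0.
have N1 : (-1 : K) != 0 by rewrite oppr_eq0 oner_neq0.
have := ordM ordX P N1 N1; rewrite mulrNN mulr1 ord1 => h.
by rewrite -mulN1r (ordM ordX) //; lia.
Qed.

Lemma vgeN P n f : vge P n (- f) = vge P n f.
Proof. by rewrite /vge oppr_eq0 ordN. Qed.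

Lemma vgeB P n f g : vge P n f -> vge P n g -> vge P n (f - g).
Proof. by move=> hf hg; apply: vgeD; rewrite ?vgeN. Qed.

Lemma ex_ord P n : exists2 f, f != 0 & ord P f = n.
Proof.
have [z z0 oz] := ord_unif ordX P.
by exists (z ^ n); rewrite ?expfz_neq0 // ordXz // oz mulr1.
Qed.

Lemma vge_inj P m n : (forall f, vge P m f <-> vge P n f) -> m = n.
Proof.
move=> h; have [f f0 of_] := ex_ord P m; have [g g0 og] := ex_ord P n.
have := h f; have := h g; rewrite !vgeE // of_ og !lexx => -[_ h1] [h2 _].
by apply/le_anti; rewrite h2 // h1.
Qed.

Lemma maxidE P f : maxid P f <-> vge P 1 f.
Proof.
rewrite /maxid /=; have [->|f0] := eqVneq f 0.
  by rewrite vge0; split=> // _; split; [exact: (ord_loc0 ordX) | left].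
have fV0 := invr_neq0 f0.
rewrite vgeE // !(ord_locP ordX) // ordV //; split=> [[h [/eqP|k]]|h].
- by rewrite (negPf f0).
- by move/negP: k; lia.
- by split; [lia | right; apply/negP; lia].
Qed.

(** Some [u] of order 1 exists. If [z] generates the maximal ideal then [u = g * z] with [g] regular
    and [z] of positive order, so the orders of the factors must be 0 and 1. *)
Lemma uniformizerE P z : uniformizer P z <-> z != 0 /\ ord P z = 1.
Proof.
rewrite /uniformizer; split=> [[/maxidE mz h]|[z0 oz]].
  have [u u0 ou] := ord_unif ordX P.
  have [|g /vge_loc lg ug] := h u; first by apply/maxidE; rewrite vgeE // ou.
  have z0 : z != 0 by apply: contra_neq u0 => z0; rewrite ug z0 mulr0.
  have g0 : g != 0 by apply: contra_neq u0 => g0; rewrite ug g0 mul0r.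
  split=> //; move: mz lg ou; rewrite !vgeE // ug (ordM ordX) //; lia.
split=> [|f /maxidE mf]; first by apply/maxidE; rewrite vgeE // oz.
exists (f / z); last by rewrite divfK.
by apply/vge_loc; rewrite vge_mulr ?invr_eq0 // ordV // oz opprK add0r.
Qed.

(** All uniformizers have order 1, so the one hidden in the existential of [OD] does not matter. *)
Lemma ODE (D : pnt X -> int) P f : OD D P f <-> vge P (- D P) f.
Proof.
have e z : z != 0 -> ord P z = 1 -> vge P 0 (f * z ^ D P) = vge P (- D P) f.
  by move=> z0 oz; rewrite vge_mulr ?expfz_neq0 // ordXz // oz mulr1 sub0r.
split=> [[z /uniformizerE[z0 oz]] /vge_loc|h]; first by rewrite e.
have [z z0 oz] := ord_unif ordX P.
by exists z; [exact/uniformizerE | apply/vge_loc; rewrite e].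
Qed.

Lemma dual_lineE (D : pnt X -> int) P f : dual_line (OD D) P f <-> vge P (D P) f.
Proof.
rewrite /dual_line /=; split=> [h|h g /ODE hg]; last first.
  by apply/vge_loc; apply: (vgeMl _ h hg); rewrite subrr.
have [z z0 oz] := ex_ord P (- D P).
have /h/vge_loc : OD D P z by apply/ODE; rewrite vgeE // oz.
by rewrite vge_mulr // oz sub0r opprK.
Qed.

Lemma dual_OD (D : pnt X -> int) P f :
  dual_line (OD D) P f <-> OD (fun Q => - D Q) P f.
Proof. by rewrite dual_lineE ODE opprK. Qed.

Lemma span_sub (V : lmodType K) P (S T : set V) :
  T 0 -> (forall v w, T v -> T w -> T (v + w)) ->
  (forall f v, vge P 0 f -> S v -> T (f *: v)) -> Defs.span P S `<=` T.
Proof.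
move=> T0 TD TS v [s [hs ->]]; rewrite big_seq.
apply: (@big_ind _ T) => // c /hs[/vge_loc]; exact: TS.
Qed.

Lemma span_gen (V : lmodType K) P (S : set V) f v :
  vge P 0 f -> S v -> Defs.span P S (f *: v).
Proof.
move=> /vge_loc lf Sv; exists [:: (f, v)]; split; last by rewrite big_seq1.
by move=> c; rewrite inE => /eqP ->.
Qed.

Lemma vge1 P : vge P 0 1.
Proof. by rewrite vgeE ?oner_neq0 // ord1. Qed.

Lemma span_gen1 (V : lmodType K) P (S : set V) v : S v -> Defs.span P S v.
Proof. by move=> Sv; rewrite -[v]scale1r; apply: span_gen => //; exact: vge1. Qed.

Lemma span_gen2 (V : lmodType K) P (S : set V) f g v w :
  vge P 0 f -> vge P 0 g -> S v -> S w -> Defs.span P S (f *: v + g *: w).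
Proof.
move=> /vge_loc lf /vge_loc lg Sv Sw.
exists [:: (f, v); (g, w)]; split; last by rewrite big_cons big_seq1.
by move=> c; rewrite !inE => /orP[] /eqP ->.
Qed.

Lemma trivialE P v : trivial_bundle P v <-> vge P 0 (v 0 0) /\ vge P 0 (v 1 0).
Proof.
by rewrite /trivial_bundle /= ord2P !vge_loc.
Qed.

(** Multiplication by [k] is a nonzero map [O(D) -> O(D')], which gives [D <= D' + div k] at every
    point; and [div k] has degree 0. *)
Lemma OD_le_degree (D D' : pnt X -> int) k : finsupp D -> finsupp D' -> k != 0 ->
  (forall P f, OD D P f -> OD D' P (f * k)) ->
  \sum_(P \in [set: pnt X]) D P <= \sum_(P \in [set: pnt X]) D' P.
Proof.
move=> fD fD' k0 h; have fk := ord_finsupp ordX k0.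
rewrite -[leRHS]addr0 -[X in _ <= _ + X](ord_degree0 ordX k0) -fsumD //.
apply: fsum_le => //; first exact: finsuppD.
move=> P; have [f f0 of_] := ex_ord P (- D P).
have /h/ODE : OD D P f by apply/ODE; rewrite vgeE // of_.
by rewrite vge_mulr // vgeE // of_; lia.
Qed.

(** In a local frame [g], the condition on [f] bounds its order by the orders of the nonzero entries
    of [g^-1 s]. The bound is 0 wherever [E] is the trivial lattice and no nonzero entry of [s] has
    a zero or a pole. *)
Lemma line_sub_OD (E : stalks X 'cV[K]_2) (s : 'cV[K]_2) :
  is_bundle E -> s != 0 ->
  exists2 D, finsupp D & forall P f, line_sub E s P f <-> OD D P f.
Proof.
move=> [hE fE] s0.
have min_ord P (v : 'cV[K]_2) : v != 0 ->
    exists n, forall f, trivial_bundle P (f *: v) <-> vge P n f.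
  move=> v0; have vz f i : v i 0 = 0 -> vge P 0 ((f *: v) i 0).
    by move=> e; rewrite mxE e mulr0 vge0.
  have vnz f i : v i 0 != 0 -> vge P 0 ((f *: v) i 0) = vge P (- ord P (v i 0)) f.
    by move=> e; rewrite mxE vge_mulr // sub0r.
  have [e0|n0] := eqVneq (v 0 0) 0; have [e1|n1] := eqVneq (v 1 0) 0.
  - by case/eqP: v0; apply: col2P; rewrite ?e0 ?e1 mxE.
  - exists (- ord P (v 1 0)) => f; rewrite trivialE (vnz _ _ n1).
    by split=> [[]//|->]; rewrite vz.
  - exists (- ord P (v 0 0)) => f; rewrite trivialE (vnz _ _ n0).
    by split=> [[]//|->]; rewrite vz.
  - exists (Num.max (- ord P (v 0 0)) (- ord P (v 1 0))) => f.
    rewrite trivialE !vnz // /vge ge_max; case: eqP => //= _.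
    by split=> [[-> ->]//|/andP[]].
have /choice[D hD] : forall P, exists n, forall f, line_sub E s P f <-> vge P n f.
  move=> P; have [g ug hg] := hE P.
  have gs0 : invmx g *m s != 0.
    by apply: contra_neq s0 => e; rewrite -[s](mulKVmx ug) e mulmx0.
  have [n hn] := min_ord P _ gs0; exists n => f.
  by rewrite /line_sub /= hg -scalemxAr hn.
exists (fun P => - D P); last by move=> P f; rewrite ODE opprK.
(* The clause [s i 0 != 0] is there because [ord P 0] carries no information. *)
pose bad (i : 'I_2) := [set P | ord P (s i 0) <> 0 /\ s i 0 != 0].
have fbad i : finite_set (bad i).
  have [e|n] := eqVneq (s i 0) 0.
    by apply: (sub_finite_set _ (finite_set0 (pnt X))) => P [_]; rewrite e eqxx.
  by apply: sub_finite_set (ord_finsupp ordX n) => P [].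
apply: (@finsupp_sub _ _ ([set P | E P <> trivial_bundle P] `|` bad 0 `|` bad 1)).
  by rewrite !finite_setU.
move=> P /not_orP[/not_orP[/contrapT EP b0] b1].
suff -> : D P = 0 by [].
apply: (@vge_inj P) => f; rewrite -hD /line_sub /= EP trivialE !mxE.
have ok i : ~ bad i P -> s i 0 != 0 -> ord P (s i 0) = 0.
  by move=> nb n; apply: contrapT => h; apply: nb.
have [e0|n0] := eqVneq (s 0 0) 0; have [e1|n1] := eqVneq (s 1 0) 0.
- by case/eqP: s0; apply: col2P; rewrite ?e0 ?e1 mxE.
- by rewrite e0 mulr0 vge0 vge_mulr // ok // subr0; split=> [[]|].
- by rewrite e1 mulr0 vge0 vge_mulr // ok // subr0; split=> [[]|].
- by rewrite !vge_mulr // !ok // subr0; split=> [[]|].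
Qed.

End CurveOrder.

(** * Extensions and semistability *)

Section Extensions.
Variables (C : fieldType) (X : curve C) (ord : pnt X -> fnf X -> int).
Hypothesis ordX : curve_order ord.
Local Notation K := (fnf X).
Local Notation deg D := (\sum_(P \in [set: pnt X]) D P).
Implicit Types (P : pnt X) (f g : K) (D : pnt X -> int) (E F : stalks X 'cV[K]_2).

Lemma bundle_iso_trans E F (G : stalks X 'cV[K]_2) :
  bundle_iso E F -> bundle_iso F G -> bundle_iso E G.
Proof.
move=> [g ug hg] [h uh hh]; exists (h *m g); first by rewrite unitmx_mul uh.
by move=> P v; rewrite hg hh mulmxA.
Qed.

Lemma bundleZ E P f v : is_bundle E -> vge ord P 0 f -> E P v -> E P (f *: v).
Proof.
move=> [h _] hf; have [g _ hg] := h P; rewrite !hg !(trivialE ordX) -scalemxAr !mxE.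
by case=> h0 h1; split; apply: (vgeMl ordX _ hf); [|exact: h0| |exact: h1].
Qed.

Lemma bundleD E P v w : is_bundle E -> E P v -> E P w -> E P (v + w).
Proof.
move=> [h _]; have [g _ hg] := h P; rewrite !hg !(trivialE ordX) mulmxDr !mxE.
by case=> v0 v1 [w0 w1]; split; apply: (vgeD ordX).
Qed.

Lemma extension_sub D1 D2 F P f :
  extension (OD D1) (OD D2) F -> vge ord P (- D1 P) f -> F P (cv2 f 0).
Proof. by case=> _ /(_ P)[h _] /(ODE ordX)/h. Qed.

Lemma extension_quo D1 D2 F P v :
  extension (OD D1) (OD D2) F -> F P v -> vge ord P (- D2 P) (v 1 0).
Proof. by case=> _ /(_ P)[_ h] Fv; apply/(ODE ordX)/h; exists v. Qed.

(** Let [v] be the vector whose second entry has the smaller order. Subtracting a regular multiple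
    of [v] from the other vector kills the second entry of the latter and puts its first entry in
    [O(D1)]. The determinant is then, up to sign, a section of [O(D2)] times a section of
    [O(D1)]. *)
Lemma det_extension D1 D2 F P v w :
  extension (OD D1) (OD D2) F -> F P v -> F P w ->
  vge ord P (- (D1 P + D2 P)) (det2 v w).
Proof.
move=> ext; have [bF /(_ P)[hM hN]] := ext.
have key v1 w1 : F P v1 -> F P w1 -> v1 1 0 != 0 ->
    vge ord P 0 (w1 1 0 / v1 1 0) -> vge ord P (- (D1 P + D2 P)) (det2 v1 w1).
  move=> Fv Fw n0; set c := _ / _ => hc.
  pose u := w1 - c *: v1.
  have Fu : F P u by rewrite /u -scaleNr; apply: bundleD => //; apply: bundleZ;
    rewrite ?(vgeN ordX).
  have u1 : u 1 0 = 0 by rewrite !mxE /c divfK // subrr.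
  have hu : vge ord P (- D1 P) (u 0 0).
    by apply/(ODE ordX)/hM; rewrite -/(cv2 (u 0 0) 0) -u1 -cv2_eta.
  have -> : det2 v1 w1 = - (v1 1 0 * u 0 0).
    by rewrite /det2 !mxE /c; field.
  rewrite (vgeN ordX) mulrC; apply: (vgeMl ordX _ hu (extension_quo ext Fv)).
  by rewrite -opprD.
move=> Fv Fw.
have detC : det2 v w = - det2 w v by rewrite /det2; ring.
have [v10|v1] := eqVneq (v 1 0) 0; last first.
  have [w10|w1] := eqVneq (w 1 0) 0; first by apply: key => //; rewrite w10 mul0r vge0.
  have [le|le] := leP (ord P (v 1 0)) (ord P (w 1 0)).
    by apply: key => //; rewrite vge_mulr ?invr_eq0 // ordV // vgeE // opprK add0r.
  rewrite detC (vgeN ordX); apply: key => //.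
  by rewrite vge_mulr ?invr_eq0 // ordV // vgeE // opprK add0r ltW.
have [w10|w1] := eqVneq (w 1 0) 0; last first.
  by rewrite detC (vgeN ordX); apply: key => //; rewrite v10 mul0r vge0.
by rewrite /det2 v10 w10 mulr0 mul0r subrr vge0.
Qed.

(** A line subbundle either lies in the sub [O(D1)] or maps nontrivially to the quotient [O(D2)].
    Both have degree 0, so [OD_le_degree] bounds its degree by 0, while the determinant has degree
    0. *)
Lemma semistable_extension D1 D2 E F :
  finsupp D1 -> finsupp D2 -> deg D1 = 0 -> deg D2 = 0 ->
  extension (OD D1) (OD D2) F -> bundle_iso E F -> semistable E.
Proof.
move=> f1 f2 d1 d2 ext [g ug hg] s s0; have [bF _] := ext.
have gs0 : g *m s != 0.
  by apply: contra_neq s0 => e; rewrite -[s](mulKmx ug) e mulmx0.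
have [D fD hD] := line_sub_OD ordX bF gs0.
exists (deg D), 0; split.
- exists D; split=> // P f; rewrite -hD /line_sub /= hg; split; by rewrite -scalemxAr.
- have dg0 : \det g != 0 by move: ug; rewrite unitmxE unitfE.
  (* The summand [ord P (\det g)] accounts for the change of coordinates from [F] to [E]; it has
     total degree 0. *)
  pose De P := D1 P + D2 P + ord P (\det g).
  have fg := ord_finsupp ordX dg0.
  exists De; split.
  + by apply: finsuppD => //; apply: finsuppD.
  + have e P f : OD De P f <-> vge ord P (- (D1 P + D2 P)) (\det g * f).
      by rewrite (ODE ordX) vge_mull // /De opprD.
    move=> P f; rewrite e; split.
      pose T := [set f : K^o | vge ord P (- (D1 P + D2 P)) (\det g * (f : K))].
      suff h : det_bundle E P `<=` T by exact: h.
      apply: (span_sub ordX (V := K^o)); rewrite /T /=.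
      * by rewrite mulr0 vge0.
      * by move=> a b ha hb; rewrite mulrDr; apply: (vgeD ordX).
      * move=> a b va [v [w [/hg Ev /hg Ew ->]]].
        rewrite -/(det2 v w) mulrCA -det2_mulmx.
        by apply: (vgeMl ordX _ va (det_extension ext Ev Ew)); rewrite add0r.
    (* For the converse inclusion a determinant of the least possible order is produced: [h1]
       generates [O(D1)] at [P], and [v] lifts a generator [h2] of [O(D2)]. Every section of [O(De)]
       at [P] is a regular multiple of it. *)
    have [h1 oh1 oh1P] := ex_ord ordX P (- D1 P).
    have [h2 h20 oh2P] := ex_ord ordX P (- D2 P).
    have [_ /(_ P)[_ hN]] := ext.
    have [|v Fv v1] := (hN h2).1; first by apply/(ODE ordX); rewrite vgeE ?oh2P.
    have F1 : F P (cv2 h1 0) by apply: (extension_sub ext); rewrite vgeE ?oh1P.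
    rewrite vge_mull // => hf.
    have -> : f = (\det g * f / (h1 * h2)) *: ((\det g)^-1 * (h1 * h2) : K^o).
      by rewrite /GRing.scale /=; field; rewrite h20 oh1 dg0.
    apply: (span_gen ordX).
      rewrite vge_mulr ?invr_eq0 ?mulf_neq0 // ordV ?mulf_neq0 // (ordM ordX) //.
      by rewrite oh1P oh2P vge_mull //; apply: (vgeW _ hf); lia.
    exists (invmx g *m cv2 h1 0), (invmx g *m v); split.
    * by apply/hg; rewrite mulKVmx.
    * by apply/hg; rewrite mulKVmx.
    * rewrite -/(det2 (invmx g *m cv2 h1 0) (invmx g *m v)) det2_mulmx det_inv.
      by rewrite /det2 !mxE /= mul0r subr0 v1.
  + rewrite fsumD //; last exact: finsuppD.
    by rewrite fsumD // d1 d2 (ord_degree0 ordX) // !addr0.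
- suff : deg D <= 0 by rewrite pmulrn_lle0.
  have [s1|s1] := eqVneq ((g *m s) 1 0) 0.
    have n0 : (g *m s) 0 0 != 0.
      by apply: contra_neq gs0 => s00; apply: col2P; rewrite ?s00 ?s1 mxE.
    rewrite -[leRHS]d1; apply: (OD_le_degree ordX fD f1 n0) => P f.
    rewrite -hD /line_sub /= => h; apply/(ext.2 P).1.
    by rewrite -/(cv2 (f * (g *m s) 0 0) 0) (_ : cv2 _ _ = f *: (g *m s)) //;
      apply: col2P; rewrite [RHS]mxE ?cv20 ?cv21 ?s1 ?mulr0.
  rewrite -[leRHS]d2; apply: (OD_le_degree ordX fD f2 s1) => P f.
  rewrite -hD /line_sub /= => h; apply/(ext.2 P).2.
  by exists (f *: (g *m s)); rewrite // mxE.
Qed.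

Lemma is_bundle_dsum D1 D2 : finsupp D1 -> finsupp D2 ->
  is_bundle (dsum (OD D1) (OD D2)).
Proof.
move=> f1 f2; split.
  move=> P; have [z z0 oz] := ord_unif ordX P.
  have zn n : z ^ n != 0 by apply: expfz_neq0.
  have [|u _ iu] := @inv_mx2 _ (mx2 (z ^ (- D1 P)) 0 0 (z ^ (- D2 P)))
                              (mx2 (z ^ D1 P) 0 0 (z ^ D2 P)).
    move=> x y; rewrite !mx2_cv2 !mul0r !addr0 !add0r !mulrA -!expfzDr // !addNr.
    by rewrite !expr0z !mul1r.
  exists (mx2 (z ^ (- D1 P)) 0 0 (z ^ (- D2 P))) => // v.
  rewrite iu (trivialE ordX) {2 3}(cv2_eta v) mx2_cv2 cv20 cv21 !mul0r addr0 add0r.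
  rewrite !vge_mull // !(ordXz ordX) // oz !mulr1 !sub0r.
  by rewrite /dsum /= !(ODE ordX).
apply: (@sub_finite_set _ _ ([set P | D1 P <> 0] `|` [set P | D2 P <> 0])); last first.
  by rewrite finite_setU.
move=> P /=; apply: contra_notP => /not_orP[/contrapT h1 /contrapT h2].
apply/seteqP; split=> v; rewrite (trivialE ordX) /dsum /= !(ODE ordX) h1 h2 oppr0 //.
Qed.

Lemma dsum_extension D1 D2 : finsupp D1 -> finsupp D2 ->
  extension (OD D1) (OD D2) (dsum (OD D1) (OD D2)).
Proof.
move=> f1 f2; split; first exact: is_bundle_dsum.
have OD0 D P : OD D P 0 by apply/(ODE ordX); rewrite vge0.
move=> P; split=> f; rewrite /dsum /=.
  by rewrite !mxE /=; split=> [|[]//]; split.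
split=> [h|[v [_ h] <-]//].
by exists (cv2 0 f); rewrite /= ?cv21 ?cv20.
Qed.

Lemma split_self_extension D F : extension (OD D) (OD D) F ->
  split_extension (OD D) F -> bundle_iso F (dsum (OD D) (OD D)).
Proof.
move=> ext [h hh]; have [bF hF] := ext.
exists (mx2 1 (- h) 0 1); first by rewrite unitmx_mx2 // mulr1 mulr0 subr0 oner_neq0.
move=> P v; rewrite {2}(cv2_eta v) mx2_cv2 /dsum /= cv20 cv21 mul0r add0r !mul1r.
have dec : v = cv2 (v 0 0 + - h * v 1 0) 0 + cv2 (h * v 1 0) (v 1 0).
  apply: col2P; rewrite [RHS]mxE ?cv20 ?cv21; ring.
split=> [Fv|[h0 /hh h1]].
  have h1 : OD D P (v 1 0) by apply/(ODE ordX); exact: (extension_quo ext Fv).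
  split=> //; apply/(hF P).1; rewrite -/(cv2 _ _).
  have -> : cv2 (v 0 0 + - h * v 1 0) 0 = v + (-1) *: cv2 (h * v 1 0) (v 1 0).
    by apply: col2P; rewrite !mxE /=; ring.
  apply: (bundleD bF) => //; apply: (bundleZ bF); last exact: hh.
  by rewrite (vgeN ordX) vge1.
by rewrite dec; apply: (bundleD bF) => //; apply/(hF P).1.
Qed.

End Extensions.

(** * The function field of the elliptic curve *)

Section Specialization.
Variables (S : comNzRingType) (K C : fieldType).
Variables (phi : {rmorphism S -> K}) (psi : {rmorphism S -> C}).
Hypothesis phi_neq0 : forall s, psi s != 0 -> phi s != 0.
Implicit Types (f g z : K) (c d : C) (m n : int).

(* [f] lies in the local ring of the fractions [phi u / phi v] with [psi v != 0],
   and [c] is its residue. *)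
Definition specializes f c : Prop :=
  exists u v, [/\ psi v != 0, f * phi v = phi u & c * psi v = psi u].

Lemma spec_phi s : specializes (phi s) (psi s).
Proof. by exists s, 1; rewrite !rmorph1 !mulr1 oner_neq0. Qed.

Lemma spec_phiE s f c : phi s = f -> psi s = c -> specializes f c.
Proof. by move=> <- <-; apply: spec_phi. Qed.

Lemma specM f g c d : specializes f c -> specializes g d -> specializes (f * g) (c * d).
Proof.
move=> [u [v [v0 e1 e2]]] [u' [v' [v0' e1' e2']]]; exists (u * u'), (v * v').
by rewrite !rmorphM /= mulf_neq0 // -e1 -e1' -e2 -e2'; split=> //; ring.
Qed.

Lemma specD f g c d : specializes f c -> specializes g d -> specializes (f + g) (c + d).
Proof.
move=> [u [v [v0 e1 e2]]] [u' [v' [v0' e1' e2']]].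
exists (u * v' + u' * v), (v * v').
by rewrite !rmorphD !rmorphM /= mulf_neq0 // -e1 -e1' -e2 -e2'; split=> //; ring.
Qed.

Lemma specV f c : specializes f c -> c != 0 -> specializes f^-1 c^-1.
Proof.
move=> [u [v [v0 e1 e2]]] c0.
have u0 : psi u != 0 by rewrite -e2 mulf_neq0.
have f0 : f != 0.
  by apply: contra_neq (phi_neq0 u0) => f0; rewrite -e1 f0 mul0r.
by exists v, u; split=> //; [rewrite -e1 mulKf | rewrite -e2 mulKf].
Qed.

(** By [phi_neq0] the kernel of [phi] lies in that of [psi]. This is applied to the cross difference
    [u * v' - u' * v] of two fractions equal in [K]. *)
Lemma spec_uniq f c d : specializes f c -> specializes f d -> c = d.
Proof.
move=> [u [v [v0 e1 e2]]] [u' [v' [v0' e1' e2']]].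
have : phi (u * v' - u' * v) == 0.
  by rewrite rmorphB !rmorphM /= -e1 -e1'; apply/eqP; ring.
move/eqP => h; have [/eqP|/phi_neq0] := eqVneq (psi (u * v' - u' * v)) 0; last first.
  by rewrite h eqxx.
rewrite rmorphB !rmorphM /= -e2 -e2' => /eqP e.
apply: (mulIf (mulf_neq0 v0 v0')); apply/eqP; rewrite -subr_eq0 -[X in _ == X]e; apply/eqP; ring.
Qed.

Lemma spec_neq0 f c : specializes f c -> c != 0 -> f != 0.
Proof.
move=> h; apply: contra_neq => f0.
apply: (spec_uniq h); rewrite f0 -(rmorph0 phi) -(rmorph0 psi); exact: spec_phi.
Qed.

Variable z : K.
Hypothesis (z0 : z != 0) (hz : specializes z 0).

(** The nonzero residue says that [f * z ^ (- n)] is a unit of the local ring, so an order is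
    certified by exhibiting a residue. That every nonzero [f] has an order is a separate fact,
    proved curve by curve. *)
Definition has_order n f : Prop := exists2 c, c != 0 & specializes (f * z ^ (- n)) c.

Lemma has_order_neq0 n f : has_order n f -> f != 0.
Proof.
move=> [c c0 h]; have := spec_neq0 h c0.
by apply: contra_neq => ->; rewrite mul0r.
Qed.

Lemma has_orderM m n f g : has_order m f -> has_order n g -> has_order (m + n) (f * g).
Proof.
move=> [c c0 hc] [d d0 hd]; exists (c * d); first exact: mulf_neq0.
by rewrite opprD expfzDr // mulrACA; apply: specM.
Qed.

Lemma has_orderV n f : has_order n f -> has_order (- n) f^-1.
Proof.
move=> [c c0 hc]; exists c^-1; first by rewrite invr_eq0.
have -> : f^-1 * z ^ (- - n) = (f * z ^ (- n))^-1 by rewrite invfM -!invr_expz.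
exact: specV.
Qed.

Lemma spec1 : specializes 1 1.
Proof. by rewrite -(rmorph1 phi) -(rmorph1 psi); apply: spec_phi. Qed.

Lemma specN f c : specializes f c -> specializes (- f) (- c).
Proof.
by move=> h; rewrite -mulN1r -[- c]mulN1r; apply: specM => //;
  rewrite -(rmorph1 phi) -(rmorph1 psi) -!rmorphN; apply: spec_phi.
Qed.

Lemma has_orderN n f : has_order n f -> has_order n (- f).
Proof.
move=> [c c0 h]; exists (- c); first by rewrite oppr_eq0.
by rewrite mulNr; apply: specN.
Qed.

Lemma spec0 : specializes 0 0.
Proof. by rewrite -(rmorph0 phi) -(rmorph0 psi); apply: spec_phi. Qed.

Lemma has_order_unif : has_order 1 z.
Proof. by exists 1; [exact: oner_neq0 | rewrite divff //; exact: spec1]. Qed.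

Lemma has_order0 f c : specializes f c -> c != 0 -> has_order 0 f.
Proof. by exists c; rewrite // oppr0 expr0z mulr1. Qed.

Lemma has_orderI n f g c : f = g * z ^ n -> specializes g c -> c != 0 -> has_order n f.
Proof.
move=> -> hg c0; exists c => //.
by rewrite -mulrA -expfzDr // subrr expr0z mulr1.
Qed.

Lemma spec_zX (n : nat) : specializes (z ^ n.+1%:Z) 0.
Proof.
elim: n => [|n IH]; first by rewrite expr1z.
by rewrite -[n.+2]add1n PoszD expfzDr // expr1z -[X in specializes _ X](mulr0 0); apply: specM.
Qed.

Lemma has_order_pos n f : has_order n f -> 0 < n -> specializes f 0.
Proof.
case: n => [[|n]|] // [c c0 hc] _.
rewrite -[f](@divfK _ (z ^ (- n.+1%:Z))) ?expfz_neq0 //.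
have -> : f / z ^ (- n.+1%:Z) * z ^ (- n.+1%:Z) = f * z ^ (- n.+1%:Z) * z ^ n.+1%:Z.
  by rewrite divfK ?expfz_neq0 // -mulrA -expfzDr // addNr expr0z mulr1.
by rewrite -[X in specializes _ X](mulr0 c); apply: specM => //; apply: spec_zX.
Qed.

(** If [n < 0], then [f^-1] has positive order, hence residue 0. A residue for [f] would then make 0
    a residue of [1 = f * f^-1]. *)
Lemma has_order_ge0 n f : has_order n f -> (exists c, specializes f c) <-> 0 <= n.
Proof.
move=> hf; split=> [[c hc]|].
  rewrite leNgt; apply/negP => n0.
  have hV := has_order_pos (has_orderV hf) _.
  have h1 : specializes 1 0.
    rewrite -[0](mulr0 c) -(divff (has_order_neq0 hf)); apply: specM => //.
    by apply: hV; rewrite oppr_gt0.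
  by have /eqP := spec_uniq h1 spec1; rewrite eq_sym oner_eq0.
rewrite le_eqVlt => /orP[/eqP n0|n0]; last by exists 0; apply: has_order_pos hf n0.
by case: hf => c _; rewrite -n0 oppr0 expr0z mulr1 => h; exists c.
Qed.

(** [1 = f / f] would have the orders [m - n] and [n - m], and both are nonnegative because 1 has a
    residue. *)
Lemma has_order_uniq m n f : has_order m f -> has_order n f -> m = n.
Proof.
move=> hm hn; have f0 := has_order_neq0 hm.
have one k : has_order k 1 -> 0 <= k.
  by move=> h; apply/(has_order_ge0 h); exists 1; exact: spec1.
apply/le_anti; rewrite -subr_ge0 -[X in _ && X]subr_ge0.
by rewrite !one // -(divff f0); apply: has_orderM => //; apply: has_orderV.
Qed.

Lemma has_orderD m n f g : m < n -> has_order m f -> has_order n g -> has_order m (f + g).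
Proof.
move=> mn [c c0 hc] hg; exists c => //; rewrite mulrDl -[c]addr0; apply: specD => //.
apply: (@has_order_pos (n - m)); last by rewrite subr_gt0.
have [d d0 hd] := hg; exists d; rewrite // -mulrA -expfzDr //.
by rewrite (_ : _ + _ = - n) //; lia.
Qed.

End Specialization.

Arguments has_order0 {S K C phi psi z f c}.

Lemma addr_frac_mul (F : fieldType) (n d n' d' z : F) : d != 0 -> d' != 0 ->
  n / d + n' / d' * z = (n * d' + n' * d * z) / (d * d').
Proof. by move=> d0 d0'; field; rewrite d0 d0'. Qed.

(** * The concrete function field, with basis [1, y] over the rational functions of [x] *)

Section FunctionField.
Variables (C : numClosedFieldType) (t : C).
Local Notation K0 := {fraction {poly C}}.
Local Notation iF := (@FracField.tofrac {poly C}).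
Local Notation K := (ell_field t).

Lemma ell_inj_zmod : zmod_morphism (@ell_inj C t).
Proof. exact: qpolyC_is_zmod_morphism. Qed.

Lemma ell_inj_monoid : monoid_morphism (@ell_inj C t).
Proof. exact: qpolyC_is_monoid_morphism. Qed.

HB.instance Definition _ :=
  GRing.isZmodMorphism.Build K0 K (@ell_inj C t) ell_inj_zmod.
HB.instance Definition _ :=
  GRing.isMonoidMorphism.Build K0 K (@ell_inj C t) ell_inj_monoid.

Definition inx (A : {poly C}) : K := ell_inj t (iF A).

Lemma inx_zmod : zmod_morphism inx.
Proof. by move=> A B; rewrite /inx !rmorphB. Qed.
Lemma inx_monoid : monoid_morphism inx.
Proof. by split=> [|A B]; rewrite /inx ?rmorph1 ?rmorphM. Qed.
HB.instance Definition _ := GRing.isZmodMorphism.Build {poly C} K inx inx_zmod.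
HB.instance Definition _ := GRing.isMonoidMorphism.Build {poly C} K inx inx_monoid.

Lemma ratC_zmod : zmod_morphism (@ratC C).
Proof. by move=> A B; rewrite /ratC !rmorphB. Qed.
Lemma ratC_monoid : monoid_morphism (@ratC C).
Proof. by split=> [|A B]; rewrite /ratC ?rmorph1 ?rmorphM. Qed.
HB.instance Definition _ := GRing.isZmodMorphism.Build C K0 (@ratC C) ratC_zmod.
HB.instance Definition _ := GRing.isMonoidMorphism.Build C K0 (@ratC C) ratC_monoid.

Lemma ellC_zmod : zmod_morphism (@ellC C t).
Proof. by move=> A B; rewrite /ellC !rmorphB. Qed.
Lemma ellC_monoid : monoid_morphism (@ellC C t).
Proof. by split=> [|A B]; rewrite /ellC ?rmorph1 ?rmorphM. Qed.
HB.instance Definition _ := GRing.isZmodMorphism.Build C K (@ellC C t) ellC_zmod.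
HB.instance Definition _ := GRing.isMonoidMorphism.Build C K (@ellC C t) ellC_monoid.

Local Notation x := (ellX t).
Local Notation y := (ellY t).

Local Notation h := (ell_poly t).
Local Notation inq := (in_qpoly h).

Lemma mk_monic_ell : mk_monic h = h.
Proof. by rewrite /mk_monic ell_poly_size ell_poly_monic. Qed.

Lemma inq_small (r : {poly K0}) : (size r <= 2)%N -> polyn (inq r) = r.
Proof. by move=> sr; rewrite in_qpoly_small // mk_monic_ell ell_poly_size ltnS. Qed.

Lemma inqC (a : K0) : inq a%:P = qpolyC h a.
Proof.
apply: val_inj; apply: (etrans (inq_small _)) => //.
by rewrite size_polyC; case: (_ != 0).
Qed.

Lemma inq_linear (a b : K0) :
  inq (a%:P + b%:P * 'X) = ell_inj t a + ell_inj t b * y :> K.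
Proof.
apply: (etrans (in_qpolyD _ _ _)); rewrite inqC.
apply: (congr1 (fun u : K => ell_inj t a + u)).
by apply: (etrans (in_qpolyM _ _ _)); rewrite inqC.
Qed.

Lemma ellY_sqr : y ^+ 2 = inx (cubic t).
Proof.
have hq : inq h = 0 by apply: val_inj;
  rewrite /= mk_monic_ell Pdiv.RingMonic.rmodpp // ell_poly_monic.
suff : inq ('X^2) = qpolyC h (iF (cubic t)) by rewrite rmorphXn.
rewrite -inqC -[in LHS](subrK ((iF (cubic t))%:P) 'X^2) rmorphD /=.
by rewrite [X in X + _]hq add0r.
Qed.

Lemma size_lin (a b : K0) : (size (a%:P + b%:P * 'X)%R <= 2)%N.
Proof.
apply: (leq_trans (size_polyD _ _)); rewrite geq_max size_polyC mul_polyC.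
rewrite (leq_trans (size_scale_leq _ _)) ?size_polyX // andbT.
by case: (_ != 0).
Qed.

Lemma ell_basis (f : K) : exists a b, f = ell_inj t a + ell_inj t b * y.
Proof.
pose r : {poly K0} := polyn (f : {poly %/ h}).
exists r`_0, r`_1; apply: etrans (inq_linear _ _).
have sr : (size r <= 2)%N.
  rewrite -ltnS (_ : 3%N = size (mk_monic h)); first exact: size_mk_monic.
  by rewrite mk_monic_ell ell_poly_size.
apply: val_inj; apply/esym/(etrans (inq_small (size_lin _ _))).
apply: (etrans _ (erefl r)); apply/polyP => -[|[|i]]; rewrite coefD coefC coefMX coefC /=.
- by rewrite addr0.
- by rewrite add0r.
- by rewrite addr0 nth_default // (leq_trans sr).
Qed.

Lemma ell_free (a b : K0) : ell_inj t a + ell_inj t b * y = 0 -> a = 0 /\ b = 0.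
Proof.
move=> e; have e2 : a%:P + b%:P * 'X = 0 :> {poly K0}.
  rewrite -(inq_small (size_lin a b)).
  by apply: (congr1 (fun r : {poly %/ h} => polyn r) (y := 0)); apply: etrans e; apply: inq_linear.
have h0 i : (a%:P + b%:P * 'X)`_i = 0 by rewrite e2 coef0.
have := h0 0%N; have := h0 1%N; rewrite !coefD !coefC !coefMX !coefC addr0 add0r.
by clear.
Qed.

Lemma inx_eq0 A : (inx A == 0) = (A == 0).
Proof.
apply/eqP/eqP => [e|->]; last exact: rmorph0.
have [] := @ell_free (iF A) 0; first by rewrite rmorph0 mul0r addr0.
by move/eqP; rewrite tofrac_eq0 => /eqP.
Qed.

Lemma inx_free A B : inx A + inx B * y = 0 -> A = 0 /\ B = 0.
Proof.
by move=> /ell_free[/eqP + /eqP]; rewrite !tofrac_eq0 => /eqP -> /eqP ->.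
Qed.

(** The chosen representative itself is exposed, and not just some fraction, because [rat_der] is
    computed from it. *)
Lemma frac_repr (r : K0) : exists2 nd : {poly C} * {poly C},
  fraction.frac (generic_quotient.repr r) = nd & nd.2 != 0 /\ r = iF nd.1 / iF nd.2.
Proof.
exists (fraction.frac (generic_quotient.repr r)) => //; split; first exact: denom_ratioP.
rewrite -[LHS](generic_quotient.reprK r); case: (generic_quotient.repr r) => -[n d] /= d0.
have iFd : iF d != 0 by rewrite tofrac_eq0.
apply: (mulIf iFd); rewrite mulfVK //.
rewrite /FracField.tofrac; unlock.
rewrite -[LHS](FracField.pi_mul).
apply/eqmodP; rewrite /= FracField.equivfE /FracField.mulf.
by rewrite !numden_Ratio ?mulf_neq0 ?oner_eq0 //= !mulr1 mulrC.
Qed.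

Lemma rat_der0 : rat_der (0 : K0) = 0.
Proof.
have [[n d] e [/= d0 /esym/eqP]] := frac_repr 0; rewrite /rat_der e.
rewrite mulf_eq0 invr_eq0 !tofrac_eq0 (negPf d0) orbF => /eqP ->.
by rewrite derivC mul0r mul0r subrr rmorph0 mul0r.
Qed.

Lemma ell_frac (f : K) : exists A B D, D != 0 /\ f = (inx A + inx B * y) / inx D.
Proof.
have [a [b ->]] := ell_basis f.
have [[n d] _ [/= d0 ->]] := frac_repr a; have [[n' d'] _ [/= d0' ->]] := frac_repr b.
exists (n * d'), (n' * d), (d * d'); split; first exact: mulf_neq0.
rewrite !fmorph_div -!/(inx _) !(rmorphM inx).
by apply: addr_frac_mul; rewrite inx_eq0.
Qed.

End FunctionField.

(** * Evaluation of polynomials in two variables *)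

Section BivariateEvaluation.
Variables (C K : comNzRingType) (cK : {rmorphism C -> K}) (xi eta : K).

Definition ev2 (v : {poly {poly C}}) : K := (map_poly (map_poly cK) v).[xi, eta].

Lemma ev2_zmod : zmod_morphism ev2.
Proof. by move=> u v; rewrite /ev2 !rmorphB !hornerE. Qed.
Lemma ev2_monoid : monoid_morphism ev2.
Proof. by split=> [|u v]; rewrite /ev2 ?rmorph1 ?rmorphM !hornerE. Qed.
HB.instance Definition _ := GRing.isZmodMorphism.Build {poly {poly C}} K ev2 ev2_zmod.
HB.instance Definition _ := GRing.isMonoidMorphism.Build {poly {poly C}} K ev2 ev2_monoid.

Lemma ev2CC c : ev2 c%:P%:P = cK c.
Proof. by rewrite /ev2 !map_polyC /= !hornerE map_polyC hornerE. Qed.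
Lemma ev2X : ev2 'X = xi.
Proof. by rewrite /ev2 map_polyX !hornerE. Qed.
Lemma ev2Y : ev2 'X%:P = eta.
Proof. by rewrite /ev2 map_polyC /= map_polyX !hornerE. Qed.

Lemma biv_ind (Q : {poly {poly C}} -> Prop) :
  (forall c, Q c%:P%:P) -> Q 'X -> Q 'X%:P ->
  (forall u v, Q u -> Q v -> Q (u + v)) -> (forall u v, Q u -> Q v -> Q (u * v)) ->
  forall v, Q v.
Proof.
move=> QC QX QY QD QM; elim/poly_ind => [|v c Qv]; first by rewrite -!polyC0.
apply: (QD); first exact: QM.
elim/poly_ind: c => [|c d Qc]; first by rewrite -polyC0.
by rewrite polyCD polyCM; apply: QD => //; apply: QM.
Qed.

End BivariateEvaluation.

Section EvalAt.
Variables (C : comNzRingType) (a b : C).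

Definition ev_at (v : {poly {poly C}}) : C := v.[a, b].
Lemma ev_at_zmod : zmod_morphism ev_at.
Proof. by move=> u v; rewrite /ev_at !hornerE. Qed.
Lemma ev_at_monoid : monoid_morphism ev_at.
Proof. by split=> [|u v]; rewrite /ev_at !hornerE. Qed.
HB.instance Definition _ := GRing.isZmodMorphism.Build {poly {poly C}} C ev_at ev_at_zmod.
HB.instance Definition _ := GRing.isMonoidMorphism.Build {poly {poly C}} C ev_at ev_at_monoid.

Lemma ev_atCC c : ev_at c%:P%:P = c. Proof. by rewrite /ev_at !hornerE. Qed.
Lemma ev_atX : ev_at 'X = a. Proof. by rewrite /ev_at !hornerE. Qed.
Lemma ev_atY : ev_at 'X%:P = b. Proof. by rewrite /ev_at !hornerE. Qed.

Lemma ev_atD u v : ev_at (u + v) = ev_at u + ev_at v. Proof. exact: rmorphD. Qed.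
Lemma ev_atM u v : ev_at (u * v) = ev_at u * ev_at v. Proof. exact: rmorphM. Qed.

End EvalAt.

(** * Normal forms of functions in the affine chart and in the chart at infinity *)

Section Elliptic.
Variables (C : numClosedFieldType) (t : C) (K : fieldType) (cub : {poly C}).
Variables (ix : {rmorphism {poly C} -> K}) (y : K).
Hypotheses (t0 : t != 0) (t1 : t != 1).
Hypothesis cubE : cub = cubic t.
Hypothesis y2 : y ^+ 2 = ix cub.
Hypothesis ix_free : forall A B, ix A + ix B * y = 0 -> A = 0 /\ B = 0.
Hypothesis frac_ix : forall f : K, exists A B D,
  D != 0 /\ f = (ix A + ix B * y) / ix D.

Definition cK (c : C) : K := ix c%:P.
Lemma cK_zmod : zmod_morphism cK.
Proof. by move=> u v; rewrite /cK !rmorphB. Qed.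
Lemma cK_monoid : monoid_morphism cK.
Proof. by split=> [|u v]; rewrite /cK ?rmorph1 ?rmorphM. Qed.
HB.instance Definition _ := GRing.isZmodMorphism.Build C K cK cK_zmod.
HB.instance Definition _ := GRing.isMonoidMorphism.Build C K cK cK_monoid.

Local Notation x := (ix 'X).
Local Notation S := {poly {poly C}}.

Lemma ix_eq0 A : (ix A == 0) = (A == 0).
Proof.
apply/eqP/eqP => [e|->]; last exact: rmorph0.
by have [|hA _] := @ix_free A 0; [rewrite e rmorph0 mul0r addr0 | exact: hA].
Qed.

Lemma y_neq0 : y != 0.
Proof.
apply/eqP => y0; have [|_ /eqP] := @ix_free 0 1; last by rewrite oner_eq0.
by rewrite y0 rmorph0 mulr0 addr0.
Qed.

Lemma ix_poly A : ix A = ev2 cK x y (map_poly polyC A).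
Proof.
elim/poly_ind: A => [|A c IH]; first by rewrite !rmorph0.
by rewrite !rmorphD !rmorphM /= IH map_polyX map_polyC /= ev2CC ev2X.
Qed.

Lemma ev_at_poly (a b : C) A : ev_at a b (map_poly polyC A) = A.[a].
Proof.
elim/poly_ind: A => [|A c IH]; first by rewrite !rmorph0 horner0.
by rewrite !rmorphD !rmorphM /= IH map_polyX map_polyC /= ev_atCC ev_atX !hornerE.
Qed.

(** The relation [y^2 = cub] holds in [K] as well as at every point [(a, b)] of the curve, so one
    reduction to [A + B y] computes both evaluations. It follows that a polynomial with a nonzero
    value at a point is nonzero in [K]. *)
Lemma affine_normal v : exists A B, ev2 cK x y v = ix A + ix B * y /\
  forall a b, b ^+ 2 = cub.[a] -> ev_at a b v = A.[a] + B.[a] * b.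
Proof.
elim/biv_ind: v => [c|||u v [A [B [e h]]] [A' [B' [e' h']]]|u v [A [B [e h]]] [A' [B' [e' h']]]].
- exists c%:P, 0; rewrite ev2CC rmorph0 mul0r addr0; split=> // a b _.
  by rewrite ev_atCC !hornerE.
- exists 'X, 0; rewrite ev2X rmorph0 mul0r addr0; split=> // a b _.
  by rewrite ev_atX !hornerE.
- exists 0, 1; rewrite ev2Y rmorph0 rmorph1 mul1r add0r; split=> // a b _.
  by rewrite ev_atY !hornerE.
- exists (A + A'), (B + B'); rewrite !rmorphD /= e e'; split; first by ring.
  by move=> a b E; rewrite ev_atD h // h' // !hornerD; ring.
- exists (A * A' + B * B' * cub), (A * B' + B * A').
  rewrite !rmorphD !rmorphM /= e e' -y2; split; first by ring.
  by move=> a b E; rewrite ev_atM h // h' // !(hornerD, hornerM) -E; ring.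
Qed.

Lemma affine_neq0 a b : b ^+ 2 = cub.[a] ->
  forall v, ev_at a b v != 0 -> ev2 cK x y v != 0.
Proof.
move=> E v; have [A [B [-> /(_ _ _ E) ->]]] := affine_normal v.
apply: contra_neq => /ix_free[-> ->]; by rewrite !horner0 mul0r addr0.
Qed.

(* At infinity x has a pole of order 2 and y one of order 3; this is the
   resulting bound on degrees for functions vanishing there. *)
Definition small_oo (f : K) : Prop := exists A B D, [/\ D != 0, f * ix D = ix A + ix B * y,
  (size A < size D)%N & ((size B).+1 < size D)%N].

Lemma size_cub : size cub = 4%N. Proof. by rewrite cubE size_cubic. Qed.

Lemma small_ooD f g : small_oo f -> small_oo g -> small_oo (f + g).
Proof.
move=> [A [B [D [D0 e sA sB]]]] [A' [B' [D' [D0' e' sA' sB']]]].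
exists (A * D' + A' * D), (B * D' + B' * D), (D * D').
rewrite !rmorphD !rmorphM /=; split.
- exact: mulf_neq0.
- transitivity (f * ix D * ix D' + g * ix D' * ix D); first by ring.
  by rewrite e e'; ring.
- rewrite size_mul //; apply: (leq_ltn_trans (size_polyD _ _)).
  rewrite gtn_max; apply/andP; split.
    by apply: (leq_ltn_trans (size_polyMleq _ _)); move: sA D0'; rewrite -size_poly_gt0;
      move: (size A) (size A') (size B) (size B') (size D) (size D'); clear; lia.
  by apply: (leq_ltn_trans (size_polyMleq _ _)); move: sA' D0; rewrite -size_poly_gt0;
    move: (size A) (size A') (size B) (size B') (size D) (size D'); clear; lia.
- rewrite size_mul //.
  suff : (size (B * D' + B' * D)%R <= (size D + size D').-1 - 2)%N.
    by move: sB sB'; move: (size (B * D' + B' * D)%R) (size A) (size A') (size B) (size B')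
      (size D) (size D'); clear; lia.
  apply: (leq_trans (size_polyD _ _)); rewrite geq_max; apply/andP; split.
    by apply: (leq_trans (size_polyMleq _ _)); move: sB D0'; rewrite -size_poly_gt0;
      move: (size A) (size A') (size B) (size B') (size D) (size D'); clear; lia.
  by apply: (leq_trans (size_polyMleq _ _)); move: sB' D0; rewrite -size_poly_gt0;
    move: (size A) (size A') (size B) (size B') (size D) (size D'); clear; lia.
Qed.

(** The critical term is [B * B' * cub]: its degree is at most [(deg D - 2) + (deg D' - 2) + 3],
    still below that of [D * D']. *)
Lemma small_ooM f g : small_oo f -> small_oo g -> small_oo (f * g).
Proof.
move=> [A [B [D [D0 e sA sB]]]] [A' [B' [D' [D0' e' sA' sB']]]].
exists (A * A' + B * B' * cub), (A * B' + A' * B), (D * D').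
have sM (P Q : {poly C}) := size_polyMleq P Q.
rewrite !rmorphD !rmorphM /=; split.
- exact: mulf_neq0.
- by rewrite mulrACA e e' -y2; ring.
- rewrite size_mul //; apply: (leq_ltn_trans (size_polyD _ _)).
  rewrite gtn_max; apply/andP; split.
    by move: sA sA' (sM A A');
      move: (size (A * A')%R) (size A) (size A') (size B) (size B') (size D) (size D'); clear; lia.
  have [->|] := eqVneq (B * B') 0.
    rewrite mul0r size_poly0.
    by move: sB sB'; move: (size A) (size A') (size B) (size B') (size D) (size D'); clear; lia.
  rewrite -size_poly_gt0 => n0.
  by move: n0 sB sB' (sM (B * B') cub) (sM B B'); rewrite size_cub;
    move: (size (B * B' * cub)%R) (size (B * B')%R) (size A) (size A') (size B) (size B') (size
      D) (size D'); clear; lia.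
- rewrite size_mul //.
  suff : (size (A * B' + A' * B)%R <= (size D + size D').-1 - 2)%N.
    by move: sB sB'; move: (size (A * B' + A' * B)%R) (size A) (size A') (size B) (size B')
      (size D) (size D'); clear; lia.
  apply: (leq_trans (size_polyD _ _)); rewrite geq_max; apply/andP; split.
    by move: sA sB' (sM A B');
      move: (size (A * B')%R) (size A) (size A') (size B) (size B') (size D) (size D'); clear; lia.
  by move: sA' sB (sM A' B);
    move: (size (A' * B)%R) (size A) (size A') (size B) (size B') (size D) (size D'); clear; lia.
Qed.

Lemma small_ooZ c f : small_oo f -> small_oo (cK c * f).
Proof.
move=> [A [B [D [D0 e sA sB]]]]; exists (c *: A), (c *: B), D.
have sZ (P : {poly C}) := size_scale_leq c P.
split=> //.
- by rewrite -mulrA e -!mul_polyC !rmorphM /= -/(cK c); ring.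
- exact: (leq_ltn_trans (sZ A)).
- by apply: leq_ltn_trans sB; rewrite ltnS; exact: sZ.
Qed.

Lemma cub_neq0 : cub != 0.
Proof. by rewrite -size_poly_gt0 size_cub. Qed.

Lemma small_oo_xi : small_oo (x / y).
Proof.
exists 0, 'X, cub; rewrite cub_neq0 size_cub size_poly0 size_polyX; split=> //.
by rewrite -y2 rmorph0; field; exact: y_neq0.
Qed.

Lemma small_oo_eta : small_oo y^-1.
Proof.
exists 0, 1, cub; rewrite cub_neq0 size_cub size_poly0 size_poly1; split=> //.
by rewrite -y2 rmorph0 rmorph1; field; exact: y_neq0.
Qed.

Lemma oo_normal v :
  exists2 e, small_oo e & ev2 cK (x / y) y^-1 v = cK (ev_at 0 0 v) + e.
Proof.
have s0 : small_oo 0.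
  by have := small_ooZ 0 small_oo_eta; rewrite rmorph0 mul0r.
elim/biv_ind: v => [c|||u v [e se he] [f sf hf]|u v [e se he] [f sf hf]].
- by exists 0; rewrite ?ev2CC ?ev_atCC ?addr0.
- by exists (x / y); rewrite ?ev2X ?ev_atX ?rmorph0 ?add0r //; exact: small_oo_xi.
- by exists (y^-1); rewrite ?ev2Y ?ev_atY ?rmorph0 ?add0r //; exact: small_oo_eta.
- exists (e + f); first exact: small_ooD.
  by rewrite rmorphD ev_atD rmorphD /= he hf; ring.
- exists (cK (ev_at 0 0 u) * f + cK (ev_at 0 0 v) * e + e * f).
    by apply: small_ooD; [apply: small_ooD; apply: small_ooZ | apply: small_ooM].
  by rewrite rmorphM ev_atM rmorphM /= he hf; ring.
Qed.

(** The value in [K] is the constant term plus a function that is small at infinity. Were the sum 0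
    with a nonzero constant [k], freeness would give [A = - k D], against [size A < size D]. *)
Lemma oo_neq0 v : ev_at 0 0 v != 0 -> ev2 cK (x / y) y^-1 v != 0.
Proof.
have [e [A [B [D [D0 he sA sB]]]] ->] := oo_normal v.
apply: contra_neq => /eqP; rewrite addr_eq0 => /eqP h.
have : ix (A + (ev_at 0 0 v) *: D) + ix B * y = 0.
  by rewrite rmorphD /= -mul_polyC rmorphM /= -/(cK _) h addrAC -he; ring.
move=> /ix_free[/eqP + _]; rewrite addr_eq0 => /eqP hA.
apply/eqP/negPn/negP => c0; move: sA; rewrite hA size_polyN size_scale // ltnn //.
Qed.

End Elliptic.

(** * Orders of [A + B y] at affine points and at infinity *)

Section LocalOrders.
Variables (C : numClosedFieldType) (t : C) (K : fieldType) (cub : {poly C}).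
Variables (ix : {rmorphism {poly C} -> K}) (y : K).
Hypotheses (t0 : t != 0) (t1 : t != 1).
Hypothesis cubE : cub = cubic t.
Hypothesis y2 : y ^+ 2 = ix cub.
Hypothesis ix_free : forall A B, ix A + ix B * y = 0 -> A = 0 /\ B = 0.

Local Notation x := (ix 'X).
Definition affine_eval : {rmorphism {poly {poly C}} -> K} := ev2 (cK ix) x y.
Definition infinity_eval : {rmorphism {poly {poly C}} -> K} :=
  ev2 (cK ix) (x / y) y^-1.
Definition point_eval (a b : C) : {rmorphism {poly {poly C}} -> C} := ev_at a b.
Local Notation ph0 := affine_eval.
Local Notation phoo := infinity_eval.
Let y0 : y != 0 := y_neq0 ix_free.

(** At a branch point the curve is tangent to the vertical line and [y] is the local coordinate;
    elsewhere [x - a] is. *)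
Definition unif (a b : C) : K := if b == 0 then y else ix ('X - a%:P).
Local Notation sp a b := (specializes ph0 (point_eval a b)).
Local Notation ho a b := (has_order ph0 (point_eval a b) (unif a b)).
Local Notation spoo := (specializes phoo (point_eval 0 0)).
Local Notation hooo := (has_order phoo (point_eval 0 0) (x / y)).

Lemma affine_eval_neq0 a b : b ^+ 2 = cub.[a] ->
  forall s, point_eval a b s != 0 -> ph0 s != 0.
Proof. exact: (affine_neq0 y2 ix_free). Qed.

Lemma infinity_eval_neq0 s : point_eval 0 0 s != 0 -> phoo s != 0.
Proof. exact: (oo_neq0 cubE y2 ix_free). Qed.

Lemma cub_horner a : cub.[a] = a * (a - 1) * (a - t).
Proof. by rewrite cubE /cubic !hornerE. Qed.

Lemma spec_at_ix a b A : sp a b (ix A) A.[a].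
Proof.
by apply: (spec_phiE (s := map_poly polyC A)); [rewrite [RHS](ix_poly ix y) | apply: ev_at_poly].
Qed.

Lemma spec_at_y a b : sp a b y b.
Proof. by apply: (spec_phiE (s := 'X%:P)); [apply: ev2Y | apply: ev_atY]. Qed.

Lemma spec_at_N a b A B : sp a b (ix A + ix B * y) (A.[a] + B.[a] * b).
Proof. by apply: specD; [|apply: specM];
  [exact: spec_at_ix|exact: spec_at_ix|exact: spec_at_y]. Qed.

Lemma unif_neq0 a b : unif a b != 0.
Proof. by rewrite /unif; case: (b == 0); rewrite ?(ix_eq0 ix_free) ?polyXsubC_eq0. Qed.

Lemma spec_at_unif a b : sp a b (unif a b) 0.
Proof.
rewrite /unif; case: eqP => [b0|_]; first by rewrite -[X in specializes _ _ _ X]b0;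
  exact: spec_at_y.
have -> : 0 = ('X - a%:P).[a] by rewrite !hornerE subrr.
exact: spec_at_ix.
Qed.

(** The roots 0, 1, t are distinct, hence simple. *)
Lemma cub_double a : cub.[a] = 0 -> exists2 Q, cub = ('X - a%:P) * Q & Q.[a] != 0.
Proof.
move=> ca; have : a * (a - 1) * (a - t) == 0 by rewrite -cub_horner ca.
have t1' : 1 - t != 0 by rewrite subr_eq0 eq_sym.
have t1'' : t - 1 != 0 by rewrite subr_eq0.
rewrite !mulf_eq0 !subr_eq0 => /orP[/orP[]|] /eqP ->.
- exists (('X - 1%:P) * ('X - t%:P)); first by rewrite cubE /cubic subr0 mulrA.
  by rewrite !hornerE mulf_neq0 ?oppr_eq0 ?oner_eq0.
- exists ('X * ('X - t%:P)); first by rewrite cubE /cubic; ring.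
  by rewrite !hornerE.
- exists ('X * ('X - 1%:P)); first by rewrite cubE /cubic; ring.
  by rewrite !hornerE mulf_neq0.
Qed.

(** At a branch point [y^2 = (x - a) Q] with [Q] a unit, so [x - a] is [Q^-1] times the square of
    the local coordinate. *)
Lemma order_at_XsubC a b : b ^+ 2 = cub.[a] ->
  ho a b (if b == 0 then 2 else 1) (ix ('X - a%:P)).
Proof.
move=> E; have z0 := unif_neq0 a b.
have [b0|b0] := eqVneq b 0; last first.
  apply: (has_orderI z0 (g := 1) (c := 1)); rewrite ?oner_neq0 ?mul1r ?expr1z //.
  - by rewrite /unif (negPf b0).
  - exact: spec1.
have [Q cQ Qa] : exists2 Q, cub = ('X - a%:P) * Q & Q.[a] != 0.
  by apply: cub_double; rewrite -E b0 expr0n.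
have Q0 : Q != 0 by apply: contra_neq Qa => ->; rewrite horner0.
apply: (has_orderI z0 (g := (ix Q)^-1) (c := Q.[a]^-1)) => //.
- by rewrite /unif b0 eqxx -exprnP y2 cQ rmorphM /= mulrC mulfK // (ix_eq0 ix_free).
- by apply: (specV (affine_eval_neq0 E)) => //; exact: spec_at_ix.
- by rewrite invr_eq0.
Qed.

(** The order is the multiplicity of the root [a] times the ramification index. It is chosen before
    [b], so that both points over [a] share it; this is what the comparison of conjugates relies
    on. *)
Lemma order_at_ix a R : R != 0 -> exists k, forall b, b ^+ 2 = cub.[a] -> ho a b k (ix R).
Proof.
move=> R0; have [m [Q]] := multiplicity_XsubC R a; rewrite R0 /= => Qa eR.
pose d : int := if cub.[a] == 0 then 2 else 1.
exists (d * m%:Z) => b E; have zn := unif_neq0 a b.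
have hd : ho a b d (ix ('X - a%:P)).
  by rewrite /d -E sqrf_eq0; apply: order_at_XsubC.
have {}hd : ho a b (d * m%:Z) (ix ('X - a%:P) ^+ m).
  elim: (m) => [|i IH].
    rewrite mulr0; apply: (has_order0 (c := 1)); last exact: oner_neq0.
    exact: spec1.
  by rewrite exprS -addn1 PoszD addrC mulrDr mulr1; apply: has_orderM.
rewrite eR rmorphM rmorphXn /= -[d * _]add0r; apply: has_orderM => //.
by apply: (has_order0 (spec_at_ix _ _ _)).
Qed.

(* Once A and B are coprime, A + B y and A - B y cannot both vanish at an unramified
   point, while their product is a polynomial in x. *)
Lemma order_at_conj a b A B : b ^+ 2 = cub.[a] -> (A != 0) || (B != 0) ->
  exists n, ho a b n (ix A + ix B * y) /\ ho a (- b) n (ix A - ix B * y).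
Proof.
move=> E AB0; have E' : (- b) ^+ 2 = cub.[a] by rewrite sqrrN.
have star := affine_eval_neq0 E; have star' := affine_eval_neq0 E'.
pose G := gcdp A B; pose A1 := A %/ G; pose B1 := B %/ G.
have G0 : G != 0 by rewrite gcdp_eq0 negb_and.
have eA : A = A1 * G by rewrite divpK ?dvdp_gcdl.
have eB : B = B1 * G by rewrite divpK ?dvdp_gcdr.
have cop : coprimep A1 B1 by apply: coprimep_div_gcd.
have [k hk] := order_at_ix a G0.
suff [n [h h']] : exists n, ho a b n (ix A1 + ix B1 * y) /\
    ho a (- b) n (ix A1 - ix B1 * y).
  exists (n + k); rewrite eA eB !rmorphM /= mulrAC -mulrDl -mulrBl.
  by split; apply: has_orderM => //; rewrite ?unif_neq0 //; apply: hk.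
have spN := spec_at_N a b A1 B1.
have spN' : sp a (- b) (ix A1 - ix B1 * y) (A1.[a] + B1.[a] * b).
  have := spec_at_N a (- b) A1 (- B1).
  by rewrite rmorphN hornerN mulrNN mulNr.
have [s0|s0] := eqVneq (A1.[a] + B1.[a] * b) 0; last first.
  by exists 0; split; [apply: has_order0 spN s0 | apply: has_order0 spN' s0].
have notboth : A1.[a] = 0 -> B1.[a] != 0.
  by move=> A1a; apply: (coprimep_root cop); rewrite rootE A1a.
(* At a branch point both conjugates are considered at the same point. Writing [A1 = A2 (x - a)] and
   [x - a = y^2 / Q] gives [A1 + B1 y = (A2 y / Q + B1) y], of order exactly 1 since [B1] does not
   vanish at [a]. *)
have [b0|b0] := eqVneq b 0.
  move: s0; rewrite b0 mulr0 addr0 => A1a; have B1a := notboth A1a.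
  have [A2 eA2] : exists A2, A1 = A2 * ('X - a%:P) by apply/factor_theorem; rewrite rootE A1a.
  have ca : cub.[a] = 0 by rewrite -E b0 expr0n.
  have [Q cQ Qa] := cub_double ca.
  have Q0 : Q != 0 by apply: contra_neq Qa => ->; rewrite horner0.
  have iQ0 : ix Q != 0 by rewrite (ix_eq0 ix_free).
  have eX : ix ('X - a%:P) = y / ix Q * y.
    by rewrite mulrAC -expr2 y2 cQ rmorphM /= mulfK.
  exists 1; rewrite oppr0.
  have key (B2 : {poly C}) : B2.[a] != 0 -> ho a 0 1 (ix A1 + ix B2 * y).
    move=> B2a; rewrite b0 in star; rewrite eA2 rmorphM /= eX.
    apply: (has_orderI (unif_neq0 a 0) (g := ix A2 * (y / ix Q) + ix B2) (c := A2.[a] * (0 /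
      Q.[a]) + B2.[a])).
    - by rewrite /unif eqxx expr1z; ring.
    - apply: specD; last exact: spec_at_ix.
      apply: specM; first exact: spec_at_ix.
      by apply: specM; [exact: spec_at_y | apply: (specV star) => //; exact: spec_at_ix].
    - by rewrite mul0r mulr0 add0r.
  split; first exact: key.
  by have := key (- B1); rewrite rmorphN mulNr hornerN oppr_eq0; apply.
(* Elsewhere, [A1 + B1 y] vanishes at [(a, b)] and its conjugate does not. So at [(a, b)] it carries
   the whole order of the norm [R], and at [(a, -b)] the conjugate does. *)
pose R := A1 ^+ 2 - B1 ^+ 2 * cub.
have eR : (ix A1 + ix B1 * y) * (ix A1 - ix B1 * y) = ix R.
  by rewrite rmorphB !rmorphM /= -y2; ring.
have R0 : R != 0.
  rewrite -(ix_eq0 ix_free) -eR mulf_neq0 //; apply/eqP => e.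
    have [eA1 eB1] := ix_free e.
    by move: notboth; rewrite eA1 eB1 !horner0 eqxx => /(_ erefl).
  have [|eA1 /eqP] := @ix_free A1 (- B1); first by rewrite rmorphN mulNr.
  rewrite oppr_eq0 => /eqP eB1.
  by move: notboth; rewrite eA1 eB1 !horner0 eqxx => /(_ erefl).
(* If both values vanished, their sum [2 A1(a)] would be 0, and then [B1(a) = 0] because [b != 0],
   against coprimality. *)
have s'0 : A1.[a] + B1.[a] * - b != 0.
  apply/eqP => s'0.
  have A1a : A1.[a] = 0.
    have : (2 : C) * A1.[a] == 0.
      rewrite (_ : 2 * _ = A1.[a] + B1.[a] * b + (A1.[a] + B1.[a] * - b)); last by ring.
      by rewrite s0 s'0 addr0.
    by rewrite mulf_eq0 pnatr_eq0 => /eqP.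
  move: s0; rewrite A1a add0r => /eqP; rewrite mulf_eq0 (negPf b0) orbF.
  by rewrite (negPf (notboth A1a)).
have [j hj] := order_at_ix a R0; exists j.
have o1 : ho a b 0 (ix A1 - ix B1 * y).
  rewrite (_ : ix A1 - _ = ix A1 + ix (- B1) * y); last by rewrite rmorphN mulNr.
  by apply: (has_order0 (spec_at_N _ _ _ _)); rewrite hornerN mulNr -mulrN.
have o2 : ho a (- b) 0 (ix A1 + ix B1 * y).
  by apply: (has_order0 (spec_at_N _ _ _ _)).
have n1 := has_order_neq0 star o1; have n2 := has_order_neq0 star' o2.
split.
- rewrite -[X in has_order _ _ _ _ X](mulfK n1) eR -[j]addr0 -oppr0.
  apply: has_orderM; [exact: unif_neq0 | exact: hj |exact: (has_orderV star)].
- rewrite -[X in has_order _ _ _ _ X](mulKf n2) eR -[j]add0r -{1}oppr0.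
  apply: has_orderM; [exact: unif_neq0 | exact: (has_orderV star') | exact: hj].
Qed.

Let z0 : x / y != 0.
Proof. by rewrite mulf_neq0 ?invr_eq0 // (ix_eq0 ix_free) polyX_eq0. Qed.

Lemma spec_oo_z : spoo (x / y) 0.
Proof. by apply: (spec_phiE (s := 'X)); [apply: ev2X | apply: ev_atX]. Qed.

Lemma spec_oo_yV : spoo y^-1 0.
Proof. by apply: (spec_phiE (s := 'X%:P)); [apply: ev2Y | apply: ev_atY]. Qed.

Lemma spec_oo_C c : spoo (cK ix c) c.
Proof. by apply: (spec_phiE (s := c%:P%:P)); [apply: ev2CC | apply: ev_atCC]. Qed.

Lemma order_oo_y : hooo (- 3%:Z)%R y.
Proof.
have star := infinity_eval_neq0.
rewrite -[X in has_order _ _ _ _ X]invrK; apply: (has_orderV star).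
(* Dividing [x^3 = y^2 + (1 + t) x^2 - t x] by [y^2] gives [x^3 / y^2 = g], that is
   [y^-1 = g^-1 (x / y)^3], where [g] has residue 1. *)
pose g := cK ix 1 + cK ix (1 + t) * ((x / y) * (x / y)) + cK ix (- t) * (x / y * y^-1).
have hg : spoo g (1 + (1 + t) * (0 * 0) + (- t) * (0 * 0)).
  have hz := spec_oo_z; have hy := spec_oo_yV; have hC := spec_oo_C.
  by rewrite /g; do !(apply: specD || apply: specM).
move: hg; rewrite !mulr0 !addr0 => hg.
have g0 := spec_neq0 star hg (oner_neq0 _).
apply: (has_orderI z0 (g := g^-1) (c := 1^-1)).
- apply: (mulIf g0); rewrite mulrAC mulVf // mul1r -exprnP.
  have := y2; rewrite cubE /cubic !rmorphM !rmorphB /= => e.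
  rewrite /g /cK !(rmorph1, rmorphD, rmorphN) /= -/(cK ix t).
  have e2 : y ^+ 2 + (1 + cK ix t) * x ^+ 2 - cK ix t * x = x ^+ 3.
    by rewrite e rmorph1 -/(cK ix t); ring.
  have -> : (x / y) ^+ 3 = (y ^+ 2 + (1 + cK ix t) * x ^+ 2 - cK ix t * x) / y ^+ 3.
    by rewrite e2; field.
  by field.
- exact: (specV star hg (oner_neq0 _)).
- by rewrite invr_eq0 oner_eq0.
Qed.

Lemma order_oo_x : hooo (- 2%:Z)%R x.
Proof.
suff: hooo (1 + - 3%:Z)%R (x / y * y) by rewrite divfK.
by apply: has_orderM => //; [exact: has_order_unif | exact: order_oo_y].
Qed.

Lemma order_oo_C c : c != 0 -> hooo 0 (cK ix c).
Proof. exact: (has_order0 (spec_oo_C c)). Qed.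

(** Each factor [x] contributes a double pole. In the Horner step the added constant has order 0,
    above the order of the product with [x], so it cannot cancel the pole. *)
Lemma order_oo_ix (A : {poly C}) : A != 0 -> hooo (- ((size A).-1 * 2)%:Z) (ix A).
Proof.
elim/poly_ind: A => [|A c IH]; first by rewrite eqxx.
have [->|A0 _] := eqVneq A 0.
  rewrite mul0r add0r polyC_eq0 size_polyC => c0; rewrite c0; exact: order_oo_C.
have hA : hooo (- (size A * 2)%:Z) (ix A * x).
  rewrite (_ : - _ = - ((size A).-1 * 2)%:Z + - 2%:Z).
    by apply: (has_orderM z0 (IH A0) order_oo_x).
  by move: A0; rewrite -size_poly_gt0; move: (size A); clear; lia.
rewrite size_MXaddC (negPf A0) /= (rmorphD ix) (rmorphM ix).
have [->|c0] := eqVneq c 0; first by rewrite polyC0 rmorph0 addr0; exact: hA.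
apply: (has_orderD z0 spec_oo_z _ hA (order_oo_C c0)).
by move: A0; rewrite -size_poly_gt0; move: (size A); clear; lia.
Qed.

(** At infinity [A] has even order and [B y] odd order. The two terms never cancel, and the sign
    between them does not affect which one dominates. *)
Lemma order_oo_conj (A B : {poly C}) : (A != 0) || (B != 0) ->
  exists n, hooo n (ix A + ix B * y) /\ hooo n (ix A - ix B * y).
Proof.
have hB : B != 0 -> hooo (- ((size B).-1 * 2)%:Z - 3%:Z)%R (ix B * y).
  by move=> B0; apply: (has_orderM z0 (order_oo_ix B0) order_oo_y).
have [->|A0] := eqVneq A 0; have [->|B0] := eqVneq B 0 => //= _.
- exists (- ((size B).-1 * 2)%:Z - 3%:Z); rewrite rmorph0 add0r sub0r.
  by split; [|apply: has_orderN]; apply: hB.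
- exists (- ((size A).-1 * 2)%:Z); rewrite rmorph0 mul0r subr0 addr0.
  by split; apply: order_oo_ix.
have hA := order_oo_ix A0; have {}hB := hB B0; have hBN := has_orderN hB.
case: (ltgtP (- ((size B).-1 * 2)%:Z - 3%:Z)%R (- ((size A).-1 * 2)%:Z)) => lt.
- exists (- ((size B).-1 * 2)%:Z - 3%:Z); rewrite [ix A + _]addrC [ix A - _]addrC.
  by split; apply: (has_orderD z0 spec_oo_z lt).
- exists (- ((size A).-1 * 2)%:Z).
  by split; apply: (has_orderD z0 spec_oo_z lt).
- by exfalso; move: lt; move: (size A).-1 (size B).-1; clear; lia.
Qed.

End LocalOrders.

(** * Divisors of functions on the elliptic curve *)

Section EllipticOrder.
Variables (C : numClosedFieldType) (t : C) (K : fieldType) (cub : {poly C}).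
Variables (ix : {rmorphism {poly C} -> K}) (y : K) (dK : K -> K).
Hypotheses (t0 : t != 0) (t1 : t != 1).
Hypothesis cubE : cub = cubic t.
Hypothesis y2 : y ^+ 2 = ix cub.
Hypothesis ix_free : forall A B, ix A + ix B * y = 0 -> A = 0 /\ B = 0.
Hypothesis frac_ix : forall f : K, exists A B D,
  D != 0 /\ f = (ix A + ix B * y) / ix D.

Local Notation x := (ix 'X).
Local Notation pt := (ell_point t).
Implicit Types (P : pt) (f g : K) (n m : int).

Definition wloc P : set K :=
  let: (xi, eta, (a, b)) :=
    if P is Some ab then (x, y, sval ab) else (x / y, y^-1, (0, 0)) in
  [set f | exists u v : {poly {poly C}}, v.[a, b] <> 0 /\
     f * (map_poly (map_poly (cK ix)) v).[xi, eta]
     = (map_poly (map_poly (cK ix)) u).[xi, eta]].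

(* The curve [Ell t] over an abstract function field K: unification would otherwise
   try to compute in the quotient ring defining [ell_field t]. *)
Definition wcurve : curve C := @Curve C K (cK ix) pt wloc dK.

Definition pphi P : {rmorphism {poly {poly C}} -> K} :=
  if P is Some _ then affine_eval ix y else infinity_eval ix y.
Definition ppsi P : {rmorphism {poly {poly C}} -> C} :=
  if P is Some ab then point_eval (sval ab).1 (sval ab).2 else point_eval 0 0.
Definition punif P : K :=
  if P is Some ab then unif ix y (sval ab).1 (sval ab).2 else x / y.

Definition pspec P := specializes (pphi P) (ppsi P).
Definition porder P := has_order (pphi P) (ppsi P) (punif P).

Lemma pt_cub (ab : {ab : C * C | ab.2 ^+ 2 == ab.1 * (ab.1 - 1) * (ab.1 - t)}) :
  (sval ab).2 ^+ 2 = cub.[(sval ab).1].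
Proof. by rewrite (cub_horner cubE); apply/eqP; exact: (svalP ab). Qed.

Lemma pstar P s : ppsi P s != 0 -> pphi P s != 0.
Proof.
case: P => [ab|]; last exact: (infinity_eval_neq0 cubE y2 ix_free).
exact: (affine_eval_neq0 y2 ix_free (pt_cub ab)).
Qed.

Lemma punif_neq0 P : punif P != 0.
Proof.
case: P => [ab|]; first exact: (unif_neq0 ix_free).
by rewrite mulf_neq0 ?invr_eq0 ?(ix_eq0 ix_free) ?polyX_eq0 // (y_neq0 ix_free).
Qed.

Lemma punif_spec P : pspec P (punif P) 0.
Proof. by case: P => [ab|]; [apply: spec_at_unif | apply: spec_oo_z]. Qed.

Lemma wloc_spec P f : wloc P f <-> exists c, pspec P f c.
Proof.
have aux (phi : {rmorphism {poly {poly C}} -> K}) (psi : {rmorphism {poly {poly C}} -> C}) :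
    (exists u v, psi v <> 0 /\ f * phi v = phi u) <-> exists c, specializes phi psi f c.
  split=> [[u [v [/eqP v0 e]]]|[c [u [v [/eqP v0 e _]]]]]; last by exists u, v.
  by exists (psi u / psi v), u, v; rewrite divfK.
case: P => [[[a b] E]|]; first exact: (aux (affine_eval ix y) (point_eval a b)).
exact: (aux (infinity_eval ix y) (point_eval 0 0)).
Qed.

(** The hyperelliptic involution; on functions it corresponds to the conjugation
    [A + B y -> A - B y]. *)
Definition negp P : pt :=
  if P is Some ab then
    Some (exist _ ((sval ab).1, - (sval ab).2) (etrans (congr1 (eq_op^~ _) (sqrrN _)) (svalP ab)))
  else None.

Lemma negpK : involutive negp.
Proof.
case=> [[[a b] E]|] //=; congr Some; apply: val_inj => /=; by rewrite opprK.
Qed.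

Lemma porder_conj P A B : (A != 0) || (B != 0) ->
  exists n, porder P n (ix A + ix B * y) /\ porder (negp P) n (ix A - ix B * y).
Proof.
case: P => [ab|] AB0; last exact: (order_oo_conj cubE y2 ix_free AB0).
exact: (order_at_conj t0 t1 cubE y2 ix_free (pt_cub ab) AB0).
Qed.

Lemma porder_ex P f : f != 0 -> exists n, porder P n f.
Proof.
move=> f0; have [A [B [D [D0 e]]]] := frac_ix f.
have num0 : (A != 0) || (B != 0).
  apply: contra_neqT f0; rewrite negb_or !negbK => /andP[/eqP A0 /eqP B0].
  by rewrite e A0 B0 rmorph0 mul0r addr0 mul0r.
have [n [hn _]] := porder_conj P num0.
have D00 : (D != 0) || ((0 : {poly C}) != 0) by rewrite D0.
have [m [hm _]] := porder_conj P D00; exists (n - m); rewrite e.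
apply: (has_orderM (punif_neq0 P) hn); apply: (has_orderV (@pstar P)).
by move: hm; rewrite rmorph0 mul0r addr0.
Qed.

(** The default 0 is the value at [f = 0], which has no order. *)
Definition pord P f : int := xget 0 [set n | porder P n f].

Lemma pord_eq P n f : porder P n f -> pord P f = n.
Proof.
move=> h; have h' : porder P (pord P f) f.
  exact: (@xgetPex _ 0 [set n | porder P n f] (ex_intro _ n h)).
exact: (has_order_uniq (@pstar P) (punif_neq0 P) (punif_spec P) h' h).
Qed.

Lemma pordP P f : f != 0 -> porder P (pord P f) f.
Proof. by move=> /porder_ex -/(_ P)[n h]; rewrite (pord_eq h). Qed.

Lemma pordM P f g : f != 0 -> g != 0 -> pord P (f * g) = pord P f + pord P g.
Proof.
move=> f0 g0; apply: pord_eq; apply: (has_orderM (punif_neq0 P)); exact: pordP.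
Qed.

Lemma pordV P f : f != 0 -> pord P f^-1 = - pord P f.
Proof. by move=> f0; apply: pord_eq; apply: (has_orderV (@pstar P)); exact: pordP. Qed.

Lemma pord_spec P f : f != 0 -> (exists c, pspec P f c) <-> 0 <= pord P f.
Proof.
by move=> f0; apply: (has_order_ge0 (@pstar P) (punif_neq0 P) (punif_spec P)); apply: pordP.
Qed.

Lemma pord_spec0 P f c : pspec P f c -> c != 0 -> pord P f = 0.
Proof. by move=> h c0; apply: pord_eq; apply: (has_order0 h c0). Qed.

Lemma pord_spec_pos P f : f != 0 -> pspec P f 0 -> 1 <= pord P f.
Proof.
move=> f0 h; have : 0 <= pord P f by apply/(pord_spec P f0); exists 0.
rewrite le_eqVlt => /orP[/eqP e|]; last by rewrite -gtz0_ge1.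
have [c c0] := pordP P f0; rewrite -e oppr0 expr0z mulr1 => h'.
by move: c0; rewrite (spec_uniq (@pstar P) h' h) eqxx.
Qed.

Lemma pord_unif P : pord P (punif P) = 1.
Proof. by apply: pord_eq; apply: has_order_unif; apply: punif_neq0. Qed.

Lemma pord_oo_C c : c != 0 -> pord None (cK ix c) = 0.
Proof. by move=> c0; apply: pord_eq; apply: order_oo_C. Qed.
Lemma pord_oo_x : pord None x = - 2%:Z.
Proof. by apply: pord_eq; apply: (order_oo_x cubE y2 ix_free). Qed.
Lemma pord_oo_y : pord None y = - 3%:Z.
Proof. by apply: pord_eq; apply: (order_oo_y cubE y2 ix_free). Qed.
Lemma pord_oo_ix (A : {poly C}) : A != 0 -> pord None (ix A) = - ((size A).-1 * 2)%:Z.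
Proof. by move=> A0; apply: pord_eq; apply: (order_oo_ix cubE y2 ix_free). Qed.

Lemma pspec_ix ab A : pspec (Some ab) (ix A) A.[(sval ab).1].
Proof. exact: spec_at_ix. Qed.
Lemma pspec_y ab : pspec (Some ab) y (sval ab).2.
Proof. exact: spec_at_y. Qed.
Lemma pord_XsubC ab : pord (Some ab) (ix ('X - (sval ab).1%:P)) =
  if (sval ab).2 == 0 then 2%:Z else 1.
Proof.
by apply: pord_eq; exact: (order_at_XsubC t0 t1 cubE y2 ix_free (pt_cub ab)).
Qed.

Lemma pord_y ab : pord (Some ab) y = ((sval ab).2 == 0)%:Z.
Proof.
have [b0|b0] := eqVneq (sval ab).2 0; last exact: (pord_spec0 (pspec_y ab)).
by have := pord_unif (Some ab); rewrite /= /unif b0 eqxx.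
Qed.

Definition balanced (D : pt -> int) := finsupp D /\ \sum_(P \in [set: pt]) D P = 0.
Definition principal f := balanced (pord^~ f).

Lemma principalM f g : f != 0 -> g != 0 -> principal f -> principal g -> principal (f * g).
Proof.
move=> f0 g0 [ff sf] [fg sg].
have e : (pord^~ (f * g)) = (fun P => pord P f + pord P g).
  by apply/funext => P; apply: pordM.
by rewrite /principal e; split; [apply: finsuppD | rewrite fsumD // sf sg addr0].
Qed.

Lemma principalV f : f != 0 -> principal f -> principal f^-1.
Proof.
move=> f0 [ff sf].
have e : (pord^~ f^-1) = (fun P => - pord P f).
  by apply/funext => P; apply: pordV.
by rewrite /principal e; split; [apply: finsuppN | rewrite fsumN // sf oppr0].
Qed.

Lemma principal_C c : c != 0 -> principal (cK ix c).
Proof.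
move=> c0; have e P : pord P (cK ix c) = 0.
  case: P => [ab|]; last exact: pord_oo_C.
  apply: (pord_spec0 (pspec_ix ab c%:P)); by rewrite hornerC.
split; first by apply: (@finsupp_sub _ _ set0) => // P _; apply: e.
by apply: fsbig1 => P _; apply: e.
Qed.

Lemma pt_eq ab ab' : (Some ab == Some ab' :> pt) = (sval ab == sval ab').
Proof. by []. Qed.

Lemma sqrt_pt_proof a s : s ^+ 2 = cub.[a] -> (a, s).2 ^+ 2 == (a, s).1 * ((a, s).1 - 1) * ((a,
  s).1 - t).
Proof. by move=> /= ->; rewrite (cub_horner cubE). Qed.

(** [P1] and [P2] are the two points over [a]. They coincide at a branch point, and the sum then
    counts the double zero there. *)
Lemma div_XsubC a : exists P1 P2 : pt, forall P, pord P (ix ('X - a%:P)) =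
  (P == P1)%:R + (P == P2)%:R - ((P == None)%:R + (P == None)%:R).
Proof.
have [s hs] : exists s, s ^+ 2 = cub.[a] by exists (sqrtC cub.[a]); apply: sqrtCK.
have hs' : (- s) ^+ 2 = cub.[a] by rewrite sqrrN.
exists (Some (exist _ (a, s) (sqrt_pt_proof hs))).
exists (Some (exist _ (a, - s) (sqrt_pt_proof hs'))).
move=> [ab|]; last first.
  by rewrite pord_oo_ix ?polyXsubC_eq0 // size_XsubC.
rewrite !pt_eq subr0; case: ab => -[a' b] /= E.
set ab := exist _ _ _.
have [ea|na] := eqVneq a' a; last first.
  rewrite !xpair_eqE (negPf na) /= addr0.
  apply: (pord_spec0 (pspec_ix ab ('X - a%:P))).
  by rewrite /= !hornerE subr_eq0.
have := pord_XsubC ab; rewrite /= ea => ->.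
have : (b == s) || (b == - s).
  rewrite -eqf_sqr hs; apply/eqP; rewrite (cub_horner cubE) -ea; exact/eqP.
rewrite !xpair_eqE eqxx /=; have [s0|s0] := eqVneq s 0.
  by rewrite s0 oppr0 orbb => /eqP ->; rewrite eqxx.
have ns : (s == - s) = false.
  by rewrite -addr_eq0 -mulr2n mulrn_eq0 /= (negPf s0).
case/orP => /eqP ->; first by rewrite (negPf s0) eqxx ns.
by rewrite oppr_eq0 (negPf s0) eqxx eq_sym ns.
Qed.

Lemma principal_XsubC a : principal (ix ('X - a%:P)).
Proof.
have [P1 [P2 /funext e]] := div_XsubC a.
have f2 : finsupp (fun P : pt => (P == None)%:R + (P == None)%:R).
  by apply: finsuppD; apply: finsupp_pt.
have f1 : finsupp (fun P : pt => (P == P1)%:R + (P == P2)%:R).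
  by apply: finsuppD; apply: finsupp_pt.
have fN := finsuppN f2.
rewrite /principal e; split; first exact: (finsuppD f1 fN).
rewrite (fsumD f1 fN) (fsumN f2).
rewrite (fsumD (finsupp_pt P1) (finsupp_pt P2)).
rewrite (fsumD (finsupp_pt (None : pt)) (finsupp_pt (None : pt))).
by rewrite (fsum_pt P1) (fsum_pt P2) (fsum_pt (None : pt)) subrr.
Qed.

Lemma principal_ix A : A != 0 -> principal (ix A).
Proof.
have [rs eA] := closed_field_poly_normal A.
move=> A0; rewrite eA -mul_polyC rmorphM rmorph_prod /=.
have lc0 : lead_coef A != 0 by rewrite lead_coef_eq0.
have p0 : ix 1 != 0 /\ principal (ix 1).
  split; first by rewrite rmorph1 oner_eq0.
  by rewrite -polyC1; apply: principal_C; exact: oner_neq0.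
suff [q0 pr] : (\prod_(z <- rs) ix ('X - z%:P) != 0) /\ principal (\prod_(z <- rs) ix ('X - z%:P)).
  apply: principalM => //; last by apply: principal_C.
  by rewrite (ix_eq0 ix_free) polyC_eq0.
elim: rs {eA} => [|z rs [IH0 IH]]; first by rewrite big_nil -(rmorph1 ix).
have z0 : ix ('X - z%:P) != 0 by rewrite (ix_eq0 ix_free) polyXsubC_eq0.
rewrite big_cons mulf_neq0 //; split=> //; apply: principalM => //; exact: principal_XsubC.
Qed.

Lemma principal_N A B : (A != 0) || (B != 0) -> principal (ix A + ix B * y).
Proof.
move=> AB0; set f := _ + _; pose f' := ix A - ix B * y.
have f0 : f != 0.
  apply/eqP => /ix_free[A0 B0]; by move: AB0; rewrite A0 B0 eqxx.
have f0' : f' != 0.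
  apply/eqP => e; have [|A0 /eqP] := @ix_free A (- B); first by rewrite rmorphN mulNr.
  by rewrite oppr_eq0 => /eqP B0; move: AB0; rewrite A0 B0 eqxx.
have opp P : pord P f = pord (negp P) f'.
  by have [n [/pord_eq -> /pord_eq ->]] := porder_conj P AB0.
pose R := A ^+ 2 - B ^+ 2 * cub.
have eR : f * f' = ix R by rewrite /f /f' rmorphB !rmorphM /= -y2; ring.
have R0 : R != 0 by rewrite -(ix_eq0 ix_free) -eR mulf_neq0.
have [fR sR] := principal_ix R0.
have hR P : pord P f + pord P f' = pord P (ix R) by rewrite -eR pordM.
have ge0 ab g : (exists c, pspec (Some ab) g c) -> g != 0 -> 0 <= pord (Some ab) g.
  by move=> h g0; apply/(pord_spec _ g0).
(* At an affine point [f] and its conjugate are both regular, so [f] has order 0 wherever the norm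
   [R] has. *)
have ff : finsupp (pord^~ f).
  apply: (@finsupp_sub _ _ ([set P | pord P (ix R) <> 0] `|` [set None])).
    by rewrite finite_setU; split.
  case=> [ab|] /not_orP[/contrapT h1 h2]; last by case: h2.
  have h3 : 0 <= pord (Some ab) f.
    by apply: ge0 => //; exists (A.[(sval ab).1] + B.[(sval ab).1] * (sval ab).2); apply: spec_at_N.
  have h4 : 0 <= pord (Some ab) f'.
    apply: ge0 => //; exists (A.[(sval ab).1] + (- B).[(sval ab).1] * (sval ab).2).
    by have := spec_at_N ix y (sval ab).1 (sval ab).2 A (- B); rewrite rmorphN mulNr.
  by move: (hR (Some ab)) h3 h4; rewrite h1; clear; lia.
split=> //.
have ff' : finsupp (pord^~ f').
  apply: (@finsupp_sub _ _ [set P | (pord P (ix R) - pord P f) <> 0]).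
    by apply: finsuppD => //; apply: finsuppN.
  by move=> P /contrapT; rewrite -hR addrAC subrr add0r.
have sff : \sum_(P \in [set: pt]) pord P f = \sum_(P \in [set: pt]) pord P f'.
  rewrite (@reindex_fsbigT _ _ _ _ _ negp) /=; last exact: (inv_bij negpK).
  by apply: eq_fsbigr => P _; rewrite opp negpK.
have : \sum_(P \in [set: pt]) pord P f + \sum_(P \in [set: pt]) pord P f' = 0.
  by rewrite -fsumD // -[RHS]sR; apply: eq_fsbigr => P _; rewrite hR.
by rewrite -sff; move: (\sum_(P \in _) _) => u; clear; lia.
Qed.

Lemma principal_all f : f != 0 -> principal f.
Proof.
move=> f0; have [A [B [D [D0 e]]]] := frac_ix f.
have num0 : (A != 0) || (B != 0).
  apply: contra_neqT f0; rewrite negb_or !negbK => /andP[/eqP A0 /eqP B0].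
  by rewrite e A0 B0 rmorph0 mul0r addr0 mul0r.
have iD0 : ix D != 0 by rewrite (ix_eq0 ix_free).
rewrite e; apply: principalM; rewrite ?invr_eq0 //; first 1 last.
- exact: principal_N.
- by apply: principalV => //; exact: principal_ix.
- by apply: contra_neq f0 => h; rewrite e h mul0r.
Qed.

Lemma wcurve_order : @curve_order C wcurve pord.
Proof.
split=> /=.
- by move=> P; apply/wloc_spec; exists 0; apply: spec0.
- move=> P f g /wloc_spec[c hc] /wloc_spec[d hd]; apply/wloc_spec.
  by exists (c + d); apply: specD.
- by move=> P f f0; apply: (iff_trans (wloc_spec P f)); apply: pord_spec.
- exact: pordM.
- by move=> P; exists (punif P); [apply: punif_neq0 | apply: pord_unif].
- by move=> f /principal_all[].
- by move=> f /principal_all[].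
Qed.

End EllipticOrder.

(** * The bundle in an adapted frame *)

Section ChangeOfFrame.
Variables (C : fieldType) (X : curve C) (ord : pnt X -> fnf X -> int).
Hypothesis ordX : curve_order ord.
Local Notation K := (fnf X).

(** The lattice [E] written in coordinates relative to the frame formed by the columns of [h]. *)
Definition frame_change (h : 'M[K]_2) (E : stalks X 'cV[K]_2) : stalks X 'cV[K]_2 :=
  fun P => [set v | E P (h *m v)].

Lemma frame_change_iso h E : h \in unitmx -> bundle_iso E (frame_change h E).
Proof.
move=> uh; exists (invmx h); first by rewrite unitmx_inv.
by move=> P v; rewrite /frame_change /= mulKVmx.
Qed.

Lemma is_bundle_frame_change h E :
  h \in unitmx -> is_bundle E -> is_bundle (frame_change h E).
Proof.
move=> uh [loc_triv fin]; split=> [P|].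
  have [g ug hg] := loc_triv P; exists (invmx h *m g).
    by rewrite unitmx_mul unitmx_inv uh.
  have -> : invmx (invmx h *m g) = invmx g *m h.
    have uhg : invmx h *m g \in unitmx by rewrite unitmx_mul unitmx_inv uh.
    apply: (can_inj (mulKmx uhg)); rewrite mulmxV // mulmxA -(mulmxA (invmx h)).
    by rewrite mulmxV // mulmx1 mulVmx.
  by move=> v; rewrite /frame_change /= hg mulmxA.
pose supp (k : 'M[K]_2) i j := [set P | ord P (k i j) <> 0 /\ k i j != 0].
pose bad k := supp k 0 0 `|` supp k 0 1 `|` supp k 1 0 `|` supp k 1 1.
have fs k i j : finite_set (supp k i j).
  have [e|n] := eqVneq (k i j) 0.
    by apply: (sub_finite_set _ (finite_set0 (pnt X))) => P [_]; rewrite e eqxx.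
  by apply: sub_finite_set (ord_finsupp ordX n) => P [].
have fb k : finite_set (bad k) by rewrite !finite_setU.
have ok k P v : ~ bad k P -> trivial_bundle P v -> trivial_bundle P (k *m v).
  move=> nb /(trivialE ordX)[v0 v1]; apply/(trivialE ordX); rewrite !mulmx_col2.
  have e i j : ~ supp k i j P -> vge ord P 0 (k i j).
    move=> ns; have [->|n] := eqVneq (k i j) 0; first exact: vge0.
    by rewrite vgeE // (_ : ord P _ = 0) //; apply: contrapT => h0; apply: ns.
  move: nb => /not_orP[/not_orP[/not_orP[n00 n01] n10] n11].
  by split; apply: (vgeD ordX); apply: (vgeMl ordX (m := 0) (n := 0)) => //; apply: e.
apply: (@sub_finite_set _ _ ([set P | E P <> trivial_bundle P] `|` bad h `|` bad (invmx h))).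
  move=> P /=; apply: contra_notP => /not_orP[/not_orP[/contrapT EP bh] bh'].
  apply/seteqP; split=> v; rewrite /frame_change /= EP => hv; last exact: ok.
  by rewrite -[v](mulKmx uh); apply: ok.
by rewrite !finite_setU.
Qed.

End ChangeOfFrame.

(** * The lattice of the pull-back, its line subbundles and its Tu invariant *)

Section TuLattice.
Variables (C : numClosedFieldType) (t : C) (K : fieldType) (cub : {poly C}).
Variables (ix : {rmorphism {poly C} -> K}) (y : K) (dK : K -> K).
Hypotheses (t0 : t != 0) (t1 : t != 1).
Hypothesis cubE : cub = cubic t.
Hypothesis y2 : y ^+ 2 = ix cub.
Hypothesis ix_free : forall A B, ix A + ix B * y = 0 -> A = 0 /\ B = 0.
Hypothesis frac_ix : forall f : K, exists A B D,
  D != 0 /\ f = (ix A + ix B * y) / ix D.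

Local Notation x := (ix 'X).
Local Notation pt := (ell_point t).
Local Notation X := (wcurve t ix y dK).
Local Notation ord := (@pord C t K ix y).
Let ordX : @curve_order C X ord :=
  wcurve_order dK t0 t1 cubE y2 ix_free frac_ix.
Local Notation V := (@vge C X ord).
Local Notation cst := (cK ix).
Let y0 : y != 0 := y_neq0 ix_free.
Implicit Types (P : pt) (f g : K) (A : {poly C}).
Local Notation apt := {ab : C * C | ab.2 ^+ 2 == ab.1 * (ab.1 - 1) * (ab.1 - t)}.
Implicit Type ab : apt.

Lemma V_spec ab f c : pspec ix y (Some ab) f c -> V (Some ab) 0 f.
Proof.
by move=> h; apply/(vge_loc ordX); apply/wloc_spec; exists c.
Qed.

Lemma V_spec0 ab f : pspec ix y (Some ab) f 0 -> V (Some ab) 1 f.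
Proof.
move=> h; have [->|f0] := eqVneq f 0; first exact: vge0.
rewrite vgeE //; exact: (pord_spec_pos t0 t1 cubE y2 ix_free frac_ix).
Qed.

Lemma V_C P c : V P 0 (cst c).
Proof.
case: P => [ab|]; first exact: (V_spec (pspec_ix ix y ab c%:P)).
have [->|c0] := eqVneq c 0; first by rewrite rmorph0 vge0.
rewrite vgeE ?(pord_oo_C cubE y2 ix_free c0) //.
by rewrite /cK (ix_eq0 ix_free) polyC_eq0.
Qed.

Lemma V_ix ab A : V (Some ab) 0 (ix A).
Proof. exact: (V_spec (pspec_ix ix y ab A)). Qed.

Lemma V_y ab : V (Some ab) 0 y.
Proof. exact: (V_spec (pspec_y ix y ab)). Qed.

Lemma V_y_sub ab b : V (Some ab) 0 (y + cst b).
Proof. by apply: (vgeD ordX); [apply: V_y | apply: V_C]. Qed.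

Lemma V1_y_sub ab : V (Some ab) 1 (y - cst (sval ab).2).
Proof.
apply: V_spec0; rewrite -(subrr (sval ab).2) -!rmorphN.
by apply: specD; [apply: pspec_y | have := pspec_ix ix y ab (- (sval ab).2)%:P; rewrite hornerC].
Qed.

Lemma ord_y ab : ord (Some ab) y = ((sval ab).2 == 0)%:Z.
Proof. exact: (pord_y cubE y2 ix_free). Qed.

Lemma ord_oo_y : ord None y = - 3%:Z.
Proof. exact: (pord_oo_y cubE y2 ix_free). Qed.

Lemma V_oo_lin A : (size A <= 2)%N -> V None (- 2%:Z) (ix A).
Proof.
have [->|A0] := eqVneq A 0; first by rewrite rmorph0 vge0.
rewrite vgeE ?(ix_eq0 ix_free) // (pord_oo_ix cubE y2 ix_free A0).
by move: A0; rewrite -size_poly_gt0; move: (size A); clear; lia.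
Qed.

Lemma ord_oo_XsubC l : ord None (ix ('X - l%:P)) = - 2%:Z.
Proof. by rewrite (pord_oo_ix cubE y2 ix_free) ?polyXsubC_eq0 // size_XsubC. Qed.

Lemma ord_XsubC ab l : ord (Some ab) (ix ('X - l%:P)) =
  if (sval ab).1 == l then if (sval ab).2 == 0 then 2%:Z else 1 else 0.
Proof.
case: eqP => [<-|/eqP na]; first exact: (pord_XsubC t0 t1 cubE y2 ix_free).
apply: (pord_spec0 cubE y2 ix_free (pspec_ix ix y ab _)).
by rewrite !hornerE subr_eq0.
Qed.

(* [m a] is the slope of the parabolic line at the branch point [(a, 0)]. *)
Definition twisted_lattice (m : C -> C) : stalks X 'cV[K]_2 := fun P =>
  [set v | match P with
   | Some ab => if (sval ab).2 == 0
       then V P (- 1) (v 0 0) /\ V P 0 (v 1 0 - cst (m (sval ab).1) * v 0 0)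
       else V P 0 (v 0 0) /\ V P 0 (v 1 0)
   | None => V P 2%:Z (v 0 0) /\ V P 1 (v 1 0) end].

(* The same lattice in the coordinates [u0 = y v0] and [u1 = v1 - M v0]. *)
Definition sheared_lattice (M : {poly C}) : stalks X 'cV[K]_2 := fun P =>
  [set u | match P with
   | Some ab => V P 0 (u 0 0) /\ V P 0 (u 1 0)
   | None => V P (- 1) (u 0 0) /\ V P 1 (u 1 0 + ix M / y * u 0 0) end].

(** At a branch point [M] and its value there differ by a function vanishing at that point, which
    absorbs the simple pole allowed on [v0]; so a single polynomial replaces the separate slopes. At
    infinity [y] has order -3, which turns the bound 2 on [v0] into the bound -1 on [u0]. *)
Lemma shear_iso M : bundle_iso (twisted_lattice (horner M)) (sheared_lattice M).
Proof.
exists (mx2 y 0 (- ix M) 1); first by rewrite unitmx_mx2 // mulr1 mul0r subr0.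
move=> P v; rewrite (cv2_eta v) mx2_cv2; move: (v 0 0) (v 1 0) => a b {v}.
rewrite mul0r addr0 mul1r /twisted_lattice /sheared_lattice /=.
case: P => [ab|]; rewrite !cv20 !cv21; last first.
  rewrite (vge_mull ordX _ _ _ y0) ord_oo_y.
  have -> : - ix M * a + b + ix M / y * (y * a) = b by field.
  by [].
rewrite (vge_mull ordX _ _ _ y0) ord_y; case: eqP => [_|_] /=.
  have [Q eQ] : exists Q, M - (M.[(sval ab).1])%:P = Q * ('X - (sval ab).1%:P).
    by apply/factor_theorem; rewrite rootE !hornerE subrr.
  have vQ : V (Some ab) 1 (ix (M - (M.[(sval ab).1])%:P)).
    apply: V_spec0; have := pspec_ix ix y ab (M - (M.[(sval ab).1])%:P).
    by rewrite hornerD hornerN hornerC subrr.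
  have e : b - cst M.[(sval ab).1] * a = - ix M * a + b + ix (M - (M.[(sval ab).1])%:P) * a.
    by rewrite rmorphB -/(cst _) /=; ring.
  rewrite e; split=> -[ha hb]; split=> //.
    rewrite -[_ + b](addrK (ix (M - (M.[(sval ab).1])%:P) * a)).
    by apply: (vgeB ordX) => //; apply: (vgeMl ordX _ vQ ha).
  by apply: (vgeD ordX) => //; apply: (vgeMl ordX _ vQ ha).
rewrite subr0; split=> -[ha hb]; split=> //.
  by apply: (vgeD ordX) => //; apply: (vgeMl ordX _ _ ha); [|rewrite (vgeN ordX); apply: V_ix].
rewrite -[b](addKr (- ix M * a)) -mulNr opprK.
by apply: (vgeD ordX) => //; apply: (vgeMl ordX _ (V_ix _ _) ha).
Qed.

Lemma sheared_bundle M : is_bundle (sheared_lattice M).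
Proof.
have triv ab : sheared_lattice M (Some ab) = @trivial_bundle C X (Some ab).
  by apply/seteqP; split=> v /=; rewrite (trivialE ordX).
split; last first.
  apply: (@sub_finite_set _ _ [set None : pt]); last exact: finite_set1.
  by move=> [ab|] // /(_ (triv ab)).
case=> [ab|].
  exists 1%:M; first exact: unitmx1.
  by move=> v; rewrite triv invmx1 mul1mx.
pose z := x / y.
have z0 : z != 0 by rewrite mulf_neq0 ?invr_eq0 // (ix_eq0 ix_free) polyX_eq0.
have oz : ord None z = 1 by apply: (pord_unif cubE y2 ix_free None).
clearbody z.
have [|u _ iu] := @inv_mx2 _ (mx2 z^-1 0 (- (ix M / y / z)) z) (mx2 z 0 (ix M / y / z) z^-1).
  move=> a b; rewrite !mx2_cv2; by congr cv2; field; rewrite z0 y0.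
exists (mx2 z^-1 0 (- (ix M / y / z)) z) => // v.
rewrite iu (trivialE ordX) [in X in _ <-> X](cv2_eta v) mx2_cv2 cv20 cv21.
rewrite mul0r addr0 /sheared_lattice /=.
have -> : ix M / y / z * v 0 0 + z^-1 * v 1 0 = (v 1 0 + ix M / y * v 0 0) * z^-1.
  by field; rewrite z0 y0.
have zV0 : z^-1 != 0 by rewrite invr_eq0.
by rewrite (vge_mull ordX _ _ _ z0) (vge_mulr ordX _ _ _ zV0) (ordV ordX) // oz.
Qed.

Section Interpolation.
Variables (p q lam : C).
(** The slope polynomial with its parameter [r] rewritten as [p * (lam - q)], that is with
    [lam = q + r / p] when [p] is nonzero. *)
Definition interp : {poly C} :=
  p%:P * 'X^2 + (p * (q - t - 1) + p * (lam - q))%:P * 'X + (p * (q - 1) * (q - t))%:P.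
Local Notation M := interp.
(* Locked, since the ring tactic would otherwise push ix inside. *)
Definition abscissa : K := locked (ix ('X - lam%:P)).
Local Notation X' := abscissa.
Lemma abscissaE : X' = ix ('X - lam%:P). Proof. by rewrite /abscissa -lock. Qed.

(** The coefficient of [x^2] in [M (x - lam) - p cub] is [p (q - t - 1) + p (lam - q) - p lam + p (1
    + t) = 0]. *)
Lemma interp_lin : exists2 L : {poly C}, (size L <= 2)%N & M * ('X - lam%:P) = p%:P * cub + L.
Proof.
pose al : {poly C} := (p * (q - 1) * (q - t) - (p * (q - t - 1) + p * (lam - q)) * lam - p * t)%:P.
pose be : {poly C} := (- (p * (q - 1) * (q - t) * lam))%:P.
exists (al * 'X + be).
  rewrite (leq_trans (size_polyD _ _)) // geq_max !size_polyC mul_polyC.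
  rewrite (leq_trans (size_scale_leq _ _)) ?size_polyX //=.
  by case: (_ != 0).
rewrite /al /be /M cubE /cubic !(polyCM, polyCD, polyCN, polyC1); ring.
Qed.

(** By [interp_lin], [(M / y) (x - lam) = p y + L / y], and [L / y] has order at least [3 - 2 = 1].
    It is used with [c] equal to [mu], [- mu] and 0. *)
Lemma V_oo_kappa c : V None 0 (ix M / y * X' - cst p * (y + cst c)).
Proof.
have [L sL e] := interp_lin.
have -> : ix M / y * X' - cst p * (y + cst c) = ix L * y^-1 - cst p * cst c.
  have {}e : ix M * X' = cst p * y ^+ 2 + ix L.
    by rewrite abscissaE -rmorphM e rmorphD rmorphM y2.
  by rewrite mulrAC e; field.
apply: (vgeB ordX); last exact: (vgeMl ordX _ (V_C _ p) (V_C _ c)).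
apply: (vgeW (n := 1)) => //.
by rewrite (vge_mulr ordX) ?invr_eq0 // (ordV ordX) // ord_oo_y; apply: V_oo_lin.
Qed.

Hypothesis p0 : p != 0.
Variables (mu : C) (w : apt).
Hypothesis wE : sval w = (lam, mu).
Let D P : int := (P == Some w)%:R - (P == None)%:R.
Let X0 : X' != 0. Proof. by rewrite abscissaE (ix_eq0 ix_free) polyXsubC_eq0. Qed.
Let cp0 : cst p != 0. Proof. by rewrite /cK (ix_eq0 ix_free) polyC_eq0. Qed.

Lemma D_aff ab : D (Some ab) = (sval ab == (lam, mu))%:R.
Proof. by rewrite /D subr0 -wE. Qed.
Lemma ord_oo_abs : ord None X' = - 2%:Z. Proof. by rewrite abscissaE; apply: ord_oo_XsubC. Qed.
Lemma D_oo : D None = -1. Proof. by []. Qed.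

Lemma V_Cmul P n c f : V P n f -> V P n (cst c * f).
Proof. by move=> h; apply: (vgeMl ordX _ (V_C P c) h); rewrite add0r. Qed.

Lemma fibre_lam ab : (sval ab).1 = lam -> (sval ab).2 = mu \/ (sval ab).2 = - mu.
Proof.
move=> e; have : ((sval ab).2 == mu) || ((sval ab).2 == - mu).
  rewrite -eqf_sqr (pt_cub cubE ab) e; have := pt_cub cubE w.
  by rewrite wE /= => ->.
by case/orP => /eqP ->; [left | right].
Qed.

(* The frame consists of [(x - lam, - p (y - mu))] and of
   [(x - lam, - p (y + mu)) / (x - lam)]. *)
Lemma generic_splitting : mu != 0 ->
  bundle_iso (sheared_lattice M) (@dsum C X (@OD C X D) (@dual_line C X (@OD C X D))).
Proof.
move=> mu0; have cm0 : cst mu != 0 by rewrite /cK (ix_eq0 ix_free) polyC_eq0.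
have c20 : (2 : K) != 0.
  have : cst 2 != 0 by rewrite /cK (ix_eq0 ix_free) polyC_eq0 pnatr_eq0.
  by rewrite rmorph_nat.
pose k := cst (2 * p * mu)^-1.
have kE : k = (2 * cst p * cst mu)^-1 by rewrite /k fmorphV /= !rmorphM rmorph_nat.
have k0 : k != 0 by rewrite kE invr_eq0 !mulf_neq0.
have Vk P n f : V P n f -> V P n (k * f) by apply: V_Cmul.
clearbody k.
(* The frame has determinant [- 2 p mu], and [g] is its inverse. The second vector is divided by
   [x - lam], whose divisor is [w + w' - 2 w_oo] with [w' = (lam, - mu)]; this turns [O(w' - w_oo)]
   into the dual of [O(w - w_oo)]. *)
pose g := mx2 (k * (cst p * (y + cst mu) / X')) k (- (k * (cst p * (y - cst mu)))) (- (k * X')).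
have dg : g \in unitmx.
  rewrite unitmx_mx2 // (_ : _ - _ = - k) ?oppr_eq0 //.
  by rewrite kE; field; rewrite ?X0 ?cp0 ?cm0 ?c20.
exists g => // P u; rewrite {2}(cv2_eta u) mx2_cv2 /dsum /= cv20 cv21.
rewrite (ODE ordX) (dual_lineE ordX) /sheared_lattice /=.
move: (u 0 0) (u 1 0) => u0 u1 {u}.
set a := k * _ * u0 + k * u1; set b := - (k * _) * u0 + - (k * _) * u1.
have eu0 : u0 = a * X' + b by rewrite /a /b kE; field; rewrite ?X0 ?cp0 ?cm0 ?c20.
have eu1 : u1 = - (cst p * (y - cst mu) * a) - cst p * (y + cst mu) * (b / X').
  by rewrite /a /b kE; field; rewrite ?X0 ?cp0 ?cm0 ?c20.
case: P => [ab|]; last first.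
  rewrite D_oo; have hm := V_oo_kappa (- mu); have hp := V_oo_kappa mu.
  rewrite rmorphN in hm; split=> -[h0 h1].
    have eb : b = - k * (X' * (u1 + ix M / y * u0) - u0 * (ix M / y * X' - cst p * (y - cst mu))).
      by rewrite /b; ring.
    have ea : a = k * ((u1 + ix M / y * u0) - u0 * (ix M / y * X' - cst p * (y + cst mu)) / X').
      by rewrite /a; field; rewrite ?X0 ?y0.
    split.
      rewrite ea; apply: Vk; apply: (vgeB ordX) => //.
      rewrite (vge_mulr ordX) ?invr_eq0 // (ordV ordX) // ord_oo_abs.
      exact: (vgeMl ordX _ h0 hp).
    rewrite eb mulNr (vgeN ordX); apply: Vk; apply: (vgeB ordX); last exact: (vgeMl ordX _ h0 hm).
    by rewrite (vge_mull ordX) // ord_oo_abs; apply: (vgeW _ h1).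
  split.
    rewrite eu0; apply: (vgeD ordX) => //.
    by rewrite (vge_mulr ordX) // ord_oo_abs.
  have -> : u1 + ix M / y * u0 = a * (ix M / y * X' - cst p * (y - cst mu)) +
     b / X' * (ix M / y * X' - cst p * (y + cst mu)).
    by rewrite eu0 eu1; field; rewrite ?X0 ?y0.
  apply: (vgeD ordX); first exact: (vgeMl ordX _ h0 hm).
  apply: (vgeMl ordX (m := 1) (n := 0)) => //.
  by rewrite (vge_mulr ordX) ?invr_eq0 // (ordV ordX) // ord_oo_abs.
have Vp : V (Some ab) 0 (y + cst mu) by apply: V_y_sub.
have Vm : V (Some ab) 0 (y - cst mu) by rewrite -rmorphN; apply: V_y_sub.
have aE : a = k * ((cst p * ((y + cst mu) * u0) + X' * u1) / X').
  by rewrite /a; field; rewrite ?X0.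
have bE : b = - k * (cst p * ((y - cst mu) * u0) + X' * u1) by rewrite /b; ring.
(* At an affine point only the order [e] of [x - lam] and lower bounds [em], [ep] for the orders of
   [y - mu] and [y + mu] matter. They are 0, 0, 0 off the fibre over [lam], then 1, 1, 0 at [w] and
   1, 0, 1 at the conjugate point. *)
suff [e [em [ep [eX hm hp [d0 de dm dp]]]]] : exists e em ep : int,
    [/\ ord (Some ab) X' = e, V (Some ab) em (y - cst mu), V (Some ab) ep (y + cst mu)
       & [/\ 0 <= D (Some ab), D (Some ab) <= e, D (Some ab) <= em & e <= ep + D (Some ab)]].
  move: d0 de dm dp; set d := D _ => d0 de dm dp.
  have VX : V (Some ab) e X' by rewrite vgeE // eX.
  have VXV n f : V (Some ab) n (f / X') = V (Some ab) (n + e) f.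
    by rewrite (vge_mulr ordX) ?invr_eq0 // (ordV ordX) // eX opprK.
  split=> -[h0 h1].
    split.
      rewrite aE; apply: Vk; rewrite VXV; apply: (vgeD ordX).
        by apply: V_Cmul; apply: (vgeMl ordX _ hp h0); move: dp; clear; lia.
      by apply: (vgeMl ordX _ VX h1); move: d0; clear; lia.
    rewrite bE mulNr (vgeN ordX); apply: Vk; apply: (vgeD ordX).
      by apply: V_Cmul; apply: (vgeMl ordX _ hm h0); move: dm; clear; lia.
    by apply: (vgeMl ordX _ VX h1); move: de; clear; lia.
  split.
    rewrite eu0; apply: (vgeD ordX); last exact: (vgeW d0).
    by apply: (vgeMl ordX _ h0 VX); move: de; clear; lia.
  rewrite eu1; apply: (vgeB ordX).
    rewrite (vgeN ordX) -mulrA; apply: V_Cmul.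
    by apply: (vgeMl ordX _ hm h0); move: dm; clear; lia.
  rewrite -mulrA; apply: V_Cmul; apply: (vgeMl ordX (m := ep) (n := d - e) _ hp).
    by move: dp; clear; lia.
  by rewrite VXV subrK.
rewrite D_aff abscissaE ord_XsubC; have [ea|na] := eqVneq (sval ab).1 lam; last first.
  exists 0, 0, 0; split=> //; rewrite -pair_eqE /pair_eq /= (negPf na) //.
have b0 : (sval ab).2 != 0 by case: (fibre_lam ea) => ->; rewrite ?oppr_eq0.
rewrite (negPf b0) -pair_eqE /pair_eq /= ea eqxx /=.
have [eb|nb] := eqVneq (sval ab).2 mu.
  by exists 1, 1, 0; split=> //; rewrite -eb; apply: V1_y_sub.
exists 1, 0, 1; split=> //.
have /eqP eb : (sval ab).2 == - mu by case: (fibre_lam ea) nb => [->|->]; rewrite eqxx.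
by rewrite -[mu]opprK -eb rmorphN; apply: V1_y_sub.
Qed.

(** A point with [mu = 0] is alone in its fibre, so [div (x - lam) = 2 D]; in particular [x - lam]
    identifies [O(D)] with its dual. *)
Lemma ramified_ord : mu = 0 ->
  (forall P, ord P X' = D P + D P) /\
  forall ab, D (Some ab) = 0 \/ D (Some ab) = 1 /\ ord (Some ab) y = 1.
Proof.
move=> mu0; have key ab : (sval ab).1 = lam -> (sval ab).2 = 0.
  by move=> /fibre_lam; rewrite mu0 oppr0 => -[].
have D_lam ab : D (Some ab) = ((sval ab).1 == lam)%:Z.
  rewrite D_aff -pair_eqE /pair_eq /=; case: eqP => //= /key ->.
  by rewrite mu0 eqxx.
split=> [[ab|]|ab]; last first.
- rewrite D_lam ord_y; case: eqP => [/key ->|_]; last by left.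
  by right; rewrite eqxx.
- by rewrite ord_oo_abs.
- by rewrite abscissaE ord_XsubC D_lam; case: eqP => [/key ->|_] //; rewrite eqxx.
Qed.

Lemma ramified_self_extension : mu = 0 -> exists F : stalks X 'cV[K]_2,
  [/\ bundle_iso (sheared_lattice M) F, @extension C X (@OD C X D) (@OD C X D) F &
   exists2 k : K, k != 0 & forall P f, @OD C X D P f <-> @dual_line C X (@OD C X D) P (k * f)].
Proof.
move=> mu0; have [oX oy] := ramified_ord mu0.
(* The first column spans the subbundle [O(D)]. As [h] has determinant [x - lam] with divisor [2 D]
   and the lattice has trivial determinant, the quotient must be [O(2 D - D)]. *)
pose h := mx2 X' 0 (- (cst p * y)) 1.
have uh : h \in unitmx by rewrite unitmx_mx2 // mulr1 mul0r subr0.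
exists (@frame_change C X h (sheared_lattice M)); split.
- exact: (@frame_change_iso C X).
- split; first exact: (is_bundle_frame_change ordX uh (sheared_bundle M)).
  have VX P n f : V P n (X' * f) = V P (n - (D P + D P)) f.
    by rewrite (vge_mull ordX) // oX.
  have py0 : cst p * y != 0 by rewrite mulf_neq0.
  have kap : V None 0 (ix M / y * X' - cst p * y).
    by have := V_oo_kappa 0; rewrite rmorph0 addr0.
  pose S P a b := sheared_lattice M P (cv2 (X' * a) (- (cst p * y) * a + b)).
  have SE P a b : @frame_change C X h (sheared_lattice M) P (cv2 a b) <-> S P a b.
    by rewrite /frame_change /= mx2_cv2 mul0r addr0 mul1r.
  have Soo a b : S None a b <-> V None 1 a /\ V None 1 b.
    rewrite /S /sheared_lattice /= cv20 cv21 VX D_oo.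
    have -> : - (cst p * y) * a + b + ix M / y * (X' * a) =
              (ix M / y * X' - cst p * y) * a + b by ring.
    split=> -[ha hb]; split=> //; last by apply: (vgeD ordX) => //; apply: (vgeMl ordX _ kap ha).
    rewrite -[b](addKr ((ix M / y * X' - cst p * y) * a)) addrC.
    by apply: (vgeB ordX) => //; apply: (vgeMl ordX _ kap ha).
  have Vy ab : V (Some ab) (D (Some ab)) (cst p * y).
    apply: V_Cmul; case: (oy ab) => [->|[-> e]]; first exact: V_y.
    by rewrite vgeE // e.
  have dD ab : 0 <= D (Some ab) by case: (oy ab) => [->|[-> _]].
  have Saff ab a b : S (Some ab) a b <->
      V (Some ab) (- (D (Some ab) + D (Some ab))) a /\ V (Some ab) 0 (- (cst p * y) * a + b).
    by rewrite /S /sheared_lattice /= cv20 cv21 VX sub0r.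
  have quo P a b : S P a b -> V P (- D P) b.
    case: P => [ab|]; last by move=> /Soo[_].
    move=> /Saff[ha hb]; rewrite -[b](addKr (- (cst p * y) * a)) -mulNr opprK.
    have := dD ab; set d := D _ in ha *; move=> d0.
    apply: (vgeD ordX); last by apply: (vgeW _ hb); move: d0; clear; lia.
    by apply: (vgeMl ordX _ (Vy ab) ha); rewrite -/d; move: (d); clear; lia.
  have lift P b : V P (- D P) b -> exists a, S P a b.
    case: P => [ab|] hb; last by exists 0; apply/Soo; split=> //; exact: vge0.
    case: (oy ab) => [d0|[d1 e]].
      exists 0; apply/Saff; split; first exact: vge0.
      by rewrite mulr0 add0r; move: hb; rewrite d0.
    (* At [w] the function [y] is a local coordinate. This choice makes [- p y a + b] zero and gives
       [a] at most the double pole that is allowed. *)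
    exists ((cst p * y)^-1 * b); apply/Saff; split; last first.
      by rewrite mulNr mulVKf // addNr vge0.
    rewrite (vge_mull ordX) ?invr_eq0 // (ordV ordX) //.
    have -> : ord (Some ab) (cst p * y) = 1.
      have cpo : ord (Some ab) (cst p) = 0.
        by apply: (pord_spec0 cubE y2 ix_free (pspec_ix ix y ab p%:P)); rewrite hornerC.
      by rewrite (ordM ordX) // cpo e.
    by move: hb; rewrite d1.
  have sub P a : V P (- D P) a <-> S P a 0.
    case: P => [ab|]; last first.
      by rewrite Soo; split=> [ha|[ha _]//]; split=> //; exact: vge0.
    rewrite Saff addr0 mulNr (vgeN ordX); have := dD ab; have := Vy ab.
    case: (oy ab) => [->|[-> e]] hy d0.
      by rewrite oppr0; split=> [ha|[]//]; split=> //; apply: (vgeMl ordX _ hy ha).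
    split=> [ha|[_]]; first by split; [apply: (vgeW _ ha) | apply: (vgeMl ordX _ hy ha)].
    rewrite -mulrA => hya; have {}hya : V (Some ab) 0 (y * a).
      rewrite -[y * a](mulKf cp0) -fmorphV.
      exact: (V_Cmul p^-1 hya).
    by move: hya; rewrite (vge_mull ordX) // e.
  move=> P; split=> f.
    by rewrite (ODE ordX) sub -SE.
  rewrite (ODE ordX); split=> [/lift[a ha]|[v hv <-]].
    by exists (cv2 a f); [apply/SE | rewrite cv21].
  by apply: (quo P (v 0 0)); apply/SE; rewrite -cv2_eta.
exists X' => // P f; rewrite (ODE ordX) (dual_lineE ordX) (vge_mull ordX) // oX.
by rewrite (_ : D P - (D P + D P) = - D P) //; move: (D P); clear; lia.
Qed.

End Interpolation.

(** With [M = r x], the coefficient [kap = r x / y] is a local coordinate at infinity. So [(f, 0)]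
    lies in the lattice there exactly when [f] is regular, and [(- f / kap, f)] lifts a regular [f].
    This is the case [lambda = oo], where [O(w - w_oo)] is trivial. *)
Lemma degenerate_self_extension (r : C) : r != 0 ->
  @extension C X (@OD C X (fun=> 0)) (@OD C X (fun=> 0)) (sheared_lattice (r%:P * 'X)).
Proof.
move=> r0; split; first exact: sheared_bundle.
have x0 : x != 0 by rewrite (ix_eq0 ix_free) polyX_eq0.
have cr0 : cst r != 0 by rewrite /cK (ix_eq0 ix_free) polyC_eq0.
have e : ix (r%:P * 'X) / y = cst r * (x / y) by rewrite rmorphM mulrA.
pose kap := cst r * (x / y).
have k0 : kap != 0 by rewrite !mulf_neq0 ?invr_eq0.
have ok : ord None kap = 1.
  rewrite /kap (ordM ordX) ?mulf_neq0 ?invr_eq0 // (pord_oo_C cubE y2 ix_free) // add0r.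
  exact: (pord_unif cubE y2 ix_free None).
have Soo a b : sheared_lattice (r%:P * 'X) None (cv2 a b) <->
    V None (- 1) a /\ V None 1 (b + kap * a).
  by rewrite /sheared_lattice /= cv20 cv21 e.
have Saff ab a b : sheared_lattice (r%:P * 'X) (Some ab) (cv2 a b) <->
    V (Some ab) 0 a /\ V (Some ab) 0 b.
  by rewrite /sheared_lattice /= cv20 cv21.
move=> P; split=> f; rewrite (ODE ordX) oppr0.
  rewrite -/(cv2 f 0); case: P => [ab|].
    by rewrite Saff; split=> [h|[]//]; split=> //; exact: vge0.
  rewrite Soo add0r (vge_mull ordX) // ok subrr.
  by split=> [h|[]//]; split=> //; apply: (vgeW _ h).
split=> [h|[v]]; last first.
  rewrite (cv2_eta v); case: P => [ab|] + <-; rewrite cv21; first by move=> /Saff[].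
  move=> /Soo[ha hb]; rewrite -[v 1 0](addrK (kap * v 0 0)).
  apply: (vgeB ordX); first exact: (vgeW _ hb).
  by rewrite (vge_mull ordX) // ok.
case: P h => [ab|] h.
  by exists (cv2 0 f); [apply/Saff; split=> //; exact: vge0 | rewrite cv21].
exists (cv2 (- (kap^-1 * f)) f); last by rewrite cv21.
apply/Soo; rewrite (vgeN ordX) (vge_mull ordX) ?invr_eq0 // (ordV ordX) // ok; split=> //.
by rewrite mulrN mulVKf // subrr vge0.
Qed.

(** The function [k] identifies [O(D)] with its dual, so a split self-extension is [O(D)] plus its
    dual. Both outcomes have the same Tu invariant, so it is not decided which one occurs. *)
Lemma self_extension_dichotomy (D : pt -> int) (E F : stalks X 'cV[K]_2) :
  bundle_iso E F -> @extension C X (@OD C X D) (@OD C X D) F ->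
  (exists2 k : K, k != 0 & forall P f, @OD C X D P f <-> @dual_line C X (@OD C X D) P (k * f)) ->
  bundle_iso E (@dsum C X (@OD C X D) (@dual_line C X (@OD C X D))) \/
  @nontrivial_self_extension C X (@OD C X D) E.
Proof.
move=> EF ext [k k0 hk]; have [sp|nsp] := pselect (@split_extension C X (@OD C X D) F); last first.
  by right; exists F.
left; apply: (bundle_iso_trans EF).
apply: (bundle_iso_trans (split_self_extension ordX ext sp)).
exists (mx2 1 0 0 k); first by rewrite unitmx_mx2 // mul1r mul0r subr0.
move=> P v; rewrite {2}(cv2_eta v) mx2_cv2 /dsum /= cv20 cv21 !mul0r mul1r addr0 add0r.
by split=> -[h1 h2]; split=> //; apply/hk.
Qed.

Lemma pic0_balanced (w : pt) (D := fun P : pt => (P == w)%:R - (P == None)%:R : int) :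
  finsupp D /\ \sum_(P \in [set: pt]) D P = 0.
Proof.
have fw : finsupp (fun P : pt => (P == w)%:R) by apply: finsupp_pt.
have fn : finsupp (fun P : pt => - (P == None)%:R) by apply/finsuppN/finsupp_pt.
split; first exact: (finsuppD fw fn).
by rewrite (fsumD fw fn) (fsumN (finsupp_pt None)) (fsum_pt w) (fsum_pt None) subrr.
Qed.

(** The middle clause keeps track of the fact that a non-split self-extension arises only at the
    branch points, as [Tu_invariant] demands. *)
Lemma twisted_Tu (p q r : C) (M := p%:P * 'X^2 + (p * (q - t - 1) + r)%:P * 'X
    + (p * (q - 1) * (q - t))%:P) (E : stalks X 'cV[K]_2) :
  (p != 0) || (r != 0) ->
  (forall P v, E P v <-> twisted_lattice (horner M) P v) ->
  @semistable C X E /\ exists w : pt,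
    [/\ ell_pi w = (if p == 0 then None else Some (q + r / p)),
        (forall ab, w = Some ab -> (sval ab).2 = 0) \/
          bundle_iso E (@dsum C X (@OD C X (fun P => (P == w)%:R - (P == None)%:R))
            (@dual_line C X (@OD C X (fun P => (P == w)%:R - (P == None)%:R)))) &
        bundle_iso E (@dsum C X (@OD C X (fun P => (P == w)%:R - (P == None)%:R))
            (@dual_line C X (@OD C X (fun P => (P == w)%:R - (P == None)%:R)))) \/
        @nontrivial_self_extension C X (@OD C X (fun P => (P == w)%:R - (P == None)%:R)) E].
Proof.
move=> pr hE.
have ES : bundle_iso E (sheared_lattice M).
  by have [g ug hg] := shear_iso M; exists g => // P v; rewrite hE.
have [p0|p0] := eqVneq p 0.
  move: pr; rewrite p0 eqxx /= => r0.
  have eM : M = r%:P * 'X.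
    by rewrite /M p0 !(mul0r, polyC0, add0r, addr0).
  have ext := degenerate_self_extension r0; rewrite eM in ES.
  have f0 : finsupp (fun _ : pt => 0).
    by apply: (finsupp_sub (finite_set0 pt)).
  have s0 : \sum_(P \in [set: pt]) (0 : int) = 0 by apply: fsbig1.
  split; first exact: (semistable_extension ordX f0 f0 s0 s0 ext ES).
  exists None; split=> //; first by left.
  have e : (fun P : pt => (P == None)%:R - (P == None)%:R : int) = (fun=> 0).
    by apply/funext => P; rewrite subrr.
  rewrite e; apply: (self_extension_dichotomy ES ext).
  by exists 1; rewrite ?oner_neq0 // => P f; rewrite (ODE ordX) (dual_lineE ordX) mul1r oppr0.
pose lam := q + r / p.
have eM : M = interp p q lam.
  rewrite /M /interp (_ : r = p * (lam - q)) //.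
  by rewrite /lam; field.
have [mu hmu] : exists mu, mu ^+ 2 = lam * (lam - 1) * (lam - t).
  by exists (sqrtC (lam * (lam - 1) * (lam - t))); apply: sqrtCK.
have hw : (lam, mu).2 ^+ 2 == (lam, mu).1 * ((lam, mu).1 - 1) * ((lam, mu).1 - t).
  by rewrite /= hmu.
pose w : apt := exist _ (lam, mu) hw.
have [fD sD] := pic0_balanced (Some w); rewrite eM in ES.
set D := fun P : pt => _ in fD sD.
have [mu0|mu0] := eqVneq mu 0; last first.
  have iso := bundle_iso_trans ES (generic_splitting q p0 (erefl (sval w)) mu0).
  split; last by exists (Some w); split; [|right|left].
  have fN := finsuppN fD.
  have sN : \sum_(P \in [set: pt]) - D P = 0 by rewrite (fsumN fD) sD oppr0.
  apply: (semistable_extension ordX fD fN sD sN (dsum_extension ordX fD fN)).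
  apply: (bundle_iso_trans iso); exists 1%:M; first exact: unitmx1.
  move=> P v; rewrite mul1mx /dsum /=.
  by split=> -[h1 h2]; split=> //; apply/(dual_OD ordX).
have [F [SF ext hk]] := ramified_self_extension q p0 (erefl (sval w)) mu0.
have EF := bundle_iso_trans ES SF.
split; first exact: (semistable_extension ordX fD fD sD sD ext EF).
exists (Some w); split=> //; last exact: (self_extension_dichotomy EF ext hk).
by left=> ab [<-].
Qed.

End TuLattice.

(** * The elliptic pull-back *)

(** Two Horner steps compared: closeness of the points and of the partial values passes to the next
    value. *)
Lemma horner_step (R : comNzRingType) (a b c d e : R) :
  a * b + c - (d * e + c) = a * (b - e) + (a - d) * e.
Proof. ring. Qed.

(** A linear form is unchanged when a vector of its kernel is subtracted. *)
Lemma line_step (R : comNzRingType) (al be v w a b : R) : al * a + be * b = 0 ->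
  al * v + be * w = al * (v - a) + be * (w - b).
Proof. by move=> h; rewrite !mulrBr addrACA -opprD h subr0. Qed.

Lemma lin_combine (R : comNzRingType) (al be v w v' w' : R) :
  al * (v + v') + be * (w + w') = (al * v + be * w) + (al * v' + be * w').
Proof. ring. Qed.

Lemma lin_scale (R : comNzRingType) (al be v w f : R) :
  al * (f * v) + be * (f * w) = f * (al * v + be * w).
Proof. ring. Qed.

Section EllipticPullback.
Variables (C : numClosedFieldType) (t : C).
Hypotheses (t0 : t != 0) (t1 : t != 1).
Local Notation K := (ell_field t).
Local Notation K0 := {fraction {poly C}}.
Local Notation iF := (@FracField.tofrac {poly C}).

Definition ellx : {rmorphism {poly C} -> K} := inx t.
Local Notation y := (ellY t).
Local Notation X := (Ell t).
Local Notation cst := (ellC t).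
Local Notation inj := (@ell_inj C t).

(* Sealed, since conversion would otherwise compute in the function field. *)
Lemma ell_ord_sig : {o : ell_point t -> K -> int | o = @pord C t K ellx y}.
Proof. by exists (@pord C t K ellx y). Qed.
Definition ell_ord : ell_point t -> K -> int := sval ell_ord_sig.
Lemma ell_ordE : ell_ord = @pord C t K ellx y. Proof. exact: (svalP ell_ord_sig). Qed.
Local Notation ord := ell_ord.

Lemma ellx_free A B : ellx A + ellx B * y = 0 -> A = 0 /\ B = 0.
Proof. exact: inx_free. Qed.
Lemma ellx_frac (f : K) : exists A B D : {poly C},
  D != 0 /\ f = (ellx A + ellx B * y) / ellx D.
Proof. exact: ell_frac. Qed.
Lemma ellx_cubic : y ^+ 2 = ellx (cubic t). Proof. exact: ellY_sqr. Qed.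

Lemma ell_order : @curve_order C X ord.
Proof.
rewrite ell_ordE; exact: (wcurve_order (@ell_der C t) t0 t1 (erefl (cubic t)) ellx_cubic
  ellx_free ellx_frac).
Qed.
Local Notation V := (@vge C X ord).
Local Opaque vge.
Implicit Types (P : ell_point t) (f g : K) (n : int) (u v : {poly C}).

Definition pt_coord P : K0 * C :=
  if P is Some ab then (ratX C, (sval ab).1) else ((ratX C)^-1, 0).

Definition rval P u : K0 := (map_poly (@ratC C) u).[(pt_coord P).1].

Lemma P1_locE P (f : K0) : P1_loc (ell_pi P) f <-> exists u v : {poly C},
  v.[(pt_coord P).2] <> 0 /\ f * rval P v = rval P u.
Proof. by case: P. Qed.

Lemma Vcst P c : V P 0 (cst c).
Proof. rewrite ell_ordE;
  exact: (V_C (@ell_der C t) t0 t1 (erefl (cubic t)) ellx_cubic ellx_free ellx_frac). Qed.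

Lemma ellC_neq0 c : (cst c != 0) = (c != 0).
Proof. by rewrite fmorph_eq0. Qed.

Lemma ordcst P c : c != 0 -> ord P (cst c) = 0.
Proof.
move=> c0; have c0' : cst c != 0 by rewrite ellC_neq0.
have := Vcst P c^-1; have := Vcst P c; rewrite fmorphV !vgeE ?invr_eq0 //.
by rewrite (ordV ell_order P c0') oppr_ge0 => h1 h2; apply/le_anti; rewrite h1 h2.
Qed.

Lemma V1_coord P : V P 1 (inj (pt_coord P).1 - cst (pt_coord P).2).
Proof.
case: P => [ab|]; rewrite /pt_coord [(_, _).1]/= [(_, _).2]/=.
  have -> : inj (ratX C) - cst (sval ab).1 = ellx ('X - (sval ab).1%:P).
    by rewrite rmorphB.
  have := pspec_ix ellx y ab ('X - (sval ab).1%:P).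
  rewrite !hornerE subrr => h.
  rewrite ell_ordE; exact: (V_spec0 (@ell_der C t) t0 t1 (erefl (cubic t)) ellx_cubic ellx_free
    ellx_frac h).
rewrite rmorph0 subr0 fmorphV.
have x0 : inj (ratX C) != 0 by rewrite (inx_eq0 t 'X) polyX_eq0.
rewrite vgeE ?invr_eq0 // (ordV ell_order) //.
by rewrite (_ : ord None _ = - 2%:Z) //; rewrite ell_ordE;
  exact: (pord_oo_x (erefl (cubic t)) ellx_cubic ellx_free).
Qed.

Lemma rval_step P u c : rval P (u * 'X + c%:P) = rval P u * (pt_coord P).1 + ratC c.
Proof. by rewrite /rval rmorphD rmorphM /= map_polyX map_polyC !hornerE. Qed.

Lemma inj_rval_step P u c :
  inj (rval P (u * 'X + c%:P)) = inj (rval P u) * inj (pt_coord P).1 + cst c.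
Proof. by rewrite rval_step (rmorphD inj) (rmorphM inj). Qed.

Lemma cst_horner_step u (a c : C) :
  cst (u * 'X + c%:P).[a] = cst u.[a] * cst a + cst c.
Proof. by rewrite hornerMXaddC (rmorphD cst) (rmorphM cst). Qed.

(** A polynomial in the local coordinate of the projective line at [pi(P)] is congruent, modulo the
    maximal ideal of [P] upstairs, to its value. Hence regular functions and maximal ideals
    downstairs pull back to regular functions and into the maximal ideal. *)
Lemma V1_rval P u : V P 1 (inj (rval P u) - cst u.[(pt_coord P).2]).
Proof.
elim/poly_ind: u => [|u c IH].
  by rewrite /rval rmorph0 !horner0 !rmorph0 subrr vge0.
have V0 : V P 0 (inj (rval P u)).
  have h : V P 0 (inj (rval P u) - cst u.[(pt_coord P).2]) by apply: (vgeW _ IH).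
  by have := vgeD ell_order h (Vcst P u.[(pt_coord P).2]); rewrite subrK.
rewrite inj_rval_step cst_horner_step horner_step; apply: (vgeD ell_order).
  exact: (vgeMl ell_order _ V0 (V1_coord P)).
exact: (vgeMl ell_order _ IH (Vcst _ _)).
Qed.

Lemma V0_rval P u : V P 0 (inj (rval P u)).
Proof.
have h : V P 0 (inj (rval P u) - cst u.[(pt_coord P).2]) by apply: (vgeW _ (V1_rval P u)).
by have := vgeD ell_order h (Vcst P u.[(pt_coord P).2]); rewrite subrK.
Qed.

Lemma V1_cst P c : c != 0 -> V P 1 (cst c) = false.
Proof. by move=> c0; rewrite vgeE ?ellC_neq0 // ordcst. Qed.

Lemma ord_rval P v : v.[(pt_coord P).2] != 0 ->
  inj (rval P v) != 0 /\ ord P (inj (rval P v)) = 0.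
Proof.
set c := v.[_] => c0; have h1 := V1_rval P v.
have n1 : ~ V P 1 (inj (rval P v)).
  move=> h2; have := vgeB ell_order h2 h1.
  by rewrite -/c opprB addrC subrK V1_cst.
have f0 : inj (rval P v) != 0.
  by apply/eqP => e; apply: n1; rewrite e vge0.
split=> //; have := V0_rval P v; move/negP: n1; rewrite !vgeE //.
by move: (ord P _) => n; clear; lia.
Qed.

Lemma quotient_V P (f : K0) u v n : v.[(pt_coord P).2] <> 0 ->
  f * rval P v = rval P u -> V P n (inj (rval P u)) -> V P n (inj f).
Proof.
move=> /eqP /ord_rval[n0 o0] e; rewrite -e (rmorphM inj).
by rewrite (vge_mulr ell_order _ _ _ n0) o0 subr0.
Qed.

Lemma P1_loc_V P (f : K0) : P1_loc (ell_pi P) f -> V P 0 (inj f).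
Proof.
by move=> /P1_locE[u [v [v0 e]]]; apply: (quotient_V v0 e); apply: V0_rval.
Qed.

Lemma P1_maxid_V P (f : K0) : @maxid C (P1 C) (ell_pi P) f -> V P 1 (inj f).
Proof.
move=> [/P1_locE[u [v [v0 e]]] h]; apply: (quotient_V v0 e).
have [u0|u0] := eqVneq u.[(pt_coord P).2] 0.
  by have := V1_rval P u; rewrite u0 (rmorph0 cst) subr0.
have [ru _] := ord_rval u0.
have f0 : f != 0.
  by apply: contra_neq ru => f0; rewrite -e f0 mul0r rmorph0.
case: h => [/eqP|[]]; first by rewrite (negPf f0).
by apply/P1_locE; exists v, u; split; [apply/eqP | rewrite -e mulKf].
Qed.

Lemma P1_loc_C (Q : option C) c : P1_loc Q (ratC c).
Proof.
by case: Q => [a|]; exists c%:P, 1; rewrite rmorph1 !hornerE map_polyC hornerE;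
  split=> //; apply/eqP; exact: oner_neq0.
Qed.

Definition ratv (a : 'cV[C]_2) : 'cV[K0]_2 := map_mx (@ratC C) a.

Lemma trivial_ratv (Q : option C) a : @trivial_bundle C (P1 C) Q (ratv a).
Proof. by move=> i; rewrite mxE; apply: P1_loc_C. Qed.

Lemma inj_ratv a i : (map_mx inj (ratv a) : 'cV[K]_2) i 0 = cst (a i 0).
Proof. by rewrite !mxE. Qed.

Definition triv := @trivial_bundle C (P1 C).

Lemma pullback_trivialE P (v : 'cV[K]_2) :
  @pullback C t triv P v <-> V P 0 (v 0 0) /\ V P 0 (v 1 0).
Proof.
split.
  pose T : set 'cV[K]_2 := [set w | V P 0 (w 0 0) /\ V P 0 (w 1 0)].
  suff h : @pullback C t triv P `<=` T by exact: h.
  apply: (span_sub ell_order).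
  - by split; rewrite mxE vge0.
  - by move=> v1 v2 [a1 b1] [a2 b2]; split; rewrite mxE; apply: (vgeD ell_order).
  - move=> f v1 hf [w hw ->]; split; rewrite !mxE.
      exact: (vgeMl ell_order _ hf (P1_loc_V (hw 0))).
    exact: (vgeMl ell_order _ hf (P1_loc_V (hw 1))).
move=> [h0 h1].
have -> : v = v 0 0 *: map_mx inj (ratv (cv2 1 0)) + v 1 0 *: map_mx inj (ratv (cv2 0 1)).
  apply: col2P; rewrite mxE [X in _ = X + _]mxE [X in _ = _ + X]mxE !inj_ratv !mxE /=.
    by rewrite (rmorph1 cst) (rmorph0 cst) mulr1 mulr0 addr0.
  by rewrite (rmorph1 cst) (rmorph0 cst) mulr1 mulr0 add0r.
apply: (span_gen2 ell_order) => //.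
  by exists (ratv (cv2 1 0)) => //; apply: trivial_ratv.
by exists (ratv (cv2 0 1)) => //; apply: trivial_ratv.
Qed.

(** The line [L] lies in the kernel of the form with coefficients [al], [be], and [dec] splits a
    vector into a regular multiple of [e] in [L] and a multiple of [e'] vanishing at [P]. A linear
    form treats finite slopes and the line [(0:1)] alike. *)
Lemma pullback_lineE P (L : set 'cV[C]_2) (al be : C) (e e' : 'cV[C]_2)
    (v : 'cV[K]_2) :
  (forall a, L a -> al * a 0 0 + be * a 1 0 = 0) -> L e ->
  (forall w : 'cV[K]_2, V P 0 (w 0 0) -> V P 0 (w 1 0) ->
     V P 1 (cst al * w 0 0 + cst be * w 1 0) -> exists f g,
     [/\ V P 0 f, V P 1 g & w = f *: map_mx inj (ratv e) + g *: map_mx inj (ratv e')]) ->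
  @pullback_line C t triv P (@trivial_line C (P1 C) (ell_pi P) L) v <->
  [/\ V P 0 (v 0 0), V P 0 (v 1 0) & V P 1 (cst al * v 0 0 + cst be * v 1 0)].
Proof.
move=> hL Le dec; split.
  pose T : set 'cV[K]_2 := [set w | [/\ V P 0 (w 0 0), V P 0 (w 1 0) &
    V P 1 (cst al * w 0 0 + cst be * w 1 0)]].
  suff h : @pullback_line C t triv P (@trivial_line C (P1 C) (ell_pi P) L) `<=` T by exact: h.
  have Tscale f n w : V P n f -> (n = 0 /\ T w \/ n = 1 /\ V P 0 (w 0 0) /\ V P 0 (w 1 0)) -> T
    (f *: w).
    move=> hf; rewrite /T /= [(f *: w) 0 0]mxE [(f *: w) 1 0]mxE lin_scale.
    case=> [[n0 [w0 w1 w2]]|[n1 [w0 w1]]]; rewrite ?n0 ?n1 in hf.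
      by split; [apply: (vgeMl ell_order _ hf w0)|apply: (vgeMl ell_order _ hf w1)|apply:
        (vgeMl ell_order _ hf w2)].
    have w2 : V P 0 (cst al * w 0 0 + cst be * w 1 0).
      by apply: (vgeD ell_order);
        [apply: (vgeMl ell_order _ (Vcst _ _) w0)|apply: (vgeMl ell_order _ (Vcst _ _) w1)].
    by split; [apply: (vgeMl ell_order _ hf w0)|apply: (vgeMl ell_order _ hf w1)|apply: (vgeMl
      ell_order _ hf w2)].
  apply: (span_sub ell_order).
  - split; rewrite !mxE ?vge0 // !mulr0 addr0; exact: vge0.
  - move=> v1 v2 [a1 b1 c1] [a2 b2 c2];
    rewrite /T /= [(v1 + v2) 0 0]mxE [(v1 + v2) 1 0]mxE lin_combine.
    by split; apply: (vgeD ell_order).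
  - move=> f v1 hf [[w [tw [a La hw]] ->]|[g [w [/(maxidE ell_order) hg /pullback_trivialE[w0
    w1] ->]]]].
      apply: (Tscale f 0) => //; left; split=> //.
      have m0 := P1_maxid_V (hw 0); have m1 := P1_maxid_V (hw 1).
      rewrite /T /= [map_mx inj w 0 0]mxE [map_mx inj w 1 0]mxE.
      have z0 : cst al * cst (a 0 0) + cst be * cst (a 1 0) = 0.
        by rewrite -!(rmorphM cst) -(rmorphD cst) hL // (rmorph0 cst).
      split; [exact: (P1_loc_V (tw 0))|exact: (P1_loc_V (tw 1))|].
      rewrite (line_step _ _ z0); apply: (vgeD ell_order).
        apply: (vgeMl ell_order (n := 1) _ (Vcst P al)) => //.
        by move: m0; rewrite (rmorphB inj).
      apply: (vgeMl ell_order (n := 1) _ (Vcst P be)) => //.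
      by move: m1; rewrite (rmorphB inj).
    rewrite scalerA; apply: (Tscale _ 1); first exact: (vgeMl ell_order _ hf hg).
    by right.
move=> [h0 h1 h2]; have [f [g [hf hg ->]]] := dec v h0 h1 h2.
rewrite -[X in _ + X]scale1r.
apply: (span_gen2 ell_order) => //; first exact: (vge1 ell_order).
  left; exists (ratv e) => //; split; first exact: trivial_ratv.
  exists e => // i; rewrite mxE subrr; split; last by left.
  by rewrite -[0](rmorph0 (@ratC C)); apply: P1_loc_C.
right; exists g, (map_mx inj (ratv e')); split=> //.
  exact/(maxidE ell_order).
apply/pullback_trivialE; rewrite !inj_ratv; split; exact: Vcst.
Qed.

Lemma affine_lineE P m (L : set 'cV[C]_2) (v : 'cV[K]_2) :
  (forall a, L a <-> a 1 0 = m * a 0 0) ->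
  @pullback_line C t triv P (@trivial_line C (P1 C) (ell_pi P) L) v <->
  V P 0 (v 0 0) /\ V P 1 (v 1 0 - cst m * v 0 0).
Proof.
move=> hL.
have comb (w : 'cV[K]_2) : cst (- m) * w 0 0 + cst 1 * w 1 0 = w 1 0 - cst m * w 0 0.
  by rewrite (rmorph1 cst) (rmorphN cst) mul1r mulNr addrC.
rewrite (@pullback_lineE P L (- m) 1 (cv2 1 m) (cv2 0 1)).
- rewrite comb; split=> [[h0 _ h2]//|[h0 h2]]; split=> //.
  have h3 : V P 0 (v 1 0 - cst m * v 0 0) by apply: (vgeW _ h2).
  have h4 : V P 0 (cst m * v 0 0) by apply: (vgeMl ell_order _ (Vcst P m) h0).
  by have := vgeD ell_order h3 h4; rewrite subrK.
- by move=> a /hL ->; rewrite mul1r mulNr addNr.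
- by apply/hL; rewrite cv20 cv21 mulr1.
- move=> w h0 h1; rewrite comb => h2; exists (w 0 0), (w 1 0 - cst m * w 0 0); split=> //.
  apply: col2P; rewrite mxE [X in _ = X + _]mxE [X in _ = _ + X]mxE !inj_ratv !mxE /=.
    by rewrite (rmorph1 cst) (rmorph0 cst) mulr1 mulr0 addr0.
  by rewrite (rmorph1 cst) mulr1 mulrC addrC subrK.
Qed.

Lemma infinity_lineE (v : 'cV[K]_2) :
  @pullback_line C t triv None (@trivial_line C (P1 C) None [set a : 'cV[C]_2 | a 0 0 = 0]) v <->
  V None 1 (v 0 0) /\ V None 0 (v 1 0).
Proof.
have comb (w : 'cV[K]_2) : cst 1 * w 0 0 + cst 0 * w 1 0 = w 0 0.
  by rewrite (rmorph1 cst) (rmorph0 cst) mul1r mul0r addr0.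
rewrite (@pullback_lineE None [set a : 'cV[C]_2 | a 0 0 = 0] 1 0 (cv2 0 1) (cv2 1 0)).
- rewrite comb; split=> [[_ h1 h2]|[h0 h1]]; split=> //.
  exact: (vgeW _ h0).
- by move=> a /= ->; rewrite mulr0 mul0r addr0.
- by rewrite /= cv20.
- move=> w h0 h1; rewrite comb => h2; exists (w 1 0), (w 0 0); split=> //.
  apply: col2P; rewrite mxE [X in _ = X + _]mxE [X in _ = _ + X]mxE !inj_ratv !mxE /=.
    by rewrite (rmorph1 cst) (rmorph0 cst) mulr1 mulr0 add0r.
  by rewrite (rmorph1 cst) (rmorph0 cst) mulr1 mulr0 addr0.
Qed.

Lemma uniformizer_ex P (Q : K -> Prop) : (forall z, z != 0 -> ord P z = 1 -> Q z) ->
  exists2 z, @uniformizer C X P z & Q z.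
Proof.
move=> h; have [z z0 oz] := ord_unif ell_order P.
by exists z; [apply/(uniformizerE ell_order) | apply: h].
Qed.

Lemma affine_elmE P m (L : set 'cV[C]_2) (v : 'cV[K]_2) :
  (forall a, L a <-> a 1 0 = m * a 0 0) ->
  (exists2 z, @uniformizer C X P z &
     @pullback_line C t triv P (@trivial_line C (P1 C) (ell_pi P) L) (z *: v)) <->
  V P (- 1) (v 0 0) /\ V P 0 (v 1 0 - cst m * v 0 0).
Proof.
move=> hL; have e z : z != 0 -> ord P z = 1 ->
    @pullback_line C t triv P (@trivial_line C (P1 C) (ell_pi P) L) (z *: v) <->
    V P (- 1) (v 0 0) /\ V P 0 (v 1 0 - cst m * v 0 0).
  move=> z0 oz; rewrite (affine_lineE _ _ hL) [(z *: v) 0 0]mxE [(z *: v) 1 0]mxE.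
  rewrite mulrCA -mulrBr (vge_mull ell_order _ _ _ z0) (vge_mull ell_order _ _ _ z0).
  by rewrite oz subrr sub0r.
split=> [[z /(uniformizerE ell_order)[z0 oz] /(e z z0 oz)]//|h].
by apply: uniformizer_ex => z z0 oz; apply/(e z z0 oz).
Qed.

Lemma infinity_elmE (v : 'cV[K]_2) :
  (exists2 z, @uniformizer C X None z & @pullback_line C t triv None
     (@trivial_line C (P1 C) None [set a : 'cV[C]_2 | a 0 0 = 0]) (z *: v)) <->
  V None 0 (v 0 0) /\ V None (- 1) (v 1 0).
Proof.
have e z : z != 0 -> ord None z = 1 -> @pullback_line C t triv None
     (@trivial_line C (P1 C) None [set a : 'cV[C]_2 | a 0 0 = 0]) (z *: v) <->
    V None 0 (v 0 0) /\ V None (- 1) (v 1 0).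
  move=> z0 oz; rewrite infinity_lineE [(z *: v) 0 0]mxE [(z *: v) 1 0]mxE.
  rewrite (vge_mull ell_order _ _ _ z0) (vge_mull ell_order _ _ _ z0).
  by rewrite oz subrr sub0r.
split=> [[z /(uniformizerE ell_order)[z0 oz] /(e z z0 oz)]//|h].
by apply: uniformizer_ex => z z0 oz; apply/(e z z0 oz).
Qed.

Variables (M : {poly C}) (L0 L1 Lt Loo : set 'cV[C]_2).
Hypotheses (hL0 : forall a, L0 a <-> a 1 0 = M.[0] * a 0 0)
  (hL1 : forall a, L1 a <-> a 1 0 = M.[1] * a 0 0)
  (hLt : forall a, Lt a <-> a 1 0 = M.[t] * a 0 0)
  (hLoo : Loo = [set a : 'cV[C]_2 | a 0 0 = 0]).

Definition elm4 : stalks X 'cV[K]_2 :=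
  @elm C X (woo t) (@pullback_line C t triv (woo t) (@trivial_line C (P1 C) None Loo))
  (@elm C X (wt t) (@pullback_line C t triv (wt t) (@trivial_line C (P1 C) (Some t) Lt))
  (@elm C X (w1 t) (@pullback_line C t triv (w1 t) (@trivial_line C (P1 C) (Some 1) L1))
  (@elm C X (w0 t) (@pullback_line C t triv (w0 t) (@trivial_line C (P1 C) (Some 0) L0))
  (@pullback C t triv)))).

Definition elm4_cond P (v : 'cV[K]_2) : Prop :=
  if P is Some ab then
    if (sval ab).2 == 0
    then V P (- 1) (v 0 0) /\ V P 0 (v 1 0 - cst M.[(sval ab).1] * v 0 0)
    else V P 0 (v 0 0) /\ V P 0 (v 1 0)
  else V P 0 (v 0 0) /\ V P (- 1) (v 1 0).

Lemma elm_at P l E (v : 'cV[K]_2) :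
  @elm C X P l E P v <-> exists2 z, @uniformizer C X P z & l (z *: v).
Proof. by rewrite /elm eqxx. Qed.

Lemma elm_neq P Q l E (v : 'cV[K]_2) : (P == Q) = false ->
  @elm C X Q l E P v <-> E P v.
Proof. by rewrite /elm => ->. Qed.

Lemma ramified_pt (ab : {ab : C * C | ab.2 ^+ 2 == ab.1 * (ab.1 - 1) * (ab.1 - t)}) :
  (sval ab).2 = 0 -> [\/ Some ab = w0 t, Some ab = w1 t | Some ab = wt t].
Proof.
case: ab => -[a b] /= E b0.
have : a * (a - 1) * (a - t) == 0 by rewrite -(eqP E) /= b0 expr0n.
rewrite !mulf_eq0 !subr_eq0.
by case/orP => [/orP[]|] /eqP ea; [apply: Or31|apply: Or32|apply: Or33];
  congr Some; apply: val_inj; rewrite /= b0 ea.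
Qed.

Lemma elm4E P (v : 'cV[K]_2) : elm4 P v <-> elm4_cond P v.
Proof.
have t0' : (0 == t) = false by rewrite eq_sym (negPf t0).
have t1' : (1 == t) = false by rewrite eq_sym (negPf t1).
have o0 : (1 == 0 :> C) = false by apply/negbTE/oner_neq0.
have n01 : (w0 t == w1 t) = false by rewrite /w0 /w1 pt_eq xpair_eqE /= eq_sym o0.
have n0t : (w0 t == wt t) = false by rewrite /w0 /wt pt_eq xpair_eqE /= t0'.
have n1t : (w1 t == wt t) = false by rewrite /w1 /wt pt_eq xpair_eqE /= t1'.
rewrite /elm4; case: P => [ab|]; last first.
  by apply: (iff_trans (elm_at (woo t) _ _ _)); rewrite hLoo; apply: infinity_elmE.
rewrite elm_neq //; have [b0|b0] := eqVneq (sval ab).2 0; last first.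
  have ne Q : (sval Q).2 = 0 -> (Some ab == Some Q :> ell_point t) = false.
    move=> Q0; rewrite pt_eq; apply/negbTE; apply: contra_neq b0 => ->; exact: Q0.
  rewrite !elm_neq ?ne // pullback_trivialE.
  by rewrite /elm4_cond (negPf b0).
have cond Q : Some ab = Some Q -> elm4_cond (Some ab) v =
    (V (Some Q) (- 1) (v 0 0) /\ V (Some Q) 0 (v 1 0 - cst M.[(sval Q).1] * v 0 0)).
  by move=> [<-]; rewrite /elm4_cond b0 eqxx.
have [e|e|e] := ramified_pt b0; rewrite (cond _ e) e.
- apply: (iff_trans (elm_neq _ _ _ n0t)); apply: (iff_trans (elm_neq _ _ _ n01)).
  by apply: (iff_trans (elm_at _ _ _ _)); exact: (@affine_elmE (w0 t) _ _ _ hL0).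
- apply: (iff_trans (elm_neq _ _ _ n1t)).
  by apply: (iff_trans (elm_at _ _ _ _)); exact: (@affine_elmE (w1 t) _ _ _ hL1).
- by apply: (iff_trans (elm_at _ _ _ _)); exact: (@affine_elmE (wt t) _ _ _ hLt).
Qed.

Lemma elm4_cond0 P : elm4_cond P 0.
Proof.
by rewrite /elm4_cond; case: P => [ab|]; [case: ifP|] => *; split;
  rewrite !mxE ?mulr0 ?subr0 vge0.
Qed.

Lemma elm4_condD P (v w : 'cV[K]_2) : elm4_cond P v -> elm4_cond P w -> elm4_cond P (v + w).
Proof.
have e (m a a' b b' : K) : b + b' - m * (a + a') = (b - m * a) + (b' - m * a').
  by rewrite mulrDr opprD addrACA.
rewrite /elm4_cond; case: P => [ab|]; [case: ifP => _|] => -[v0 v1] [w0 w1];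
  rewrite [(v + w) 0 0]mxE [(v + w) 1 0]mxE ?e; split; exact: (vgeD ell_order).
Qed.

Lemma elm4_condZ P f (v : 'cV[K]_2) : V P 0 f -> elm4_cond P v -> elm4_cond P (f *: v).
Proof.
have e (m a b : K) : f * b - m * (f * a) = f * (b - m * a).
  by rewrite mulrCA mulrBr.
move=> hf; rewrite /elm4_cond; case: P hf => [ab|] hf; [case: ifP => _|] => -[v0 v1];
  rewrite [(f *: v) 0 0]mxE [(f *: v) 1 0]mxE ?e.
- by split; [exact: (vgeMl ell_order _ hf v0) | exact: (vgeMl ell_order _ hf v1)].
- by split; [exact: (vgeMl ell_order _ hf v0) | exact: (vgeMl ell_order _ hf v1)].
- by split; [exact: (vgeMl ell_order _ hf v0) | exact: (vgeMl ell_order _ hf v1)].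
Qed.

(** A function [z] of order [D P] generates the dual of [O(D)] at [P], so tensoring multiplies the
    lattice by [z]. *)
Lemma tens_elm4E (D : ell_point t -> int) P z (v : 'cV[K]_2) : z != 0 -> ord P z = D P ->
  tens (@dual_line C X (@OD C X D)) elm4 P v <-> elm4_cond P (z^-1 *: v).
Proof.
move=> z0 oz; split.
  pose T : set 'cV[K]_2 := [set w | elm4_cond P (z^-1 *: w)].
  suff h : tens (@dual_line C X (@OD C X D)) elm4 P `<=` T by exact: h.
  apply: (span_sub ell_order).
  - by rewrite /T /= scaler0; apply: elm4_cond0.
  - by move=> v1 v2 h1 h2; rewrite /T /= scalerDr; apply: elm4_condD.
  - move=> f w hf [g [u [/(dual_lineE ell_order) hg /elm4E hu ->]]].
    rewrite /T /= !scalerA; apply: elm4_condZ => //.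
    rewrite mulrC (vge_mulr ell_order) ?invr_eq0 // (ordV ell_order) // oz sub0r opprK.
    by apply: (vgeMl ell_order _ hf hg); rewrite add0r.
move=> h; apply: (span_gen1 ell_order); exists z, (z^-1 *: v); split.
- by apply/(dual_lineE ell_order); rewrite vgeE // oz.
- exact/elm4E.
- by rewrite scalerA divff // scale1r.
Qed.

(** The twist by [O(-2[w_oo])] raises the bounds at infinity from 0 and -1 to 2 and 1, and changes
    nothing at affine points. *)
Lemma tens_twisted P (v : 'cV[K]_2) :
  tens (@dual_line C X (@OD C X (fun P => 2 * (P == woo t)%:R))) elm4 P v <->
  @twisted_lattice C t K ellx y (@ell_der C t) (horner M) P v.
Proof.
have [z z0 oz] := ex_ord ell_order P (2 * (P == woo t)%:R).
rewrite (tens_elm4E (D := fun P => 2 * (P == woo t)%:R) _ z0 oz).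
case: P oz => [ab|] oz.
  have oz0 : ord (Some ab) z^-1 = 0 by rewrite (ordV ell_order) // oz.
  have zV0 : z^-1 != 0 by rewrite invr_eq0.
  have Vz n f : V (Some ab) n (z^-1 * f) = V (Some ab) n f.
    by rewrite (vge_mull ell_order _ _ _ zV0) oz0 subr0.
  rewrite /elm4_cond /twisted_lattice /= [(z^-1 *: v) 0 0]mxE [(z^-1 *: v) 1 0]mxE.
  rewrite mulrCA -mulrBr !Vz -ell_ordE.
  by case: ((sval ab).2 == 0).
have zV0 : z^-1 != 0 by rewrite invr_eq0.
rewrite /elm4_cond /twisted_lattice /= [(z^-1 *: v) 0 0]mxE [(z^-1 *: v) 1 0]mxE.
rewrite !(vge_mull ell_order _ _ _ zV0) (ordV ell_order) // oz -ell_ordE.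
by [].
Qed.

End EllipticPullback.

(** * Slopes of the parabolic lines, irreducibility, and the conclusion *)

Section Residue.
Variable C : numClosedFieldType.

(** [A + (th / 2) I] is singular, and its first row is nonzero since [b != 0]; that row alone
    defines the kernel. *)
Lemma eigenline_residue (th a b : C) (v : 'cV[C]_2) : b != 0 ->
  eigenline (residue th a b) th v <-> v 1 0 = - ((a + th / 2) / b) * v 0 0.
Proof.
move=> b0; have two : (2 : C) != 0 by rewrite pnatr_eq0.
have four : (4 : C) != 0 by rewrite pnatr_eq0.
set A := residue th a b + (th / 2)%:M.
have A0 : (A *m v) 0 0 = (a + th / 2) * v 0 0 + b * v 1 0.
  by rewrite mulmx_col2 !mxE /= !(mulr1n, mulr0n, addr0).
have A1 : (A *m v) 1 0 = (th ^+ 2 / 4 - a ^+ 2) / b * v 0 0 + (- a + th / 2) * v 1 0.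
  by rewrite mulmx_col2 !mxE /= !(mulr1n, mulr0n, addr0).
rewrite /eigenline /=; split=> [e|e].
  have : b * v 1 0 = - ((a + th / 2) * v 0 0).
    by apply/eqP; rewrite -addr_eq0 addrC -A0 e mxE.
  by move=> h; apply: (mulfI b0); rewrite h; field.
suff : A *m v = 0 by [].
by apply: col2P; rewrite ?A0 ?A1 e [RHS]mxE; field.
Qed.

End Residue.

Section Reducible.
Variable C : numClosedFieldType.

Lemma reducible_lower (t : C) (A0 A1 At : 'M[C]_2) :
  A0 1 0 = 0 -> A1 1 0 = 0 -> At 1 0 = 0 ->
  ~ irreducible_connection (fuchs_connection t A0 A1 At).
Proof.
move=> h0 h1 ht; set N := fuchs_connection _ _ _ _ => irr.
pose s : 'cV[{fraction {poly C}}]_2 := cv2 1 0.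
have s0 : s != 0.
  apply/eqP => /matrixP/(_ 0 0); rewrite cv20 mxE => /eqP; exact/negP/oner_neq0.
apply: (irr s s0); exists (@nabla _ (P1 C) N s 0 0).
have N10 : N 1 0 = 0.
  by rewrite /N /fuchs_connection !mxE h0 h1 ht !(rmorph0 (@ratC C)) !mulr0 !addr0 oppr0.
apply: col2P; rewrite [RHS]mxE ?cv20 ?cv21 ?mulr1 // mulr0.
rewrite /nabla mxE mulmx_col2 cv20 cv21 N10 mul0r mulr0 addr0 addr0 mxE cv21.
exact: rat_der0.
Qed.

Lemma pullback_semistable_Tu (t Q p r th0 th1 tht k0 k1 kt koo rho : C)
    (A0 A1 At : 'M[C]_2) (N : 'M[fnf (P1 C)]_2)
    (E : stalks (Ell t) 'cV[fnf (Ell t)]_2) (N' : 'M[fnf (Ell t)]_2) :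
  t != 0 -> t != 1 -> Q != 0 -> Q != 1 -> Q != t ->
  k0 = th0 -> k1 = th1 -> kt = tht -> r = rho + koo ->
  A0 = res0 th0 k0 t Q p -> A1 = res1 th1 k1 koo rho t Q p ->
  At = rest tht kt koo rho t Q p ->
  N = fuchs_connection t A0 A1 At -> irreducible_connection N ->
  elliptic_pullback (@trivial_bundle _ (P1 C)) N
    (@trivial_line _ (P1 C) (Some 0) (eigenline A0 th0))
    (@trivial_line _ (P1 C) (Some 1) (eigenline A1 th1))
    (@trivial_line _ (P1 C) (Some t) (eigenline At tht))
    (@trivial_line _ (P1 C) None (@line_0_1 C)) E N' ->
  semistable E /\ Tu_invariant E (if p == 0 then None else Some (Q + r / p)).
Proof.
move=> t0 t1 Q0 Q1 Qt hk0 hk1 hkt rE hA0 hA1 hAt hN hirr hE.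
have q1 : Q - 1 != 0 by rewrite subr_eq0.
have qt : Q - t != 0 by rewrite subr_eq0.
have t1' : t - 1 != 0 by rewrite subr_eq0.
have n4 : (4 : C) != 0 by rewrite pnatr_eq0.
have n2 : (2 : C) != 0 by rewrite pnatr_eq0.
pose M : {poly C} := p%:P * 'X^2 + (p * (Q - t - 1) + r)%:P * 'X
    + (p * (Q - 1) * (Q - t))%:P.
have ME a : M.[a] = p * a ^+ 2 + (p * (Q - t - 1) + r) * a + p * (Q - 1) * (Q - t).
  by rewrite /M !hornerE.
have pr : (p != 0) || (r != 0).
  apply/negPn/negP; rewrite negb_or !negbK => /andP[/eqP p0 /eqP r0].
  (* For [p = r = 0] each [a_i] is [- theta_i / 2], so all entries
     [c_i = (theta_i^2 / 4 - a_i^2) / b_i] vanish. *)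
  move: hirr; rewrite hN; apply: reducible_lower.
  - by rewrite hA0 mxE /= p0 hk0; field; rewrite ?t0 ?Q0.
  - by rewrite hA1 mxE /= p0 hk1 -rE r0; field; rewrite ?t1' ?q1.
  - by rewrite hAt mxE /= p0 hkt -rE r0; field; rewrite ?t0 ?t1' ?qt.
(* The slopes are [p (Q - 1) (Q - t)] at 0, [p Q (Q - t) + r] at 1 and [p Q (Q - 1) + r t] at [t],
   the values of [M] there. *)
have hL0 a : eigenline A0 th0 a <-> a 1 0 = M.[0] * a 0 0.
  rewrite hA0 eigenline_residue; last by rewrite oppr_eq0 mulf_neq0 ?invr_eq0.
  by rewrite (_ : - _ = M.[0]) // ME hk0; field; rewrite ?t0 ?Q0.
have hL1 a : eigenline A1 th1 a <-> a 1 0 = M.[1] * a 0 0.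
  rewrite hA1 eigenline_residue; last by rewrite mulf_neq0 ?invr_eq0.
  by rewrite (_ : - _ = M.[1]) // ME hk1 -rE; field; rewrite ?t1' ?q1.
have hLt a : eigenline At tht a <-> a 1 0 = M.[t] * a 0 0.
  rewrite hAt eigenline_residue; last by rewrite oppr_eq0 !mulf_neq0 ?invr_eq0 ?mulf_neq0.
  by rewrite (_ : - _ = M.[t]) // ME hkt -rE; field; rewrite ?t0 ?t1' ?qt.
have [zeta [_ eE _]] := hE.
have hEP P v : E P v <-> @twisted_lattice _ t (ell_field t) (ellx t) (ellY t) (@ell_der _ t)
  (horner M) P v.
  by rewrite eE; apply: (tens_twisted t0 t1 hL0 hL1 hLt (erefl _)).
have [ss [w [ew hram htu]]] := twisted_Tu t0 t1 (erefl (cubic t)) (ellx_cubic t) (@ellx_free _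
  t) (@ellx_frac _ t) pr hEP.
split; first exact: ss.
exists w; split; first exact: ew.
case: hram => [ram|iso]; last by left; exact: iso.
case: htu => [iso|ext]; [by left; exact: iso | right; split; last exact: ext].
case: w {ew ext} ram => [ab|] ram; last by rewrite !inE eqxx !orbT.
by case: (ramified_pt (ram ab erefl)) => ->; rewrite !inE eqxx ?orbT.
Qed.

End Reducible.

Theorem corollary10 (R : realType)
    (th0 th1 tht thoo k0 k1 kt koo rho : R[i])
    (hk0 : k0 = th0) (hk1 : k1 = th1) (hkt : kt = tht) (hkoo : koo = thoo - 1)
    (hrho : k0 + k1 + kt + koo + 2 * rho = 1)
    (D : set R[i]) (q : R[i] -> R[i])
    (hq : PVI_solution k0 k1 kt koo D q)
    (t : R[i]) (htD : D t) (hq0 : q t <> 0) (hq1 : q t <> 1) (hqt : q t <> t)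
    (p : R[i]) (hp : p = PVI_p th0 th1 tht q t)
    (A0 A1 At : 'M[R[i]]_2)
    (hA0 : A0 = res0 th0 k0 t (q t) p)
    (hA1 : A1 = res1 th1 k1 koo rho t (q t) p)
    (hAt : At = rest tht kt koo rho t (q t) p)
    (hAoo : - (A0 + A1 + At) <> 0)
    (N : 'M[fnf (P1 R[i])]_2) (hN : N = fuchs_connection t A0 A1 At)
    (hirr : irreducible_connection N)
    (E'' : stalks (Ell t) 'cV[fnf (Ell t)]_2) (N'' : 'M[fnf (Ell t)]_2)
    (hE : elliptic_pullback (@trivial_bundle _ (P1 R[i])) N
            (@trivial_line _ (P1 R[i]) (Some 0) (eigenline A0 th0))
            (@trivial_line _ (P1 R[i]) (Some 1) (eigenline A1 th1))
            (@trivial_line _ (P1 R[i]) (Some t) (eigenline At tht))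
            (@trivial_line _ (P1 R[i]) None (@line_0_1 R[i]))
            E'' N'') :
  semistable E'' /\
  Tu_invariant E'' (if p == 0 then None else Some (q t + (rho + koo) / p)).
Proof.
have [t0 t1 _ _ _] := hq.2 t htD.
apply: (pullback_semistable_Tu (r := rho + koo) _ _ _ _ _ hk0 hk1 hkt erefl hA0 hA1 hAt hN hirr hE);
  exact/eqP.
Qed.
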